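(* Let $A$ be a finite abelian group. Let $\Gamma$ be a residually finite group of finite type which satisfies a cosystolic inequality in dimension $2$ with respect to the family of all finite transitive $\Gamma$-actions and $A$. If $\alpha\in\mathrm H^2(\Gamma,A)$ classifies a central extension $1\to A\to\tilde\Gamma\to\Gamma\to1$ such that $\tilde\Gamma$ is not residually finite, then $$0\ne\theta^{\mathrm P}_*(\alpha)\in\mathrm H^2(\Gamma,\mathrm P(A))$$ whenever the measured $\Gamma$-Boolean algebra $\mathrm P$ is weakly contained in the family of finite $\Gamma$-actions. In particular, this holds for $\mathrm P=\mathrm M(\hat\Gamma)$.
   Context: **Measured Boolean algebras.** A measured Boolean algebra $(\mathrm P,\mu)$ is a Boolean algebra with a map $\mu\colon\mathrm P\to[0,1]$ with $\mu(X\cup Y)+\mu(X\cap Y)=\mu(X)+\mu(Y)$, $\mu(0)=0$, $\mu(1)=1$; put $d(X,Y)=\mu(X\cup Y)-\mu(X\cap Y)$. A measured $\Gamma$-Boolean algebra carries in addition a measure-preserving $\Gamma$-action by Boolean automorphisms. A finite action is a finite measured $\Gamma$-Boolean algebra; a finite transitive action is the algebra of all subsets of $\Gamma/\Lambda$ with normalized counting measure, $\Lambda\le\Gamma$ of finite index. $\hat\Gamma$ is the profinite completion of $\Gamma$ with Haar probability measure and left-translation action of $\Gamma$, and $\mathrm M(\hat\Gamma)$ its measure algebra (measurable sets modulo null sets). For a finite abelian group $A$, $\mathrm P(A)$ is the abelian group generated by symbols $X\otimes a$ ($X\in\mathrm P$, $a\in A$) subject to $X\otimes a+Y\otimes b=(X\setminus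 Y)\otimes a+(Y\setminus X)\otimes b+(X\cap Y)\otimes(a+b)$. Every $x\in\mathrm P(A)$ is uniquely $\sum_{a\ne0}X_a\otimes a$ with pairwise disjoint $X_a$; put $\mu(x)=\sum_{a\ne0}\mu(X_a)$. $\mathrm P(A)$ is a $\mathbb Z[\Gamma]$-module. The map $\theta^{\mathrm P}\colon A\to\mathrm P(A)$, $a\mapsto1\otimes a$, induces $\theta^{\mathrm P}_*\colon\mathrm H^i(\Gamma,A)\to\mathrm H^i(\Gamma,\mathrm P(A))$. **Cosystolic inequality.** $\Gamma$ is of finite type if it has a finite classifying space $B\Gamma=E\Gamma/\Gamma$ with $E\Gamma$ a contractible simplicial complex with free simplicial $\Gamma$-action; fix such a model and faithful probability measures $\nu_i$ on the sets $B\Gamma(i)$ of $i$-simplices. For $c\in\mathrm C^i(B\Gamma,\mathrm P(A))=\hom_{\mathbb Z\Gamma}(\mathrm C_i(E\Gamma),\mathrm P(A))$ put $\|c\|=\sum_{x\in B\Gamma(i)}\mu(c(\tilde x))\nu_i(x)$ ($\tilde x\in E\Gamma(i)$ any lift of $x$), and for $\beta\in\mathrm H^i(\Gamma,\mathrm P(A))=\mathrm H^i(B\Gamma,\mathrm P(A))$ let $|||\beta|||$ be the infimum of $\|c\|$ over cocycles $c$ representing $\beta$. $\Gamma$ satisfies a cosystolic inequality in dimension $i$ with respect to a family $\mathcal P$ and $A$ if there is $\varepsilon>0$ with $|||\beta|||\ge\varepsilon$ for all nonzero $\beta\in\mathrm H^i(B\Gamma,\mathrm P(A))$ and all $\mathrm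 P\in\mathcal P$ (independent of the choices of model and $\nu_i$). **Weak containment.** For measured $\Gamma$-Boolean algebras $(\mathrm P_j,\mu_j)_{j\in I}$ and a non-principal ultrafilter $\mathcal U$ on $I$, the metric ultraproduct is $\mathrm P_{\mathcal U}=\prod_j\mathrm P_j/\sim$ with $(X_j)\sim(Y_j)$ iff $\lim_{j\to\mathcal U}d_j(X_j,Y_j)=0$, measure $\mu_{\mathcal U}([X_j]_j)=\lim_{j\to\mathcal U}\mu_j(X_j)$ and the induced $\Gamma$-action. $(\mathrm P,\mu)$ is contained in $(\mathrm Q,\nu)$ if there is a measure-preserving $\Gamma$-equivariant homomorphism of Boolean algebras $\mathrm P\to\mathrm Q$; it is weakly contained in a family if it is contained in a metric ultraproduct of members of that family. *)

(* Defs.v *)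
From HB Require Import structures.
From mathcomp Require Import all_boot all_order all_algebra.
From mathcomp Require Import perm finmap generic_quotient ring_quotient.
From mathcomp Require Import freeg.
From mathcomp Require Import all_classical all_reals all_analysis.
From mathcomp Require Import ring lra.
Import Order.Theory GRing.Theory Num.Theory.
Import numFieldNormedType.Exports.

Set Implicit Arguments.
Unset Strict Implicit.
Unset Printing Implicit Defensive.

Local Open Scope classical_set_scope.
Local Open Scope ring_scope.
Local Open Scope quotient_scope.

HB.factory Record isBooleanAlgebra (d : Order.disp_t) T of Choice T := {
  meet : T -> T -> T;
  join : T -> T -> T;
  compl : T -> T;
  bot : T;
  top : T;
  meetC : commutative meet;
  joinC : commutative join;
  meetA : associative meet;
  joinA : associative join;
  joinKI : forall y x : T, meet x (join x y) = x;
  meetKU : forall y x : T, join x (meet x y) = x;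
  meetUl : left_distributive meet join;
  meet0x : forall x, meet bot x = bot;
  meetx1 : forall x, meet x top = x;
  joinxC : forall x, join x (compl x) = top;
  meetxC : forall x, meet x (compl x) = bot;
}.

HB.builders Context d T of isBooleanAlgebra d T.

Fact meetxx : idempotent_op meet.
Proof. by move=> x; rewrite -{2}(meetKU x x) joinKI. Qed.

HB.instance Definition _ := Order.isMeetJoinDistrLattice.Build d T
  (fun x y => erefl (meet x y == x))
  (fun x y => erefl ((y != x) && (meet x y == x)))
  meetC joinC meetA joinA joinKI meetKU meetUl meetxx.

Fact le0x (x : T) : (bot <= x)%O.
Proof. by apply/eqP/meet0x. Qed.

Fact lex1 (x : T) : (x <= top)%O.
Proof. by apply/eqP/meetx1. Qed.

HB.instance Definition _ := Order.hasBottom.Build d T le0x.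
HB.instance Definition _ := Order.hasTop.Build d T lex1.
HB.instance Definition _ := Order.TBDistrLattice_hasComplement.Build d T
  joinxC meetxC.

HB.end.

Definition is_action (G : groupType) (T : Type) (act : G -> T -> T) :=
  (forall x, act 1%g x = x) /\ (forall g h x, act (g * h)%g x = act g (act h x)).

Record bool_hom d d' (P : ctbDistrLatticeType d) (Q : ctbDistrLatticeType d')
    (f : P -> Q) : Prop := BoolHom {
  bool_homI : forall X Y, f (X `&` Y)%O = (f X `&` f Y)%O;
  bool_homU : forall X Y, f (X `|` Y)%O = (f X `|` f Y)%O;
  bool_homC : forall X, f (~` X)%O = (~` f X)%O;
  bool_hom0 : f \bot%O = \bot%O;
  bool_hom1 : f \top%O = \top%O }.

Record is_bool_measure (R : realType) d (P : ctbDistrLatticeType d)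
    (mu : P -> R) : Prop := IsBoolMeasure {
  bmu_ge0 : forall X, 0 <= mu X;
  bmu_le1 : forall X, mu X <= 1;
  bmuUI : forall X Y, mu (X `|` Y)%O + mu (X `&` Y)%O = mu X + mu Y;
  bmu0 : mu \bot%O = 0;
  bmu1 : mu \top%O = 1 }.

Record mgba (R : realType) (G : groupType) := MGBA {
  mgba_disp : Order.disp_t;
  mgba_sort :> ctbDistrLatticeType mgba_disp;
  mu : mgba_sort -> R;
  mact : G -> mgba_sort -> mgba_sort;
  mu_measure : is_bool_measure mu;
  mact_action : is_action mact;
  mact_hom : forall g, bool_hom (mact g);
  mu_act : forall g X, mu (mact g X) = mu X }.

Definition mdist (R : realType) (G : groupType) (P : mgba R G) (X Y : P) : R :=
  mu (X `|` Y)%O - mu (X `&` Y)%O.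

Section Separated.
Variables (R : realType) (G : groupType) (P : mgba R G).
Implicit Types X Y Z : P.

Lemma mu_split X Y : mu X = mu (X `&` Y)%O + mu (X `\` Y)%O.
Proof.
have := bmuUI (mu_measure P) (X `&` Y)%O (X `\` Y)%O.
rewrite joinIB => <-.
suff -> : ((X `&` Y) `&` (X `\` Y))%O = \bot%O :> P.
  by rewrite (bmu0 (mu_measure P)) addr0.
by rewrite -meetA [(Y `&` _)%O]diffKI meetx0.
Qed.

Lemma le_mu X Y : (X <= Y)%O -> mu X <= mu Y.
Proof.
move=> XY; rewrite (mu_split Y X) meetC (meet_idPl XY).
by rewrite lerDl (bmu_ge0 (mu_measure P)).
Qed.

Lemma le_muU X Y : mu (X `|` Y)%O <= mu X + mu Y.
Proof.
by rewrite -(bmuUI (mu_measure P)) lerDl (bmu_ge0 (mu_measure P)).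
Qed.

Lemma mdistE X Y : mdist X Y = mu (X `\` Y)%O + mu (Y `\` X)%O.
Proof.
have := bmuUI (mu_measure P) X Y; rewrite /mdist.
rewrite (mu_split X Y) (mu_split Y X) [(Y `&` X)%O]meetC.
set a := mu _; set b := mu _ => e.
have -> : a = (b + mu (X `\` Y)%O + (b + mu (Y `\` X)%O)) - b by rewrite -e addrK.
ring.
Qed.

Definition null_le X Y := mu (X `\` Y)%O = 0.

Lemma mdist_eq0 X Y : mdist X Y = 0 <-> null_le X Y /\ null_le Y X.
Proof.
rewrite mdistE; split=> [|[-> ->]]; last by rewrite addr0.
move/eqP; rewrite paddr_eq0 ?(bmu_ge0 (mu_measure P)) // => /andP[/eqP ? /eqP ?].
by split.
Qed.

Lemma mu_null_le X Y : (X <= Y)%O -> mu Y = 0 -> mu X = 0.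
Proof.
move=> /le_mu XY Y0; apply/eqP.
by rewrite eq_le (bmu_ge0 (mu_measure P)) -Y0 XY.
Qed.

Lemma mu_nullU X Y : mu X = 0 -> mu Y = 0 -> mu (X `|` Y)%O = 0.
Proof.
move=> X0 Y0; apply/eqP; rewrite eq_le (bmu_ge0 (mu_measure P)) andbT.
by have := le_muU X Y; rewrite X0 Y0 addr0.
Qed.

Lemma null_le_refl X : null_le X X.
Proof. by rewrite /null_le diffxx (bmu0 (mu_measure P)). Qed.

Lemma le_diffU X Y : (X <= Y `|` (X `\` Y))%O.
Proof. by rewrite -leBLR. Qed.

Lemma null_le_trans Y X Z : null_le X Y -> null_le Y Z -> null_le X Z.
Proof.
move=> XY YZ; apply: mu_null_le (mu_nullU XY YZ).
rewrite leBLR joinC -joinA; apply: le_trans (le_diffU X Y) _.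
rewrite joinC leU2 // joinC; exact: le_diffU.
Qed.

Lemma null_leI X Y X' Y' : null_le X Y -> null_le X' Y' ->
  null_le (X `&` X')%O (Y `&` Y')%O.
Proof.
move=> XY XY'; apply: mu_null_le (mu_nullU XY XY').
rewrite leBLR joinIl leI2 //.
  by apply: le_trans (le_diffU X Y) _; rewrite leU2 // leUl.
by apply: le_trans (le_diffU X' Y') _; rewrite leU2 // leUr.
Qed.

Lemma null_leU X Y X' Y' : null_le X Y -> null_le X' Y' ->
  null_le (X `|` X')%O (Y `|` Y')%O.
Proof.
move=> XY XY'; apply: mu_null_le (mu_nullU XY XY').
rewrite leBLR joinACA leU2 //; exact: le_diffU.
Qed.

Lemma null_leC X Y : null_le X Y -> null_le (~` Y)%O (~` X)%O.
Proof. by rewrite /null_le !diffE complK meetC. Qed.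

Definition sep_rel X Y := mdist X Y == 0.

Lemma sep_relP X Y : reflect (null_le X Y /\ null_le Y X) (sep_rel X Y).
Proof. by apply: (iffP eqP) => /mdist_eq0. Qed.

Lemma sep_rel_equiv : equiv_class_of sep_rel.
Proof.
split=> [X|X Y|Y X Z].
- by apply/sep_relP; split; exact: null_le_refl.
- by apply/sep_relP/sep_relP => -[].
- move=> /sep_relP[a b] /sep_relP[c d]; apply/sep_relP.
  by split; [exact: null_le_trans a c|exact: null_le_trans d b].
Qed.

Canonical sep_equiv := EquivRelPack sep_rel_equiv.

Definition sep_type := {eq_quot sep_rel}.
HB.instance Definition _ := Choice.on sep_type.
HB.instance Definition _ := Quotient.on sep_type.

Local Notation "[ X ]s" := (\pi_sep_type X).

Lemma sep_eqP X Y : [X]s = [Y]s <-> null_le X Y /\ null_le Y X.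
Proof.
split; first by move/eqmodP/sep_relP.
by move=> XY; apply/eqmodP/sep_relP.
Qed.

Lemma sep_repr X : null_le (repr [X]s) X /\ null_le X (repr [X]s).
Proof. by apply/sep_eqP; rewrite reprK. Qed.

Definition sep_meet (x y : sep_type) := [(repr x `&` repr y)%O]s.
Definition sep_join (x y : sep_type) := [(repr x `|` repr y)%O]s.
Definition sep_compl (x : sep_type) := [(~` repr x)%O]s.

Lemma pi_meet X Y : sep_meet [X]s [Y]s = [(X `&` Y)%O]s.
Proof.
have [a b] := sep_repr X; have [c d] := sep_repr Y.
by apply/sep_eqP; split; exact: null_leI.
Qed.

Lemma pi_join X Y : sep_join [X]s [Y]s = [(X `|` Y)%O]s.
Proof.
have [a b] := sep_repr X; have [c d] := sep_repr Y.
by apply/sep_eqP; split; exact: null_leU.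
Qed.

Lemma pi_compl X : sep_compl [X]s = [(~` X)%O]s.
Proof. by have [a b] := sep_repr X; apply/sep_eqP; split; exact: null_leC. Qed.

Fact sep_meetC : commutative sep_meet.
Proof. by elim/quotW=> X; elim/quotW=> Y; rewrite !pi_meet meetC. Qed.
Fact sep_joinC : commutative sep_join.
Proof. by elim/quotW=> X; elim/quotW=> Y; rewrite !pi_join joinC. Qed.
Fact sep_meetA : associative sep_meet.
Proof.
elim/quotW=> X; elim/quotW=> Y; elim/quotW=> Z.
by rewrite (pi_meet Y Z) (pi_meet X Y) !pi_meet meetA.
Qed.
Fact sep_joinA : associative sep_join.
Proof.
elim/quotW=> X; elim/quotW=> Y; elim/quotW=> Z.
by rewrite (pi_join Y Z) (pi_join X Y) !pi_join joinA.
Qed.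
Fact sep_joinKI y x : sep_meet x (sep_join x y) = x.
Proof.
by elim/quotW: x => X; elim/quotW: y => Y; rewrite pi_join pi_meet joinKI.
Qed.
Fact sep_meetKU y x : sep_join x (sep_meet x y) = x.
Proof.
by elim/quotW: x => X; elim/quotW: y => Y; rewrite pi_meet pi_join meetKU.
Qed.
Fact sep_meetUl : left_distributive sep_meet sep_join.
Proof.
elim/quotW=> X; elim/quotW=> Y; elim/quotW=> Z.
rewrite (pi_join X Y) (pi_meet X Z) (pi_meet Y Z) (pi_join (X `&` Z)%O).
by rewrite pi_meet meetUl.
Qed.
Fact sep_meet0x x : sep_meet [\bot%O]s x = [\bot%O]s.
Proof. by elim/quotW: x => X; rewrite pi_meet meet0x. Qed.
Fact sep_meetx1 x : sep_meet x [\top%O]s = x.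
Proof. by elim/quotW: x => X; rewrite pi_meet meetx1. Qed.
Fact sep_joinxC x : sep_join x (sep_compl x) = [\top%O]s.
Proof. by elim/quotW: x => X; rewrite pi_compl pi_join joinxC. Qed.
Fact sep_meetxC x : sep_meet x (sep_compl x) = [\bot%O]s.
Proof. by elim/quotW: x => X; rewrite pi_compl pi_meet meetxC. Qed.

HB.instance Definition _ := isBooleanAlgebra.Build (mgba_disp P) sep_type
  sep_meetC sep_joinC sep_meetA sep_joinA sep_joinKI sep_meetKU sep_meetUl
  sep_meet0x sep_meetx1 sep_joinxC sep_meetxC.

Definition sep_mu (x : sep_type) : R := mu (repr x).
Definition sep_act (g : G) (x : sep_type) : sep_type := [mact g (repr x)]s.

Lemma pi_mu X : sep_mu [X]s = mu X.
Proof.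
have [a b] := sep_repr X; rewrite /sep_mu.
by rewrite (mu_split (repr _) X) (mu_split X (repr [X]s)) a b meetC.
Qed.

Lemma null_le_act g X Y : null_le X Y -> null_le (mact g X) (mact g Y).
Proof.
have h := mact_hom P g.
by rewrite /null_le !diffE -(bool_homC h) -(bool_homI h) mu_act.
Qed.

Lemma pi_act g X : sep_act g [X]s = [mact g X]s.
Proof.
by have [a b] := sep_repr X; apply/sep_eqP; split; exact: null_le_act.
Qed.

Lemma pi_sepI X Y : ([X]s `&` [Y]s)%O = [(X `&` Y)%O]s.
Proof. exact: pi_meet. Qed.
Lemma pi_sepU X Y : ([X]s `|` [Y]s)%O = [(X `|` Y)%O]s.
Proof. exact: pi_join. Qed.
Lemma pi_sepC X : (~` [X]s)%O = [(~` X)%O]s.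
Proof. exact: pi_compl. Qed.

Fact sep_measure : is_bool_measure sep_mu.
Proof.
have m := mu_measure P; split=> [x|x|||].
- exact: bmu_ge0 m _.
- exact: bmu_le1 m _.
- elim/quotW=> X; elim/quotW=> Y.
  by rewrite pi_sepI pi_sepU !pi_mu (bmuUI m).
- by rewrite pi_mu (bmu0 m).
- by rewrite pi_mu (bmu1 m).
Qed.

Fact sep_action : is_action sep_act.
Proof.
have [a1 aM] := mact_action P; split=> [|g h]; elim/quotW=> X.
  by rewrite pi_act a1.
by rewrite (pi_act h) !pi_act aM.
Qed.

Fact sep_hom g : bool_hom (sep_act g).
Proof.
have h := mact_hom P g; split.
- elim/quotW=> X; elim/quotW=> Y.
  by rewrite pi_sepI !pi_act pi_sepI (bool_homI h).
- elim/quotW=> X; elim/quotW=> Y.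
  by rewrite pi_sepU !pi_act pi_sepU (bool_homU h).
- by elim/quotW=> X; rewrite pi_sepC !pi_act pi_sepC (bool_homC h).
- by rewrite [LHS]pi_act (bool_hom0 h).
- by rewrite [LHS]pi_act (bool_hom1 h).
Qed.

Fact sep_mu_act g x : sep_mu (sep_act g x) = sep_mu x.
Proof. by elim/quotW: x => X; rewrite pi_act !pi_mu mu_act. Qed.

Definition separated : mgba R G :=
  MGBA sep_measure sep_action sep_hom sep_mu_act.

End Separated.

Section Ultraproduct.
Variables (R : realType) (G : groupType) (I : Type) (U : set_system I).
Variable UU : UltraFilter U.
Variable P : I -> mgba R G.

Definition prod_type := forall j, P j.
HB.instance Definition _ := gen_eqMixin prod_type.
HB.instance Definition _ := gen_choiceMixin prod_type.
Implicit Types X Y Z : prod_type.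

Definition prod_meet X Y : prod_type := fun j => (X j `&` Y j)%O.
Definition prod_join X Y : prod_type := fun j => (X j `|` Y j)%O.
Definition prod_compl X : prod_type := fun j => (~` X j)%O.
Definition prod_bot : prod_type := fun j => \bot%O.
Definition prod_top : prod_type := fun j => \top%O.

Fact prod_meetC : commutative prod_meet.
Proof. by move=> X Y; apply: functional_extensionality_dep => j; exact: meetC. Qed.
Fact prod_joinC : commutative prod_join.
Proof. by move=> X Y; apply: functional_extensionality_dep => j; exact: joinC. Qed.
Fact prod_meetA : associative prod_meet.
Proof. by move=> X Y Z; apply: functional_extensionality_dep => j; exact: meetA. Qed.
Fact prod_joinA : associative prod_join.
Proof. by move=> X Y Z; apply: functional_extensionality_dep => j; exact: joinA. Qed.
Fact prod_joinKI Y X : prod_meet X (prod_join X Y) = X.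
Proof. by apply: functional_extensionality_dep => j; exact: joinKI. Qed.
Fact prod_meetKU Y X : prod_join X (prod_meet X Y) = X.
Proof. by apply: functional_extensionality_dep => j; exact: meetKU. Qed.
Fact prod_meetUl : left_distributive prod_meet prod_join.
Proof. by move=> X Y Z; apply: functional_extensionality_dep => j; exact: meetUl. Qed.
Fact prod_meet0x X : prod_meet prod_bot X = prod_bot.
Proof. by apply: functional_extensionality_dep => j; exact: meet0x. Qed.
Fact prod_meetx1 X : prod_meet X prod_top = X.
Proof. by apply: functional_extensionality_dep => j; exact: meetx1. Qed.
Fact prod_joinxC X : prod_join X (prod_compl X) = prod_top.
Proof. by apply: functional_extensionality_dep => j; exact: joinxC. Qed.
Fact prod_meetxC X : prod_meet X (prod_compl X) = prod_bot.
Proof. by apply: functional_extensionality_dep => j; exact: meetxC. Qed.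

HB.instance Definition _ := isBooleanAlgebra.Build Order.default_display prod_type
  prod_meetC prod_joinC prod_meetA prod_joinA prod_joinKI prod_meetKU
  prod_meetUl prod_meet0x prod_meetx1 prod_joinxC prod_meetxC.

Definition prod_mu X : R := lim (mu (X j) @[j --> U]).
Definition prod_act (g : G) X : prod_type := fun j => mact g (X j).

Lemma prod_mu_cvg X : mu (X j) @[j --> U] --> prod_mu X.
Proof.
apply/cvg_ex.
have UF : UltraFilter (mu (X j) @[j --> U]).
  split; first by apply: fmap_proper_filter; exact: ultra_proper.
  move=> F FF sF; apply/seteqP; split=> // A FA /=.
  have [//|nA] := in_ultra_setVsetC ((fun j => mu (X j)) @^-1` A) UU.
  by have /filter_ex[x []] : F (A `&` ~` A) by apply: (@filterI _ F _ _ _ FA); exact: (sF (~` A) nA).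
have := @segment_compact R 0 1; rewrite compact_ultra => /(_ _ UF) [].
  suff : U [set j | mu (X j) \in `[0, 1]] by [].
  apply: filterE => j /=; rewrite in_itv /=; apply/andP.
  by have m := mu_measure (P j); split; [exact: bmu_ge0|exact: bmu_le1].
by move=> l [_ Fl]; exists l.
Qed.

Lemma prod_mu_eq X l : mu (X j) @[j --> U] --> l -> prod_mu X = l.
Proof. exact/cvg_lim/Rhausdorff. Qed.

Fact prod_measure : is_bool_measure prod_mu.
Proof.
split=> [X|X|X Y||].
- apply: limr_ge; first by apply/cvg_ex; eexists; exact: prod_mu_cvg.
  by apply: nearW => j; exact: bmu_ge0 (mu_measure _) _.
- apply: limr_le; first by apply/cvg_ex; eexists; exact: prod_mu_cvg.
  by apply: nearW => j; exact: bmu_le1 (mu_measure _) _.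
- have FU : ProperFilter U := @ultra_proper _ _ UU.
  have a := @cvgD _ _ _ U FU _ _ _ _ (@prod_mu_cvg (X `|` Y)%O) (@prod_mu_cvg (X `&` Y)%O).
  have b := @cvgD _ _ _ U FU _ _ _ _ (@prod_mu_cvg X) (@prod_mu_cvg Y).
  rewrite -(cvg_lim (@Rhausdorff R) b); apply/esym/(cvg_lim (@Rhausdorff R)).
  apply: cvg_trans a; apply: near_eq_cvg.
  by apply: nearW => j; exact: (bmuUI (mu_measure (P j))).
- apply: prod_mu_eq; apply: (@cvg_near_cst _ _ _ _ _ (@ultra_proper _ _ UU)).
  by apply: nearW => j; rewrite (bmu0 (mu_measure (P j))).
- apply: prod_mu_eq; apply: (@cvg_near_cst _ _ _ _ _ (@ultra_proper _ _ UU)).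
  by apply: nearW => j; rewrite (bmu1 (mu_measure (P j))).
Qed.

Fact prod_action : is_action prod_act.
Proof.
split=> [X|g h X]; apply: functional_extensionality_dep => j.
  exact: (mact_action (P j)).1.
exact: (mact_action (P j)).2.
Qed.

Fact prod_hom g : bool_hom (prod_act g).
Proof.
split=> [X Y|X Y|X||]; apply: functional_extensionality_dep => j.
- exact: bool_homI (mact_hom (P j) g) _ _.
- exact: bool_homU (mact_hom (P j) g) _ _.
- exact: bool_homC (mact_hom (P j) g) _.
- exact: bool_hom0 (mact_hom (P j) g).
- exact: bool_hom1 (mact_hom (P j) g).
Qed.

Fact prod_mu_act g X : prod_mu (prod_act g X) = prod_mu X.
Proof. by congr (lim (_ @ U)); apply/funext => j; exact: mu_act. Qed.

(* By linearity of the limit the distance on [prod_mgba] is lim_U d_j. *)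
Definition prod_mgba : mgba R G :=
  MGBA prod_measure prod_action prod_hom prod_mu_act.

Definition ultraproduct : mgba R G := separated prod_mgba.

End Ultraproduct.

Definition nonprincipal (I : Type) (U : set_system I) := forall j : I, ~ U [set j].

Definition contained (R : realType) (G : groupType) (P Q : mgba R G) : Prop :=
  exists f : P -> Q,
    [/\ bool_hom f, (forall X, mu (f X) = mu X) &
        (forall g X, f (mact g X) = mact g (f X))].

Definition weakly_contained (R : realType) (G : groupType) (P : mgba R G)
    (F : mgba R G -> Prop) : Prop :=
  exists (I : Type) (U : set_system I) (UU : UltraFilter U) (Q : I -> mgba R G),
    [/\ nonprincipal U, (forall j, F (Q j)) & contained P (ultraproduct UU Q)].

Definition finite_mgba (R : realType) (G : groupType) (P : mgba R G) : Prop :=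
  finite_set [set: P].

Definition lcoset (G : groupType) (g : G) (L : set G) : set G :=
  [set (g * h)%g | h in L].

Record is_subgroup (G : groupType) (L : set G) : Prop := IsSubgroup {
  subg1 : L 1%g;
  subgM : forall g h, L g -> L h -> L (g * h)%g;
  subgV : forall g, L g -> L (g^-1)%g }.

Definition lcosets (G : groupType) (L : set G) : set (set G) :=
  [set lcoset g L | g in [set: G]].

Record finite_index_subgroup (G : groupType) := FiniteIndexSubgroup {
  fis_set :> set G;
  fis_subgroup : is_subgroup fis_set;
  fis_finite : finite_set (lcosets fis_set) }.

Definition residually_finite (G : groupType) : Prop :=
  forall g : G, g <> 1%g -> exists L : finite_index_subgroup G, ~ (L : set G) g.

Section Transitive.
Variables (R : realType) (G : groupType) (L : finite_index_subgroup G).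

Definition coset_space : Type := lcosets L.

Lemma lcosetM (g h : G) (A : set G) : lcoset (g * h)%g A = lcoset g (lcoset h A).
Proof.
apply/seteqP; split=> [_ [x Ax <-]|_ [_ [x Ax <-] <-]].
  by exists (h * x)%g; [exists x|rewrite mulgA].
by exists x; rewrite ?mulgA.
Qed.

Lemma lcoset1 (A : set G) : lcoset 1%g A = A.
Proof.
apply/seteqP; split=> [_ [x Ax <-]|x Ax]; first by rewrite mul1g.
by exists x; rewrite ?mul1g.
Qed.

Lemma translate_subproof (g : G) (C : coset_space) :
  lcoset g (val C) \in lcosets L.
Proof.
case: C => C /=; rewrite inE => -[h _ <-]; rewrite inE.
by exists (g * h)%g; rewrite ?lcosetM.
Qed.

Definition translate (g : G) (C : coset_space) : coset_space :=
  exist (fun D => D \in lcosets L) _ (translate_subproof g C).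

Lemma translate1 C : translate 1%g C = C.
Proof. by apply/val_inj; rewrite /= lcoset1. Qed.

Lemma translateM g h C : translate (g * h)%g C = translate g (translate h C).
Proof. by apply/val_inj; rewrite /= lcosetM. Qed.

Lemma finite_coset_space (S : set coset_space) : finite_set S.
Proof.
apply: (@sub_finite_set _ _ (val @^-1` lcosets L)).
  by move=> [C CL] _ /=; move: CL; rewrite inE.
apply: finite_preimage (fis_finite L).
by move=> x y _ _; exact: val_inj.
Qed.

Definition coset_card (S : set coset_space) : R := #|` fset_set S|%:R.

Definition coset_mu (S : set coset_space) : R :=
  coset_card S / coset_card [set: coset_space].

(* gS, written as the preimage of S under translation by g^-1 *)
Definition coset_act (g : G) (S : set coset_space) : set coset_space :=
  translate g^-1%g @^-1` S.

Lemma coset_card_gt0 : 0 < coset_card [set: coset_space].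
Proof.
rewrite ltr0n cardfs_gt0; apply/fset0Pn.
have H : lcoset 1%g L \in lcosets L by rewrite inE; exists 1%g.
by exists (exist (fun D => D \in lcosets L) _ H : coset_space); rewrite in_fset_set ?inE //; exact: finite_coset_space.
Qed.

Lemma coset_cardUI S T :
  coset_card (S `|` T) + coset_card (S `&` T) = coset_card S + coset_card T.
Proof.
have f := finite_coset_space.
by rewrite /coset_card -!natrD fset_setU // fset_setI // cardfsUI.
Qed.

Lemma coset_card_le S T : S `<=` T -> coset_card S <= coset_card T.
Proof.
move=> ST; rewrite ler_nat; apply: fsubset_leq_card.
have f := finite_coset_space.
by apply/fsubsetP => x; rewrite !in_fset_set // !inE; exact: ST.
Qed.

Fact coset_measure : is_bool_measure coset_mu.
Proof.
have c0 := coset_card_gt0; split=> [S|S|S T||].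
- by rewrite divr_ge0 // ler0n.
- by rewrite ler_pdivrMr // mul1r coset_card_le.
- rewrite /coset_mu -!mulrDl; congr (_ / _); exact: coset_cardUI.
- by rewrite /coset_mu /coset_card [\bot%O]/(@set0 coset_space) fset_set0 cardfs0 mul0r.
- by rewrite /coset_mu divff // gt_eqF.
Qed.

Fact coset_action : is_action coset_act.
Proof.
split=> [S|g h S]; apply/seteqP; split=> C; rewrite /coset_act /=.
- by rewrite invg1 translate1.
- by rewrite invg1 translate1.
- by rewrite invgM translateM.
- by rewrite invgM translateM.
Qed.

Fact coset_hom g : bool_hom (coset_act g).
Proof. by split. Qed.

Fact coset_mu_act g S : coset_mu (coset_act g S) = coset_mu S.
Proof.
have f := finite_coset_space.
congr (_ / _); rewrite /coset_card; congr _%:R.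
have -> : fset_set S = [fset translate g^-1%g C | C in fset_set (coset_act g S)]%fset.
  apply/fsetP => C; apply/idP/imfsetP => [|[D /=]]; rewrite !in_fset_set // !inE.
    move=> SC; exists (translate g C); last by rewrite -translateM mulVg translate1.
    by rewrite in_fset_set // inE /coset_act /= -translateM mulVg translate1.
  by move=> SD ->.
rewrite card_imfset //= => C D /(congr1 (translate g)).
by rewrite -!translateM mulgV !translate1.
Qed.

Definition transitive_mgba : mgba R G :=
  MGBA coset_measure coset_action coset_hom coset_mu_act.

End Transitive.

Definition finite_transitive_mgba (R : realType) (G : groupType)
    (P : mgba R G) : Prop :=
  exists L : finite_index_subgroup G, P = transitive_mgba R L.

Record finite_index_normal (G : groupType) := FiniteIndexNormal {
  fin_fis :> finite_index_subgroup G;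
  fin_normal : forall g h : G,
    (fin_fis : set G) h -> (fin_fis : set G) (g^-1 * h * g)%g }.

Section Profinite.
Variable G : groupType.
Implicit Types (N M : finite_index_normal G) (g h : G).

(* Points of the inverse limit of the quotients G/N, [x N] being the component
   of x in G/N, a coset of N. *)
Record profinite := Profinite {
  prof_val :> finite_index_normal G -> set G;
  prof_coset : forall N, lcosets N (prof_val N);
  prof_compat : forall N M, (N : set G) `<=` M -> prof_val N `<=` prof_val M }.

HB.instance Definition _ := gen_eqMixin profinite.
HB.instance Definition _ := gen_choiceMixin profinite.

Lemma profinite_eq (x y : profinite) : (forall N, x N = y N) -> x = y.
Proof.
case: x y => [x cx tx] [y cy ty] /= /funext xy; subst y.
by rewrite (Prop_irrelevance cx cy) (Prop_irrelevance tx ty).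
Qed.

Lemma lcoset_mul N g h :
  [set (a * b)%g | a in lcoset g N & b in lcoset h N] = lcoset (g * h)%g N.
Proof.
have S := fis_subgroup N; apply/seteqP; split.
  move=> _ [_ [n Nn <-]] [_ [m Nm <-]] <-.
  exists (h^-1 * n * h * m)%g.
    by apply: subgM => //; exact: fin_normal.
  by rewrite !mulgA mulgK.
move=> _ [n Nn <-]; exists g; first by exists 1%g; [exact: subg1|rewrite mulg1].
by exists (h * n)%g; [exists n|rewrite mulgA].
Qed.

Definition prof_mul (x y : profinite) : profinite.
Proof.
apply: (@Profinite (fun N => [set (a * b)%g | a in x N & b in y N])).
- move=> N; have [g _ <-] := prof_coset x N; have [h _ <-] := prof_coset y N.
  by exists (g * h)%g => //; rewrite lcoset_mul.
- move=> N M NM _ [a xa] [b yb] <-.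
  by exists a; [exact: prof_compat NM _ xa|
    exists b => //; exact: prof_compat NM _ yb].
Defined.

Definition prof_of (g : G) : profinite.
Proof.
apply: (@Profinite (fun N => lcoset g N)).
- by move=> N; exists g.
- by move=> N M NM _ [n Nn <-]; exists n => //; exact: NM.
Defined.

HB.instance Definition _ := isPointed.Build profinite (prof_of 1%g).

Lemma prof_of_mul g h (x : profinite) :
  prof_mul (prof_of (g * h)%g) x = prof_mul (prof_of g) (prof_mul (prof_of h) x).
Proof.
apply: profinite_eq => N /=; have [k _ <-] := prof_coset x N.
by rewrite !lcoset_mul mulgA.
Qed.

Lemma prof_of_1 (x : profinite) : prof_mul (prof_of 1%g) x = x.
Proof.
apply: profinite_eq => N /=; have [k _ <-] := prof_coset x N.
by rewrite !lcoset_mul mul1g.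
Qed.

(* The topology induced by the product of the discrete groups G/N. *)
Definition prof_open (V : set profinite) : Prop :=
  forall x, V x -> exists2 D : set (finite_index_normal G), finite_set D &
    forall y : profinite, (forall N, D N -> y N = x N) -> V y.

Fact prof_openT : prof_open setT.
Proof. by move=> x _; exists set0. Qed.

Fact prof_openI : setI_closed prof_open.
Proof.
move=> V W oV oW x [Vx Wx].
have [D fD DV] := oV _ Vx; have [E fE EW] := oW _ Wx.
exists (D `|` E); first by rewrite finite_setU.
by move=> y xy; split; [apply: DV|apply: EW] => N h; apply: xy; [left|right].
Qed.

Fact prof_open_bigU (I : Type) (f : I -> set profinite) :
  (forall i, prof_open (f i)) -> prof_open (\bigcup_i f i).
Proof.
move=> of_ x [i _ fx]; have [D fD Df] := of_ i _ fx.
by exists D => // y /Df fy; exists i.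
Qed.

HB.instance Definition _ := isOpenTopological.Build profinite
  prof_openT prof_openI prof_open_bigU.

Definition borel_profinite := g_sigma_algebraType (@open profinite).
HB.instance Definition _ := Measurable.on borel_profinite.

Lemma prof_translate_open g (V : set profinite) :
  open V -> open (prof_mul (prof_of g) @^-1` V).
Proof.
move=> oV; suff : prof_open (prof_mul (prof_of g) @^-1` V) by [].
have {}oV : prof_open V by [].
move=> x Vx; have [D fD DV] := oV _ Vx; exists D => // y xy.
by apply: DV => N /xy /= ->.
Qed.

Lemma prof_translate_measurable g (E : set borel_profinite) :
  measurable E -> measurable (prof_mul (prof_of g) @^-1` E : set borel_profinite).
Proof.
have m : measurable_fun setT (prof_mul (prof_of g) : borel_profinite -> borel_profinite).
  refine (@measurability _ _ borel_profinite borel_profinite setT _ (@open profinite) _ _).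
    by [].
  move=> _ [V oV <-]; rewrite setTI.
  by apply: sub_sigma_algebra; exact: prof_translate_open.
by move=> mE; have := m measurableT E mE; rewrite setTI.
Qed.

Lemma prof_translateE g (E : set profinite) :
  prof_mul (prof_of g^-1%g) @^-1` E = prof_mul (prof_of g) @` E.
Proof.
apply/seteqP; split=> [x Ex|_ [x Ex <-]] /=.
  by exists (prof_mul (prof_of g^-1%g) x); rewrite // -prof_of_mul mulgV prof_of_1.
by rewrite -prof_of_mul mulVg prof_of_1.
Qed.

End Profinite.

(* The Haar measure of the compact group [profinite G] is the left-invariant
   Borel probability measure. *)
Definition is_haar (R : realType) (G : groupType)
    (m : probability (borel_profinite G) R) : Prop :=
  forall (x : profinite G) (E : set (borel_profinite G)),
    measurable E -> m (prof_mul x @` E) = m E.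

Section MeasureAlgebra.
Variables (R : realType) (G : groupType).
Variables (m : probability (borel_profinite G) R) (mH : is_haar m).

Record borel_set := BorelSet {
  borel_val :> set (borel_profinite G);
  borel_measurable : measurable borel_val }.

HB.instance Definition _ := gen_eqMixin borel_set.
HB.instance Definition _ := gen_choiceMixin borel_set.

Lemma borel_eq (E F : borel_set) : (E : set _) = F -> E = F.
Proof.
case: E F => [E mE] [F mF] /= EF; subst F.
by rewrite (Prop_irrelevance mE mF).
Qed.

Definition borelI (E F : borel_set) : borel_set :=
  BorelSet (measurableI _ _ (borel_measurable E) (borel_measurable F)).
Definition borelU (E F : borel_set) : borel_set :=
  BorelSet (measurableU _ _ (borel_measurable E) (borel_measurable F)).
Definition borelC (E : borel_set) : borel_set :=
  BorelSet (measurableC (borel_measurable E)).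
Definition borel0 : borel_set := BorelSet measurable0.
Definition borelT : borel_set := BorelSet measurableT.

Fact borelIC : commutative borelI.
Proof. by move=> E F; apply: borel_eq; exact: setIC. Qed.
Fact borelUC : commutative borelU.
Proof. by move=> E F; apply: borel_eq; exact: setUC. Qed.
Fact borelIA : associative borelI.
Proof. by move=> E F H; apply: borel_eq; exact: setIA. Qed.
Fact borelUA : associative borelU.
Proof. by move=> E F H; apply: borel_eq; exact: setUA. Qed.
Fact borelKI F E : borelI E (borelU E F) = E.
Proof. by apply: borel_eq; rewrite /= setUC setKU. Qed.
Fact borelKU F E : borelU E (borelI E F) = E.
Proof. by apply: borel_eq; rewrite /= setIC setKI. Qed.
Fact borelIUl : left_distributive borelI borelU.
Proof. by move=> E F H; apply: borel_eq; exact: setIUl. Qed.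
Fact borel0I E : borelI borel0 E = borel0.
Proof. by apply: borel_eq; exact: set0I. Qed.
Fact borelIT E : borelI E borelT = E.
Proof. by apply: borel_eq; exact: setIT. Qed.
Fact borelUCr E : borelU E (borelC E) = borelT.
Proof. by apply: borel_eq; exact: setUCr. Qed.
Fact borelICr E : borelI E (borelC E) = borel0.
Proof. by apply: borel_eq; exact: setICr. Qed.

HB.instance Definition _ := isBooleanAlgebra.Build set_display borel_set
  borelIC borelUC borelIA borelUA borelKI borelKU borelIUl borel0I borelIT
  borelUCr borelICr.

Definition borel_mu (E : borel_set) : R := fine (m E).

(* gE, written as the preimage of E under translation by g^-1 *)
Definition borel_act (g : G) (E : borel_set) : borel_set :=
  BorelSet (prof_translate_measurable g^-1%g (borel_measurable E)).

Fact borel_measure : is_bool_measure borel_mu.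
Proof.
have fin (E : borel_set) : m E \is a fin_num by apply: fin_num_measure; case: E.
split=> [E|E|E F||]; rewrite /borel_mu.
- by rewrite fine_ge0.
- rewrite -lee_fin fineK //; apply: probability_le1; exact: borel_measurable.
- rewrite -!fineD //; congr fine.
  have mE := borel_measurable E; have mF := borel_measurable F.
  rewrite [(E `|` F)%O : set _]/(borel_val E `|` borel_val F).
  rewrite measureUfinl //; last by rewrite ltey_eq fin.
  by rewrite subeK //; apply: (fin (E `&` F)%O).
- by rewrite measure0.
- by have -> : m (\top%O : borel_set) = 1%E by exact: probability_setT.
Qed.

Fact borel_action : is_action borel_act.
Proof.
split=> [E|g h E]; apply: borel_eq; apply/seteqP; split=> x /=.
- by rewrite invg1 prof_of_1.
- by rewrite invg1 prof_of_1.
- by rewrite invgM prof_of_mul.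
- by rewrite invgM prof_of_mul.
Qed.

Fact borel_hom g : bool_hom (borel_act g).
Proof. by split=> *; exact: borel_eq. Qed.

Fact borel_mu_act g E : borel_mu (borel_act g E) = borel_mu E.
Proof.
rewrite /borel_mu /= prof_translateE; congr fine.
by apply: mH; exact: borel_measurable.
Qed.

Definition borel_mgba : mgba R G :=
  MGBA borel_measure borel_action borel_hom borel_mu_act.

(* Borel sets suffice: every Haar-measurable set is Borel up to a null set. *)
Definition haar_mgba : mgba R G := separated borel_mgba.

End MeasureAlgebra.

Record gmodule (G : groupType) := GModule {
  gm_sort :> zmodType;
  gm_act : G -> gm_sort -> gm_sort;
  gm_action : is_action gm_act;
  gm_actB : forall g, {morph gm_act g : x y / x - y} }.

Record gmod_hom (G : groupType) (M N : gmodule G) := GModHom {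
  gh_fun :> M -> N;
  ghB : {morph gh_fun : x y / x - y};
  gh_equivariant : forall g x, gh_fun (gm_act g x) = gm_act g (gh_fun x) }.

Definition trivial_gmodule (G : groupType) (A : zmodType) : gmodule G.
Proof. by apply: (@GModule G A (fun _ a => a)); split. Defined.

(* The n-cochains form the subgroup [cochain n] of an ambient group. *)
Record cochain_complex := CochainComplex {
  ambient : nat -> zmodType;
  cochain : forall n, set (ambient n);
  codiff : forall n, ambient n -> ambient n.+1;
  cochain0 : forall n, @cochain n 0;
  cochainB : forall n x y, @cochain n x -> @cochain n y -> @cochain n (x - y);
  codiffB : forall n, {morph @codiff n : x y / x - y} }.
Arguments cochain : clear implicits.
Arguments codiff K {n} x : rename.

Section Cohomology.
Variables (K : cochain_complex) (n : nat).

Lemma codiff0 m : codiff K (0 : ambient K m) = 0.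
Proof. by rewrite -(subrr 0) codiffB !subrr. Qed.

Definition cocycle_pred : {pred ambient K n} :=
  [pred c | `[< cochain K n c /\ codiff K c = 0 >]].

Fact cocycle_zmod_closed : zmod_closed cocycle_pred.
Proof.
split=> [|x y]; first by apply/asboolP; split; [exact: cochain0|exact: codiff0].
move=> /asboolP[Cx dx] /asboolP[Cy dy]; apply/asboolP.
by split; [exact: cochainB|rewrite codiffB dx dy subrr].
Qed.

HB.instance Definition _ :=
  GRing.isZmodClosed.Build (ambient K n) cocycle_pred cocycle_zmod_closed.

Record cocycle := Cocycle {
  cocycle_val :> ambient K n;
  cocycleP : cocycle_val \in cocycle_pred }.

HB.instance Definition _ := [isSub for cocycle_val].
HB.instance Definition _ := [Choice of cocycle by <:].
HB.instance Definition _ := [SubChoice_isSubZmodule of cocycle by <:].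

Definition is_coboundary : ambient K n -> Prop :=
  match n return ambient K n -> Prop with
  | 0 => fun c => c = 0
  | m.+1 => fun c => exists2 b, cochain K m b & c = codiff K b
  end.

Definition coboundary_pred : {pred cocycle} :=
  [pred z | `[< is_coboundary (cocycle_val z) >]].

Fact coboundary_zmod_closed : zmod_closed coboundary_pred.
Proof.
have [h0 hB] : is_coboundary 0 /\
    (forall x y, is_coboundary x -> is_coboundary y -> is_coboundary (x - y)).
  rewrite /is_coboundary; case: n => [|m].
    by split=> // x y -> ->; rewrite subrr.
  split=> [|_ _ [b Cb ->] [c Cc ->]].
    by exists 0; [exact: cochain0|rewrite codiff0].
  by exists (b - c); [exact: cochainB|rewrite codiffB].
split=> [|x y /asboolP bx /asboolP yb]; first exact/asboolP.
by apply/asboolP; exact: hB.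
Qed.

HB.instance Definition _ :=
  GRing.isZmodClosed.Build cocycle coboundary_pred coboundary_zmod_closed.

Definition cohomology : zmodType := Quotient.quot coboundary_pred.

Definition cohom_class (z : cocycle) : cohomology :=
  \pi_(Quotient.quot coboundary_pred) z.

End Cohomology.

(* The i-th face of an ordered simplex omits the vertex i. *)
Definition face (T : Type) (n : nat) (i : 'I_n.+2) (v : {ffun 'I_n.+2 -> T}) :
  {ffun 'I_n.+1 -> T} := [ffun j => v (fintype.lift i j)].

(* Homogeneous cochains, i.e. Hom_{Z[G]}(Z[G^{n+1}], M). *)
Section BarComplex.
Variables (G : groupType) (M : gmodule G).

Definition bar_ambient (n : nat) : zmodType := {ffun 'I_n.+1 -> G} -> M.

Definition bar_cochain n : set (bar_ambient n) :=
  [set c | forall (g : G) (v : {ffun 'I_n.+1 -> G}),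
    c [ffun i => (g * v i)%g] = gm_act g (c v)].

Definition bar_codiff n (c : bar_ambient n) : bar_ambient n.+1 :=
  fun v => \sum_(i < n.+2) c (face i v) *~ (-1) ^+ i.

Fact gm_act0 (N : gmodule G) (g : G) : gm_act g (0 : N) = 0.
Proof. by rewrite -(subrr 0) gm_actB !subrr. Qed.

Fact bar_cochain0 n : bar_cochain (0 : bar_ambient n).
Proof. by move=> g v; rewrite gm_act0. Qed.

Fact bar_cochainB n (x y : bar_ambient n) :
  bar_cochain x -> bar_cochain y -> bar_cochain (x - y).
Proof.
move=> Cx Cy g v; rewrite (_ : forall w, (x - y) w = x w - y w) //.
by rewrite (_ : forall w, (x - y) w = x w - y w) // gm_actB -Cx -Cy.
Qed.

Fact bar_codiffB n : {morph @bar_codiff n : x y / x - y}.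
Proof.
move=> x y; apply/funext => v.
transitivity (bar_codiff x v - bar_codiff y v) => //; rewrite -sumrB.
by apply: eq_bigr => i _; rewrite -mulrzBl.
Qed.

Definition bar_complex : cochain_complex :=
  CochainComplex bar_cochain0 bar_cochainB bar_codiffB.

Definition group_cohomology (n : nat) : zmodType := cohomology bar_complex n.

End BarComplex.

Section BarMap.
Variables (G : groupType) (M N : gmodule G) (f : gmod_hom M N) (n : nat).

Lemma gh0 : f 0 = 0.
Proof. by rewrite -(subrr 0) ghB !subrr. Qed.

HB.instance Definition _ := GRing.isZmodMorphism.Build M N f (ghB f).

Lemma bar_codiff_map m (c : bar_ambient M m) :
  bar_codiff ((f : M -> N) \o c : bar_ambient N m) =
  (f : M -> N) \o bar_codiff c.
Proof.
apply/funext => v; rewrite /bar_codiff /= raddf_sum.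
by apply: eq_bigr => i _; rewrite raddfMz.
Qed.

Fact bar_map_subproof (z : cocycle (bar_complex M) n) :
  ((f : M -> N) \o (cocycle_val z : bar_ambient M n) : bar_ambient N n)
    \in @cocycle_pred (bar_complex N) n.
Proof.
have /asboolP[Cz dz] := cocycleP z; apply/asboolP; split.
  by move=> g v /=; rewrite -gh_equivariant; congr (f _); exact: Cz.
by rewrite [LHS]bar_codiff_map [bar_codiff _]dz; apply/funext => v /=; exact: gh0.
Qed.

Definition bar_map (z : cocycle (bar_complex M) n) : cocycle (bar_complex N) n :=
  Cocycle (bar_map_subproof z).

Definition cohom_map (x : group_cohomology M n) : group_cohomology N n :=
  cohom_class (bar_map (repr (x : Quotient.quot (@coboundary_pred (bar_complex M) n)))).

Lemma bar_map_coboundary (x : ambient (bar_complex M) n) :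
  is_coboundary x ->
  is_coboundary ((f : M -> N) \o (x : bar_ambient M n) :
    ambient (bar_complex N) n).
Proof.
case: n x => [x ->|m x [b Cb ->]]; first by apply/funext => v /=; exact: gh0.
exists ((f : M -> N) \o (b : bar_ambient M m)); last exact/esym/bar_codiff_map.
by move=> g v /=; rewrite -gh_equivariant; congr (f _); exact: Cb.
Qed.

Lemma cohom_mapE (z : cocycle (bar_complex M) n) :
  cohom_map (cohom_class z) = cohom_class (bar_map z).
Proof.
apply/eqP; rewrite -Quotient.idealrBE; apply/asboolP.
set w := repr _.
have /asboolP/bar_map_coboundary h : w - z \in @coboundary_pred (bar_complex M) n.
  by rewrite Quotient.idealrBE reprK.
rewrite [X in is_coboundary X](_ : _ = (f : M -> N) \o
  (cocycle_val (w - z) : bar_ambient M n)) //.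
by apply/funext => v; exact/esym/ghB.
Qed.

End BarMap.

Section SubgroupSpan.
Variables (V : zmodType) (S : set V).

Definition subgroup_of (T : set V) : Prop :=
  T 0 /\ (forall x y, T x -> T y -> T (x - y)).

Definition span_pred : {pred V} :=
  [pred x | `[< forall T : set V, subgroup_of T -> S `<=` T -> T x >]].

Fact span_zmod_closed : zmod_closed span_pred.
Proof.
split=> [|x y /asboolP Sx /asboolP Sy]; apply/asboolP => T TT ST.
  exact: TT.1.
by apply: TT.2; [exact: Sx|exact: Sy].
Qed.

HB.instance Definition _ := GRing.isZmodClosed.Build V span_pred span_zmod_closed.

End SubgroupSpan.

Section PA.
Variables (R : realType) (G : groupType) (P : mgba R G) (A : finZmodType).

Definition free_PA : zmodType := {freeg (P * A)%type / int}.

Definition PA_gen (X : P) (a : A) : free_PA := << (X, a) >>.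

Definition PA_rel : set free_PA :=
  [set r | exists X Y a b,
    r = PA_gen X a + PA_gen Y b -
        (PA_gen (X `\` Y)%O a + PA_gen (Y `\` X)%O b +
         PA_gen (X `&` Y)%O (a + b))].

Definition PA_sort : zmodType := Quotient.quot (span_pred PA_rel).

Definition PA_proj (x : free_PA) : PA_sort :=
  \pi_(Quotient.quot (span_pred PA_rel)) x.

Definition tensor (X : P) (a : A) : PA_sort := PA_proj (PA_gen X a).

Lemma PA_projB : {morph PA_proj : x y / x - y}.
Proof. by move=> x y; rewrite /PA_proj raddfB. Qed.

Lemma PA_projD : {morph PA_proj : x y / x + y}.
Proof. by move=> x y; rewrite /PA_proj raddfD. Qed.

Lemma PA_proj_eq x y : PA_proj x = PA_proj y <-> x - y \in span_pred PA_rel.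
Proof. by rewrite Quotient.idealrBE; split=> /eqP. Qed.

Lemma tensorD X Y a b : tensor X a + tensor Y b =
  tensor (X `\` Y)%O a + tensor (Y `\` X)%O b + tensor (X `&` Y)%O (a + b).
Proof.
rewrite -!PA_projD; apply/PA_proj_eq/asboolP => T _; apply.
by exists X, Y, a, b.
Qed.

Definition free_act (g : G) : free_PA -> free_PA :=
  fglift (fun p : P * A => << (mact g p.1, p.2) >> : {freeg (P * A)%type / int}).

Lemma free_actB g : {morph free_act g : x y / x - y}.
Proof. exact: lift_is_additive. Qed.

Lemma free_actD g : {morph free_act g : x y / x + y}.
Proof.
have h0 : free_act g 0 = 0 by rewrite -(subrr 0) free_actB !subrr.
move=> x y; rewrite -[y in LHS]opprK free_actB -[- y]add0r free_actB h0 add0r.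
by rewrite opprK.
Qed.

Lemma free_act_gen g X a : free_act g (PA_gen X a) = PA_gen (mact g X) a.
Proof. by rewrite /free_act liftU scale1r. Qed.

Lemma free_PA_ind (Q : free_PA -> Prop) :
  Q 0 -> (forall x y, Q x -> Q y -> Q (x - y)) ->
  (forall X a, Q (PA_gen X a)) -> forall x, Q x.
Proof.
move=> Q0 QB Qg x.
have QN y : Q y -> Q (- y) by move=> Qy; rewrite -[- y]add0r; exact: QB.
have QD y z : Q y -> Q z -> Q (y + z).
  by move=> Qy Qz; rewrite -[z]opprK; apply: QB => //; exact: QN.
have QM y k : Q y -> Q (y *+ k).
  by move=> Qy; elim: k => [|k IH]; rewrite ?mulr0n // mulrS; exact: QD.
have Qz (k : int) y : Q y -> Q (y *~ k).
  by move=> Qy; case: k => k; rewrite ?NegzE ?mulrNz; [|apply: QN]; exact: QM.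
rewrite -(freeg_sumE x); elim/big_ind: _ => // -[X a] _.
have -> : << (coeff (X, a) x) *g (X, a) >> = PA_gen X a *~ coeff (X, a) x.
  by rewrite /PA_gen freegU_mulz intz.
by apply: Qz; exact: Qg.
Qed.

Lemma span_act g x : x \in span_pred PA_rel -> free_act g x \in span_pred PA_rel.
Proof.
move=> /asboolP/(_ [set y | free_act g y \in span_pred PA_rel]) h; apply: h.
  split=> [|y z /= Sy Sz]; last by rewrite free_actB rpredB.
  by rewrite /= -(subrr 0) free_actB subrr rpred0.
move=> _ [X [Y [a [b ->]]]] /=; have h := mact_hom P g.
rewrite free_actB !free_actD !free_act_gen !diffE !(bool_homI h) !(bool_homC h).
rewrite -!diffE; apply/asboolP => T _; apply.
by exists (mact g X), (mact g Y), a, b.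
Qed.

Definition PA_act (g : G) (x : PA_sort) : PA_sort :=
  PA_proj (free_act g (repr (x : Quotient.quot (span_pred PA_rel)))).

Lemma PA_act_proj g x : PA_act g (PA_proj x) = PA_proj (free_act g x).
Proof.
apply/PA_proj_eq; rewrite -free_actB; apply: span_act.
by apply/PA_proj_eq; rewrite /PA_proj reprK.
Qed.

Lemma PA_act_tensor g X a : PA_act g (tensor X a) = tensor (mact g X) a.
Proof. by rewrite /tensor PA_act_proj free_act_gen. Qed.

Lemma PA_surj (x : PA_sort) : exists y, x = PA_proj y.
Proof.
by exists (repr (x : Quotient.quot (span_pred PA_rel))); rewrite /PA_proj reprK.
Qed.

Fact PA_actB g : {morph PA_act g : x y / x - y}.
Proof.
move=> x y; have [x' ->] := PA_surj x; have [y' ->] := PA_surj y.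
by rewrite -PA_projB !PA_act_proj free_actB PA_projB.
Qed.

Fact PA_action : is_action PA_act.
Proof.
have h0 g : free_act g 0 = 0 by rewrite -(subrr 0) free_actB !subrr.
have [a1 aM] := mact_action P.
split=> [x|g h x]; have [y ->] := PA_surj x; rewrite !PA_act_proj; congr PA_proj.
  elim/free_PA_ind: y => [|y z IHy IHz|X a]; first exact: h0.
    by rewrite free_actB IHy IHz.
  by rewrite free_act_gen a1.
elim/free_PA_ind: y => [|y z IHy IHz|X a]; first by rewrite !h0.
  by rewrite !free_actB IHy IHz.
by rewrite !free_act_gen aM.
Qed.

Definition PA : gmodule G := GModule PA_action PA_actB.

(* x = \sum_(a != 0) X_a (x) a with pairwise disjoint X_a; X_0 is irrelevant. *)
Definition PA_normal_form (x : PA) (X : A -> P) : Prop :=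
  (forall a b, a != 0 -> b != 0 -> a != b -> (X a `&` X b)%O = \bot%O) /\
  x = \sum_(a : A | a != 0) tensor (X a) a.

(* Every x has exactly one normal form, hence exactly one such value. *)
Definition mu_PA (x : PA) : R :=
  xget 0 [set r | exists2 X, PA_normal_form x X &
                             r = \sum_(a : A | a != 0) mu (X a)].

Lemma tensor_bot a : tensor \bot%O a = 0.
Proof.
have := tensorD \bot%O \bot%O a 0.
by rewrite !diffxx meetxx addr0 -[LHS]addr0 => /addrI/esym.
Qed.

Fact thetaB : {morph tensor \top%O : a b / a - b}.
Proof.
have tD a b : tensor \top%O (a + b) = tensor \top%O a + tensor \top%O b.
  by rewrite tensorD !diffxx !tensor_bot meetxx !add0r.
by move=> a b; rewrite -[in RHS](subrK b a) [in RHS]tD addrK.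
Qed.

Fact theta_equivariant g (a : trivial_gmodule G A) :
  tensor \top%O (gm_act g a) = PA_act g (tensor \top%O a).
Proof. by rewrite PA_act_tensor (bool_hom1 (mact_hom P g)). Qed.

Definition theta : gmod_hom (trivial_gmodule G A) PA :=
  @GModHom _ (trivial_gmodule G A) PA (tensor \top%O) thetaB theta_equivariant.

End PA.

Record simplicial_complex := SimplicialComplex {
  vertex : choiceType;
  simplex :> set {fset vertex};
  simplex_neq0 : forall s, simplex s -> s != fset0;
  simplex_vertex : forall v : vertex, simplex [fset v]%fset;
  simplex_sub : forall s t, simplex s -> (t `<=` s)%fset -> t != fset0 ->
    simplex t }.

Section Realization.
Variables (R : realType) (K : simplicial_complex).

(* Points are given by their barycentric coordinates. *)
Record realization := Realization {
  bary :> vertex K -> R;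
  bary_ge0 : forall v, 0 <= bary v;
  bary_simplex : exists2 s, simplex s &
    (forall v, v \notin s -> bary v = 0) /\ \sum_(v <- enum_fset s) bary v = 1 }.

HB.instance Definition _ := gen_eqMixin realization.
HB.instance Definition _ := gen_choiceMixin realization.

Definition closed_cell (s : {fset vertex K}) : set realization :=
  [set x : realization | forall v, v \notin s -> x v = 0].

(* The weak topology: V is open iff its trace on each closed cell is open for
   the Euclidean topology of the cell. *)
Definition realization_open (V : set realization) : Prop :=
  forall s, simplex s -> forall x, closed_cell s x -> V x ->
    exists2 e : R, 0 < e & forall y, closed_cell s y ->
      (forall v, `|x v - y v| < e) -> V y.

Fact realization_openT : realization_open setT.
Proof. by move=> s _ x _ _; exists 1. Qed.

Fact realization_openI : setI_closed realization_open.
Proof.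
move=> V W oV oW s Ks x sx [Vx Wx].
have [d d0 dV] := oV _ Ks _ sx Vx; have [e e0 eW] := oW _ Ks _ sx Wx.
exists (Num.min d e); first by rewrite lt_min d0.
by move=> y sy xy; split; [apply: dV|apply: eW] => // v;
  have := xy v; rewrite lt_min => /andP[].
Qed.

Fact realization_open_bigU (I : Type) (f : I -> set realization) :
  (forall i, realization_open (f i)) -> realization_open (\bigcup_i f i).
Proof.
move=> of_ s Ks x sx [i _ fx]; have [e e0 ef] := of_ i _ Ks _ sx fx.
by exists e => // y sy xy; exists i => //; exact: ef.
Qed.

HB.instance Definition _ := isOpenTopological.Build realization
  realization_openT realization_openI realization_open_bigU.

End Realization.

Definition contractible (R : realType) (T : topologicalType) : Prop :=
  exists (x0 : T) (h : T * R -> T),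
    [/\ {within [set: T] `*` `[0, 1], continuous h},
        (forall x, h (x, 0) = x) & (forall x, h (x, 1) = x0)].

(* EG with its free action, such that BG = EG/G has finitely many simplices.
   Freeness on the realization means that no simplex is mapped to itself, even
   up to a permutation of its vertices: its barycentre would be fixed. *)
Record finite_model (R : realType) (G : groupType) := FiniteModel {
  EG :> simplicial_complex;
  EG_act : G -> vertex EG -> vertex EG;
  EG_action : is_action EG_act;
  EG_simplicial : forall g s, simplex s ->
    simplex [fset EG_act g v | v in s]%fset;
  EG_free : forall g s, simplex s -> [fset EG_act g v | v in s]%fset = s ->
    g = 1%g;
  EG_contractible : contractible R (realization R EG);
  EG_cofinite : finite_set
    [set [set [fset EG_act g v | v in s]%fset | g in [set: G]] | s in @simplex EG]
  }.

Section SimplicialCochains.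
Variables (R : realType) (G : groupType) (E : finite_model R G).

(* n-simplices of EG with an ordering of their vertices. *)
Record osimplex (n : nat) := OSimplex {
  os_val :> {ffun 'I_n.+1 -> vertex E};
  os_inj : injective os_val;
  os_simplex : @simplex E [fset os_val i | i in 'I_n.+1]%fset }.

HB.instance Definition _ n := gen_eqMixin (osimplex n).
HB.instance Definition _ n := gen_choiceMixin (osimplex n).

Definition vertices n (v : osimplex n) : {fset vertex E} :=
  [fset v i | i in 'I_n.+1]%fset.

Definition os_face n (i : 'I_n.+2) (v : osimplex n.+1) : osimplex n.
Proof.
apply: (@OSimplex n (face i v)).
- by move=> j k; rewrite !ffunE => /os_inj/lift_inj.
- apply: simplex_sub (os_simplex v) _ _.
    by apply/fsubsetP => x /imfsetP[j _ ->]; rewrite ffunE in_imfset.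
  by apply/fset0Pn; exists (face i v ord0); rewrite in_imfset.
Defined.

Definition os_perm n (s : 'S_n.+1) (v : osimplex n) : osimplex n.
Proof.
apply: (@OSimplex n [ffun i => v (s i)]).
- by move=> j k; rewrite !ffunE => /os_inj/perm_inj.
- apply: simplex_sub (os_simplex v) _ _.
    by apply/fsubsetP => x /imfsetP[j _ ->]; rewrite ffunE in_imfset.
  by apply/fset0Pn; exists ([ffun i => v (s i)] ord0); rewrite in_imfset.
Defined.

Lemma EG_act_inj g : injective (EG_act g : vertex E -> vertex E).
Proof.
have [a1 aM] := EG_action E.
by move=> x y /(congr1 (EG_act g^-1%g)); rewrite -!aM mulVg !a1.
Qed.

Definition os_act n (g : G) (v : osimplex n) : osimplex n.
Proof.
apply: (@OSimplex n [ffun i => EG_act g (v i)]).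
- by move=> j k; rewrite !ffunE => /EG_act_inj/os_inj.
- have := EG_simplicial g (os_simplex v); congr simplex.
  apply/fsetP => x; apply/imfsetP/imfsetP => /=.
    by move=> [_ /imfsetP[i _ ->] ->]; exists i; rewrite ?ffunE.
  by move=> [i _ ->]; exists (v i); rewrite ?ffunE ?in_imfset.
Defined.

(* The set BG(n) of n-simplices of BG = EG/G: ordered n-simplices of EG up to
   reordering and translation. The lift of x : BG n to EG is [repr x]. *)
Definition BG_rel n (v w : osimplex n) : bool :=
  `[< exists g, vertices w = [fset EG_act g x | x in vertices v]%fset >].

Fact BG_rel_equiv n : equiv_class_of (@BG_rel n).
Proof.
have [a1 aM] := EG_action E.
have im1 (s : {fset vertex E}) : [fset EG_act 1%g x | x in s]%fset = s.
  apply/fsetP => x; apply/imfsetP/idP => [[y /= ys ->]|xs]; first by rewrite a1.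
  by exists x; rewrite ?a1.
have imM g h (s : {fset vertex E}) : [fset EG_act (g * h)%g x | x in s]%fset =
    [fset EG_act g x | x in [fset EG_act h x | x in s]]%fset.
  apply/fsetP => x; apply/imfsetP/imfsetP => /=.
    by move=> [y ys ->]; exists (EG_act h y); rewrite ?aM ?in_imfset.
  by move=> [_ /imfsetP[y /= ys ->] ->]; exists y; rewrite ?aM.
have S v w : @BG_rel n v w -> BG_rel w v.
  move=> /asboolP[g e]; apply/asboolP; exists g^-1%g.
  by rewrite e -imM mulVg im1.
split=> [v|v w|w v u].
- by apply/asboolP; exists 1%g; rewrite im1.
- by apply/idP/idP => /S.
- move=> /asboolP[g ewv] /asboolP[h euw]; apply/asboolP.
  by exists (h * g)%g; rewrite imM -ewv.
Qed.

Canonical BG_equiv n := EquivRelPack (@BG_rel_equiv n).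

Definition BG n := {eq_quot @BG_rel n}.
HB.instance Definition _ n := Choice.on (BG n).
HB.instance Definition _ n := Quotient.on (BG n).

Variable M : gmodule G.

(* Hom_{Z[G]}(C_n(EG), M), where the oriented chain group C_n(EG) is generated
   by the ordered simplices subject to v o s = sgn(s) v. *)
Definition simp_ambient (n : nat) : zmodType := osimplex n -> M.

Definition simp_cochain n : set (simp_ambient n) :=
  [set c : osimplex n -> M |
    (forall g v, c (os_act g v) = gm_act g (c v)) /\
    (forall (s : 'S_n.+1) v, c (os_perm s v) = c v *~ (-1) ^+ s)].

Definition simp_codiff n (c : simp_ambient n) : simp_ambient n.+1 :=
  fun v => \sum_(i < n.+2) c (os_face i v) *~ (-1) ^+ i.

Fact simp_cochain0 n : simp_cochain (0 : simp_ambient n).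
Proof.
split=> [g v|s v]; first by rewrite gm_act0.
exact/esym/mul0rz.
Qed.

Fact simp_cochainB n (x y : simp_ambient n) :
  simp_cochain x -> simp_cochain y -> simp_cochain (x - y).
Proof.
have B w : (x - y) w = x w - y w by [].
move=> [gx sx] [gy sy]; split=> [g v|s v]; rewrite !B.
  by rewrite gx gy gm_actB.
by rewrite sx sy mulrzBl.
Qed.

Fact simp_codiffB n : {morph @simp_codiff n : x y / x - y}.
Proof.
move=> x y; apply/funext => v.
transitivity (simp_codiff x v - simp_codiff y v) => //; rewrite -sumrB.
by apply: eq_bigr => i _; rewrite -mulrzBl.
Qed.

Definition simp_complex : cochain_complex :=
  CochainComplex simp_cochain0 simp_cochainB simp_codiffB.

Definition model_cohomology (n : nat) : zmodType := cohomology simp_complex n.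

End SimplicialCochains.

(* BG(n) may be empty, in which case it carries no probability measure. *)
Definition faithful_probability (R : realType) (G : groupType)
    (E : finite_model R G) (nu : forall n, BG E n -> R) : Prop :=
  forall n, (forall x : BG E n, 0 < nu n x) /\
    ([set: BG E n] !=set0 -> \sum_(x \in [set: BG E n]) nu n x = 1).

Section Cosystolic.
Variables (R : realType) (G : groupType) (E : finite_model R G).
Variables (nu : forall n, BG E n -> R) (A : finZmodType).

Definition cochain_norm (P : mgba R G) n
    (c : simp_ambient E (PA P A) n) : R :=
  \sum_(x \in [set: BG E n]) mu_PA (c (repr x)) * nu x.

Definition cosystolic_norm (P : mgba R G) n
    (beta : model_cohomology E (PA P A) n) : R :=
  inf [set cochain_norm (cocycle_val z) |
         z in [set z : cocycle (simp_complex E (PA P A)) n |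
                cohom_class z = beta]].

Definition cosystolic_inequality (n : nat) (F : mgba R G -> Prop) : Prop :=
  exists2 e : R, 0 < e &
    forall P, F P -> forall beta : model_cohomology E (PA P A) n,
      beta != 0 -> e <= cosystolic_norm beta.

End Cosystolic.

Record central_extension (A : zmodType) (Gt G : groupType)
    (iota : A -> Gt) (pr : Gt -> G) : Prop := CentralExtension {
  ext_iotaD : forall a b, iota (a + b) = (iota a * iota b)%g;
  ext_iota_inj : injective iota;
  ext_central : forall a x, (iota a * x)%g = (x * iota a)%g;
  ext_prM : forall x y, pr (x * y)%g = (pr x * pr y)%g;
  ext_pr_surj : forall g, exists x, pr x = g;
  ext_exact : forall x, pr x = 1%g <-> exists a, x = iota a }.

(* The class of the extension is that of the factor set f(g, h) of a section s,
   s(g) s(h) = iota(f(g, h)) s(gh); in homogeneous terms f(g, h) = c(1, g, gh). *)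
Definition classifies (A : zmodType) (Gt G : groupType)
    (iota : A -> Gt) (pr : Gt -> G)
    (alpha : group_cohomology (trivial_gmodule G A) 2) : Prop :=
  exists (s : G -> Gt) (z : cocycle (bar_complex (trivial_gmodule G A)) 2),
    [/\ cohom_class z = alpha, (forall g, pr (s g) = g) &
        forall g h, (s g * s h)%g =
          (iota (cocycle_val z [ffun i => tnth [tuple 1; g; g * h] i])
           * s (g * h))%g].

(* Main.v *)
(* Suppose theta_*(alpha) = 0 over P. Along an equivariant map from the vertices
   of EG to G and orientations of its edges, the factor set of the extension
   becomes a simplicial 2-cocycle c of BG, and theta c = db for some simplicial
   1-cochain b with values in P(A). If P is weakly contained in the finite
   actions, lifting b to the product of the finite algebras and projecting to a
   factor gives b_j with theta c - d b_j of arbitrarily small norm. Over the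
   measure algebra of the profinite completion the same is achieved by
   approximating the Borel sets in the values of b by unions of cosets of one
   finite index normal subgroup; for this G is finitely generated, so it has only
   countably many such subgroups and the open sets are countable unions of
   cosets.
   This contradicts the cosystolic inequality once theta c is not a coboundary
   over the transitive actions, finite actions being averages of transitive ones
   over their atoms. If theta c = db over G/L, evaluating b at the base coset
   corrects the lifts of the edges of EG to Gt into a flat L-invariant system.
   Its trivialization on the contractible complex EG defines a splitting of the
   extension over L, whose image is a subgroup of finite index of Gt that misses
   the kernel A; as G is residually finite, so is Gt.
   Of the cohomology of EG only degrees 0 and 1 enter, and these are read off the
   contracting homotopy: a 1-cocycle is trivialized over the square swept out by
   an edge. *)
Require Import Defs.
From HB Require Import structures.
From mathcomp Require Import all_boot all_order all_algebra.
From mathcomp Require Import perm finmap generic_quotient ring_quotient freeg.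
From mathcomp Require Import all_classical all_reals all_analysis.
From mathcomp Require Import ring lra.
Import Order.Theory GRing.Theory Num.Theory.
Import numFieldNormedType.Exports.

Set Implicit Arguments.
Unset Strict Implicit.
Unset Printing Implicit Defensive.

Local Open Scope classical_set_scope.
Local Open Scope ring_scope.
Local Open Scope quotient_scope.

(** * Cocycles on a contractible complex *)

(** The value [mu_PA] is defined by disjoint normal forms, which homomorphisms and limits handle
    badly. Normal forms are therefore computed only over G/L, where P(A) is the group of functions
    from G/L to A and [mu_PA] measures the support. Elsewhere an element is controlled by any finite
    presentation as a sum of tensors X (x) a, with the sum of the mu X as its size. Such
    presentations can be pushed along Boolean homomorphisms, concatenated, and read coordinate by
    coordinate in an ultraproduct; over G/L their size bounds [mu_PA] from above. Evaluation at the
    base coset is Shapiro's lemma on cochains, the functions on G/L being the module coinduced from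
    L. The flat system that it yields has values in the nonabelian group Gt, but multiplication by
    the lifts s(phi v) moves it into A, so only abelian cocycles have to be trivialized on EG. There
    a 1-cocycle is read as gluing data over the open stars of the vertices. Of a path in the
    realization one then needs only which barycentric coordinates are positive. *)

Section Cousin.
Variables (R : realType) (P : R -> R -> Prop) (a b : R).
Hypothesis ab : a <= b.
Hypothesis Ploc : forall t, a <= t <= b -> exists2 d : R, 0 < d &
  forall x y, a <= x -> x <= t -> t <= y -> y <= b -> t - d < x -> y < t + d ->
    P x y.
Hypothesis Ptrans : forall x y z, a <= x -> x <= y -> y <= z -> z <= b ->
  P x y -> P y z -> P x z.

(** Continuous induction on the supremum of the t with [P a t]: compactness of the interval without
    subdivisions. It serves both to propagate equalities along a segment and to glue local objects,
    according to the choice of the relation [P]. *)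
Lemma cousin : P a b.
Proof.
pose S := [set t | a <= t <= b /\ P a t].
have Sa : S a.
  have [d d0 dP] : exists2 d : R, 0 < d & forall x y, a <= x -> x <= a -> a <= y ->
      y <= b -> a - d < x -> y < a + d -> P x y by apply: Ploc; rewrite lexx ab.
  by split; [rewrite lexx ab|apply: dP => //; lra].
have Sub : ubound S b by move=> x [/andP[]].
have hS : has_sup S by split; [exists a|exists b].
pose s := sup S.
have as_ : a <= s by exact: sup_upper_bound.
have sb : s <= b by apply: ge_sup => //; exists a.
have [|d d0 dP] := Ploc (t := s); first by rewrite as_ sb.
have [t [/andP[at_ tb] Pat] tds] : exists2 t, S t & s - d < t.
  by exact: sup_adherent.
have ts : t <= s by apply: sup_upper_bound => //; split; rewrite ?at_ ?tb.
have [sbE|sb'] := eqVneq s b.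
  by apply: Ptrans Pat _ => //; apply: dP => //; rewrite ?sbE ?lexx //; lra.
have sltb : s < b by rewrite lt_neqAle sb' sb.
(* If s < b, this point lies beyond s, inside [a, b], and within the radius d at which [Ploc]
   applies around s. *)
pose y := Num.min b (s + d / 2).
have yb : y <= b by rewrite ge_min lexx.
have sy : s < y by rewrite lt_min sltb /=; lra.
have yd : y <= s + d / 2 by rewrite ge_min lexx orbT.
have Say : S y.
  split; first by rewrite yb andbT; lra.
  by apply: Ptrans Pat _; rewrite ?(le_trans ts (ltW sy)) //; apply: dP => //; lra.
by have := sup_upper_bound hS Say; rewrite leNgt sy.
Qed.

End Cousin.

Section PulledBackCocycle.
Variables (R : realType) (K : simplicial_complex) (A : zmodType).
Variable k : vertex K -> vertex K -> A.
Hypothesis kD : forall s, simplex s -> forall u v w, u \in s -> v \in s ->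
  w \in s -> k u v + k v w = k u w.
Implicit Types (u v w : vertex K).

Lemma bary_supp (x : realization R K) : exists2 s, simplex s &
  (forall v, 0 < x v -> v \in s) /\ exists v, 0 < x v.
Proof.
have [s Ks [x0 x1]] := bary_simplex x; exists s => //; split=> [v xv|].
  by apply: contraLR xv => /x0 ->; rewrite ltxx.
apply: contrapT => nx; move: x1; rewrite big_seq big1.
  by move/esym/eqP; rewrite oner_eq0.
move=> v _; apply/eqP; rewrite eq_le bary_ge0 andbT leNgt; apply/negP => xv.
by apply: nx; exists v.
Qed.

Lemma cocycle_supp (x : realization R K) u v w : 0 < x u -> 0 < x v -> 0 < x w ->
  k u v + k v w = k u w.
Proof.
have [s Ks [sx _]] := bary_supp x => xu xv xw.
by apply: (kD Ks); exact: sx.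
Qed.

Lemma cocycle_supp0 (x : realization R K) u : 0 < x u -> k u u = 0.
Proof. by move=> xu; have /eqP := cocycle_supp xu xu xu; rewrite -subr_eq0 addrK => /eqP. Qed.

(* The preimages under H of the open stars of the vertices are open. *)
Definition star_continuous (H : R -> R -> realization R K) (a b c d : R) :=
  forall r t u, a <= r <= b -> c <= t <= d -> 0 < H r t u ->
  exists2 e : R, 0 < e & forall r' t', a <= r' <= b -> c <= t' <= d ->
    `|r' - r| < e -> `|t' - t| < e -> 0 < H r' t' u.

(* A trivialization over a rectangle of the torsor glued from the stars by k. *)
Definition trivialization (H : R -> R -> realization R K) (a b c d : R)
    (f : R -> R -> vertex K -> A) :=
  (forall r t u w, a <= r <= b -> c <= t <= d -> 0 < H r t u -> 0 < H r t w ->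
     f r t w = f r t u + k u w) /\
  (forall r t u, a <= r <= b -> c <= t <= d -> 0 < H r t u ->
     exists2 e : R, 0 < e & forall r' t', a <= r' <= b -> c <= t' <= d ->
       `|r' - r| < e -> `|t' - t| < e -> 0 < H r' t' u -> f r' t' u = f r t u).

Lemma star_continuousS H a b c d a' b' c' d' :
  a <= a' -> b' <= b -> c <= c' -> d' <= d ->
  star_continuous H a b c d -> star_continuous H a' b' c' d'.
Proof.
move=> aa bb cc dd sH r t u /andP[? ?] /andP[? ?] Hu.
have [||e e0 he] := sH _ _ _ _ _ Hu; [apply/andP; split; lra..|].
by exists e => // r' t' /andP[? ?] /andP[? ?]; apply: he; apply/andP; split; lra.
Qed.

Lemma trivializationS H f a b c d a' b' c' d' :
  a <= a' -> b' <= b -> c <= c' -> d' <= d ->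
  trivialization H a b c d f -> trivialization H a' b' c' d' f.
Proof.
move=> aa bb cc dd [f1 f2]; split.
  by move=> r t u w /andP[? ?] /andP[? ?]; apply: f1; apply/andP; split; lra.
move=> r t u /andP[? ?] /andP[? ?] Hu.
have [||e e0 he] := f2 _ _ _ _ _ Hu; [apply/andP; split; lra..|].
by exists e => // r' t' /andP[? ?] /andP[? ?]; apply: he; apply/andP; split; lra.
Qed.

Lemma star_continuousC H a b c d : star_continuous H a b c d ->
  star_continuous (fun r t => H t r) c d a b.
Proof.
move=> sH r t u hr ht Hu; have [e e0 he] := sH _ _ _ ht hr Hu.
by exists e => // r' t' *; apply: he.
Qed.

Lemma trivializationC H a b c d f : trivialization H a b c d f ->
  trivialization (fun r t => H t r) c d a b (fun r t => f t r).
Proof.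
move=> [f1 f2]; split=> [r t u w hr ht|r t u hr ht Hu]; first exact: f1.
have [e e0 he] := f2 _ _ _ ht hr Hu.
by exists e => // r' t' *; apply: he.
Qed.

(** Two trivializations change by the same [k u w] between vertices, so their difference depends on
    the point alone. It is locally constant, hence constant along a segment; the rectangle is
    degenerate because only segments are compared. *)
Lemma trivialization_diff H a c d f g r t t' u u' :
  star_continuous H a a c d -> trivialization H a a c d f ->
  trivialization H a a c d g -> r = a ->
  c <= t <= d -> c <= t' <= d -> 0 < H r t u -> 0 < H r t' u' ->
  f r t u - g r t u = f r t' u' - g r t' u'.
Proof.
move=> sH [f1 f2] [g1 g2] ->.
have aa : a <= a <= a by rewrite lexx.
wlog tt : t t' u u' / t <= t'.
  move=> h ht ht' Hu Hu'; have [?|/ltW ?] := leP t t'; first exact: h.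
  by apply/esym; apply: h.
move=> /andP[ct td] /andP[ct' td'] Hu Hu'.
have D x v w : c <= x <= d -> 0 < H a x v -> 0 < H a x w ->
    f a x v - g a x v = f a x w - g a x w.
  move=> hx Hv Hw; rewrite (f1 _ _ v w) // (g1 _ _ v w) //.
  by rewrite opprD addrACA subrr addr0.
pose P x y := forall v w, 0 < H a x v -> 0 < H a y w ->
  f a x v - g a x v = f a y w - g a y w.
apply: (@cousin R P t t') => // [x /andP[tx xt]|x y z tx xy yz zt Pxy Pyz v w Hv Hw].
  have hx : c <= x <= d by apply/andP; split; lra.
  (* A vertex of the support at x stays in the support nearby, so both functions can be read off at
     [v0], where they are locally constant. *)
  have [_ _ [_ [v0 Hv0]]] := bary_supp (H a x).
  have [e e0 he] := sH _ _ _ aa hx Hv0.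
  have [ef ef0 hef] := f2 _ _ _ aa hx Hv0.
  have [eg eg0 heg] := g2 _ _ _ aa hx Hv0.
  pose m := Num.min e (Num.min ef eg).
  have m0 : 0 < m by rewrite !lt_min e0 ef0.
  have [me mef meg] : [/\ m <= e, m <= ef & m <= eg].
    by rewrite /m !ge_min !lexx !orbT.
  have near y v : c <= y <= d -> x - m < y -> y < x + m -> 0 < H a y v ->
      f a y v - g a y v = f a x v0 - g a x v0.
    move=> hy y1 y2 Hv.
    have ab : `|y - x| < m by rewrite ltr_norml; apply/andP; split; lra.
    have r0 z : 0 < z -> `|a - a| < z by rewrite subrr normr0.
    have Hyv0 : 0 < H a y v0 by apply: he => //; [exact: r0|lra].
    rewrite (D _ v v0) // hef //; [rewrite heg //| |].
    - exact: r0.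
    - lra.
    - exact: r0.
    - lra.
  exists m => // y z ty yx xz zt' y1 z1 v w Hv Hw.
  rewrite (near y v) ?(near z w) //; try lra; apply/andP; split; lra.
have [_ _ [_ [v0 Hv0]]] := bary_supp (H a y).
by rewrite (Pxy v v0) // (Pyz v0 w).
Qed.

(** A small rectangle is mapped into the open star of one vertex v, and there [k v] is a
    trivialization. The bounds on the four sides are separate so that [cousin] can be applied in
    either coordinate. *)
Lemma trivialization_local H a b c d r t : star_continuous H a b c d ->
  a <= r <= b -> c <= t <= d -> exists2 e : R, 0 < e &
  forall a' b' c' d', a <= a' -> a' <= r -> r <= b' -> b' <= b ->
    c <= c' -> c' <= t -> t <= d' -> d' <= d ->
    r - e < a' -> b' < r + e -> t - e < c' -> d' < t + e ->
    exists f, trivialization H a' b' c' d' f.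
Proof.
move=> sH hr ht; have [_ _ [_ [v Hv]]] := bary_supp (H r t).
have [e e0 he] := sH _ _ _ hr ht Hv; exists e => // a' b' c' d' *.
have Hv' r' t' : a' <= r' <= b' -> c' <= t' <= d' -> 0 < H r' t' v.
  move=> /andP[? ?] /andP[? ?]; apply: he.
  - by apply/andP; split; lra.
  - by apply/andP; split; lra.
  - by rewrite ltr_norml; apply/andP; split; lra.
  - by rewrite ltr_norml; apply/andP; split; lra.
exists (fun r t => k v); split=> [r' t' u w hr' ht' Hu Hw|r' t' u hr' ht' Hu].
  by rewrite (cocycle_supp (Hv' _ _ hr' ht') Hu Hw).
by exists 1.
Qed.

(** Over the common side the two differ by a constant [D], by [trivialization_diff]; adding [D] to
    the second makes them agree there. *)
Lemma trivialization_glue H a b b' c d f g : a <= b -> b <= b' ->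
  c <= d -> star_continuous H a b' c d ->
  trivialization H a b c d f -> trivialization H b b' c d g ->
  exists h, trivialization H a b' c d h.
Proof.
move=> ab bb cd sH tf tg.
have [_ _ [_ [v0 Hv0]]] := bary_supp (H b c).
pose D := f b c v0 - g b c v0.
pose h r t u := if r <= b then f r t u else g r t u + D.
have hb t u : c <= t <= d -> 0 < H b t u -> g b t u + D = f b t u.
  move=> ht Hu; rewrite /D; have -> : f b c v0 - g b c v0 = f b t u - g b t u.
    apply: (@trivialization_diff H b c d) => //; rewrite ?lexx ?cd //.
    - by apply: star_continuousS sH; lra.
    - by apply: trivializationS tf; lra.
    - by apply: trivializationS tg; lra.
  by rewrite addrC subrK.
have [f1 f2] := tf; have [g1 g2] := tg.
exists h; split=> [r t u w /andP[ar rb] ht Hu Hw|r t u /andP[ar rb] ht Hu]; rewrite /h.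
  case: (leP r b) => [rb'|br]; first by apply: f1 => //; rewrite ar.
  by rewrite (g1 _ _ u w) ?(ltW br) // addrAC.
have [rb'|br|rE] := ltgtP r b.
- have [|e e0 he] := f2 _ _ _ _ ht Hu; first by rewrite ar ltW.
  exists (Num.min e (b - r)); first by rewrite lt_min e0 subr_gt0.
  move=> r' t' /andP[ar' _] ht'; rewrite !lt_min !ltr_norml => /andP[/andP[? ?] /andP[? ?]] /andP[/andP[? ?] _] H'.
  have r'b : r' <= b by lra.
  rewrite r'b; apply: he; rewrite ?ar' ?ltr_norml //; apply/andP; split; lra.
- have [|e e0 he] := g2 _ _ _ _ ht Hu; first by rewrite ltW.
  exists (Num.min e (r - b)); first by rewrite lt_min e0 subr_gt0.
  move=> r' t' /andP[ar' rb'] ht'; rewrite !lt_min !ltr_norml => /andP[/andP[? ?] /andP[? ?]] /andP[/andP[? ?] _] H'.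
  have br' : b < r' by lra.
  rewrite leNgt br' /=; congr (_ + _).
  by apply: he; rewrite ?(ltW br') ?ltr_norml //; apply/andP; split; lra.
- subst r; have [|e e0 he] := f2 _ _ _ _ ht Hu; first by rewrite ab lexx.
  have [|e' e'0 he'] := g2 _ _ _ _ ht Hu; first by rewrite bb lexx.
  exists (Num.min e e'); first by rewrite lt_min e0.
  move=> r' t' /andP[ar' rb'] ht'; rewrite !lt_min => /andP[? ?] /andP[? ?] H'.
  case: leP => [r'b|br']; first by apply: he; rewrite ?ar'.
  by rewrite -(hb _ _ ht Hu); congr (_ + _); apply: he'; rewrite ?(ltW br').
Qed.

(** [cousin] in one coordinate inside [cousin] in the other; gluing in the second coordinate is
    gluing in the first after exchanging the two. *)
Lemma trivialization_exists H a b c d : a <= b -> c <= d ->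
  star_continuous H a b c d -> exists f, trivialization H a b c d f.
Proof.
move=> ab cd sH.
pose M c' d' := exists f, trivialization H a b c' d' f.
apply: (@cousin R M c d) => // [t /andP[ct td]|x y z cx xy yz zd [f tf] [g tg]]; last first.
  have sH' : star_continuous (fun r t => H t r) x z a b.
    by apply: star_continuousC; apply: star_continuousS sH; lra.
  have [h th] := trivialization_glue xy yz ab sH' (trivializationC tf) (trivializationC tg).
  by exists (fun r t => h t r); exact: trivializationC th.
(* At a fixed t, one strip width e works over all of [a', b']. Adjacent intervals take the minimum
   of their widths, which makes [L] transitive. *)
pose L a' b' := exists2 e : R, 0 < e & forall c' d', c <= c' -> c' <= t -> t <= d' ->
  d' <= d -> t - e < c' -> d' < t + e -> exists f, trivialization H a' b' c' d' f.
suff [e e0 he] : L a b by exists e.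
apply: (@cousin R L a b) => // [r hr|x y z ax xy yz zb [e e0 he] [e' e'0 he']].
  have [|e e0 he] := trivialization_local sH hr (t := t); first by rewrite ct.
  by exists e => // a' b' *; exists e => // c' d' *; apply: he.
exists (Num.min e e'); first by rewrite lt_min e0.
move=> c' d' cc c't td' d'd h1 h2.
have me : Num.min e e' <= e by rewrite ge_min lexx.
have me' : Num.min e e' <= e' by rewrite ge_min lexx orbT.
have [||f tf] := he c' d' cc c't td' d'd; [lra..|].
have [||g tg] := he' c' d' cc c't td' d'd; [lra..|].
apply: trivialization_glue xy yz _ _ tf tg; first lra.
by apply: star_continuousS sH; lra.
Qed.

End PulledBackCocycle.

Section Contractible.
Variables (R : realType) (K : simplicial_complex).
Hypothesis cK : contractible R (realization R K).
Implicit Types (u v w : vertex K).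

Lemma realization_eq (x y : realization R K) : (forall v, x v = y v) -> x = y.
Proof.
case: x y => [x x0 x1] [y y0 y1] /= /funext xy; subst y.
by rewrite (Prop_irrelevance x0 y0) (Prop_irrelevance x1 y1).
Qed.

Section Segment.
Variables (v w : vertex K) (vw : simplex [fset v; w]%fset) (r : R).
Hypothesis r01 : 0 <= r <= 1.

(** For v = w the two terms add up to 1, so the same formula covers the constant path at a
    vertex. *)
Definition seg_coord (u : vertex K) : R := (1 - r) *+ (u == v) + r *+ (u == w).

Fact seg_ge0 u : 0 <= seg_coord u.
Proof. by case/andP: r01 => ? ?; rewrite addr_ge0 // mulrn_wge0 //; lra. Qed.

Fact seg_simplex : exists2 s, simplex s &
  (forall u, u \notin s -> seg_coord u = 0) /\ \sum_(u <- enum_fset s) seg_coord u = 1.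
Proof.
exists [fset v; w]%fset => //; split=> [u|].
  by rewrite !inE negb_or => /andP[/negbTE uv /negbTE uw]; rewrite /seg_coord uv uw !mulr0n addr0.
have S (y : vertex K) (q : R) : y \in [fset v; w]%fset ->
    \sum_(u <- enum_fset [fset v; w]%fset) q *+ (u == y) = q.
  move=> yi; rewrite (bigD1_seq y) ?fset_uniq //= eqxx mulr1n big1 ?addr0 //.
  by move=> u /negbTE ->.
by rewrite big_split /= !S ?inE ?eqxx ?orbT // subrK.
Qed.

Definition seg : realization R K := Realization seg_ge0 seg_simplex.
End Segment.

(** Clipping turns [seg] into a function of every real r, without a proof of membership that varies
    with r; on [0, 1] it changes nothing. *)
Fact clip01 (r : R) : 0 <= Num.max 0 (Num.min r 1) <= 1.
Proof. by rewrite le_max lexx ge_max ler01 ge_min lexx orbT. Qed.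

Lemma clipE (r : R) : 0 <= r <= 1 -> Num.max 0 (Num.min r 1) = r.
Proof. by move=> /andP[r0 r1]; rewrite min_l // max_r. Qed.

(** Open stars are open in the weak topology, so joint continuity of the contraction over an edge
    becomes star continuity of the square with sides r (along the edge) and t (time). *)
Lemma contractionP : exists (x0 : realization R K) (h : realization R K -> R -> realization R K),
  [/\ forall x, h x 0 = x, forall x, h x 1 = x0 &
   forall v w (vw : simplex [fset v; w]%fset),
     star_continuous (fun r t => h (seg vw (clip01 r)) t) 0 1 0 1].
Proof.
have [x0 [h [hc h0 h1]]] := cK; exists x0, (fun x t => h (x, t)); split=> //.
move=> v w vw r t u r01 t01 hu.
pose W : set (realization R K) := [set x | 0 < x u].
have oW : open W.
  suff : realization_open W by [].
  move=> s Ks x _ Wx; exists (x u) => // y _ xy; rewrite /W /=.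
  have := xy u; rewrite ltr_norml => /andP[_]; lra.
move/subspace_continuousP: hc => hc.
have hT : ([set: realization R K] `*` `[0, 1]%classic) (seg vw (clip01 r), t).
  by split => //=; rewrite in_itv.
have := hc _ hT W (open_nbhs_nbhs (conj oW hu)).
rewrite /= nbhs_filterE /within /=.
case=> -[V B] /= [+ nB] VB; rewrite nbhsE => -[V' [oV' V'x] V'V].
have {}oV' : realization_open V' by [].
(* Weak openness is used on the closed cell of the edge only, which contains all points of the
   segment. *)
have [|e e0 he] := oV' _ vw _ _ V'x.
  by move=> y /=; rewrite !inE negb_or /seg_coord => /andP[/negbTE -> /negbTE ->]; rewrite !mulr0n addr0.
have /nbhs_ballP[e' /= e'0 he'] := nB.
exists (Num.min (e / 2) e'); first by rewrite lt_min e'0 andbT; lra.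
move=> r' t' r'01 t'01; rewrite !lt_min => /andP[re _] /andP[_ te].
have : (V `*` B) (seg vw (clip01 r'), t').
  split=> /=.
    apply: V'V; apply: he.
      by move=> y /=; rewrite !inE negb_or /seg_coord => /andP[/negbTE -> /negbTE ->]; rewrite !mulr0n addr0.
    move=> y /=; rewrite /seg_coord !clipE //.
    move: re; rewrite !ltr_norml => /andP[? ?].
    case: (y == v); case: (y == w); rewrite ?mulr0n ?mulr1n; apply/andP; split; lra.
  by apply: he'; rewrite /ball /= distrC.
by move/VB; apply; split => //=; rewrite in_itv.
Qed.

End Contractible.

Section LowDegreeAcyclicity.
Variables (R : realType) (K : simplicial_complex).
Hypothesis cK : contractible R (realization R K).
Implicit Types (u v w : vertex K).

Fact vertex_edge v : simplex [fset v; v]%fset.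
Proof. by rewrite fsetUid; exact: simplex_vertex. Qed.

(** The square swept out by an edge restricts at its two ends to the paths of the end vertices,
    taken from the degenerate squares of [vertex_edge]. Trivializations over different edges are
    compared there. *)
Lemma seg_left v w (vw : simplex [fset v; w]%fset) :
  seg vw (clip01 (0 : R)) = seg (vertex_edge v) (clip01 0).
Proof.
apply: realization_eq => u; rewrite /= /seg_coord clipE ?lexx ?ler01 //.
by rewrite subr0 !mul0rn !addr0.
Qed.

Lemma seg_right v w (vw : simplex [fset v; w]%fset) :
  seg vw (clip01 (1 : R)) = seg (vertex_edge w) (clip01 0).
Proof.
apply: realization_eq => u; rewrite /= /seg_coord !clipE ?lexx ?ler01 //.
by rewrite subrr subr0 !mul0rn add0r addr0.
Qed.

Lemma vertex_exists : exists v : vertex K, True.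
Proof.
have [x0 [h _]] := contractionP cK.
by have [_ _ [_ [v _]]] := bary_supp x0; exists v.
Qed.

(** Follow v along the contraction to x0: nearby points of the path share a vertex of their
    supports, and the vertices of one support span a simplex, so f does not change. *)
Lemma contractible_connected (T : Type) (f : vertex K -> T) :
  (forall v w, simplex [fset v; w]%fset -> f v = f w) -> forall v w, f v = f w.
Proof.
move=> fE; have [x0 [h [h0 h1 sh]]] := contractionP cK.
have supp (x : realization R K) v w : 0 < x v -> 0 < x w -> f v = f w.
  have [s Ks [sx _]] := bary_supp x => xv xw; apply/fE/(simplex_sub Ks).
    by apply/fsubsetP => u; rewrite !inE => /orP[] /eqP ->; exact: sx.
  by apply/fset0Pn; exists v; rewrite !inE eqxx.
have [_ _ [_ [v0 x0v]]] := bary_supp x0.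
suff to_v0 v : f v = f v0 by move=> v w; rewrite !to_v0.
have sH := sh v v (vertex_edge v); set H := (fun r t => _) in sH.
have i01 : 0 <= (0 : R) <= 1 by rewrite lexx ler01.
pose P (t t' : R) := forall u w, 0 < H 0 t u -> 0 < H 0 t' w -> f u = f w.
have : P 0 1; last first.
  apply; last by rewrite /H h1.
  by rewrite /H h0 /= /seg_coord clipE // eqxx mulr1n mul0rn; lra.
apply: (@cousin R P 0 1) => // [t /andP[ct td]|x y z _ _ _ _ Pxy Pyz u w Hu Hw].
  have ht : 0 <= t <= 1 by rewrite ct.
  have [_ _ [_ [u0 Hu0]]] := bary_supp (H 0 t).
  have [e e0 he] := sH _ _ _ i01 ht Hu0.
  have near (y : R) u : 0 <= y <= 1 -> t - e < y -> y < t + e -> 0 < H 0 y u ->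
      f u = f u0.
    move=> hy y1 y2 Hu; apply: supp Hu _; apply: he => //.
      by rewrite subrr normr0.
    by rewrite ltr_norml; apply/andP; split; lra.
  exists e => // y z ty yx xz zt' y1 z1 u w Hu Hw.
  by rewrite (near y u) ?(near z w) //; try lra; apply/andP; split; lra.
have [_ _ [_ [u0 Hu0]]] := bary_supp (H 0 y).
by rewrite (Pxy u u0) // (Pyz u0 w).
Qed.

Variables (A : zmodType) (k : vertex K -> vertex K -> A).
Hypothesis kD : forall s, simplex s -> forall u v w, u \in s -> v \in s ->
  w \in s -> k u v + k v w = k u w.

(** On the side t = 1 the square is constant at x0, where [k u0] is a trivialization independent of
    r. Comparison with it shows that [f r 1 u0] is constant, and that value is subtracted. *)
Lemma normalized_trivialization (H : R -> R -> realization R K) (x0 : realization R K) u0 :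
  (forall r, H r 1 = x0) -> 0 < x0 u0 -> star_continuous H 0 1 0 1 ->
  exists2 f, trivialization k H 0 1 0 1 f & forall r, 0 <= r <= 1 -> f r 1 u0 = 0.
Proof.
move=> H1 xu0 sH; have [f [f1 f2]] := trivialization_exists kD ler01 ler01 sH.
have i1 : 0 <= (1 : R) <= 1 by rewrite lexx ler01.
have i0 : 0 <= (0 : R) <= 1 by rewrite lexx ler01.
have fr r : 0 <= r <= 1 -> f r 1 u0 = f 0 1 u0.
  move=> hr; pose g (r t : R) := k u0.
  have sH' : star_continuous (fun t r => H r t) 1 1 0 1.
    by apply: star_continuousC; apply: star_continuousS sH; rewrite ?lexx ?ler01.
  have tf : trivialization k (fun t r => H r t) 1 1 0 1 (fun t r => f r t).
    apply: trivializationC.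
    by apply: (trivializationS _ _ _ _ (conj f1 f2)); rewrite ?lexx ?ler01.
  have tg : trivialization k (fun t r => H r t) 1 1 0 1 (fun t r => k u0).
    split=> [t r' u w ht hr' Hu Hw|t r' u ht hr' Hu]; last by exists 1.
    have t1 : t = 1 by apply/le_anti; rewrite andbC.
    by rewrite t1 H1 in Hu Hw *; rewrite (cocycle_supp kD xu0 Hu Hw).
  have Hu r' : 0 < H r' 1 u0 by rewrite H1.
  have := trivialization_diff sH' tf tg (erefl _) hr i0 (Hu r) (Hu 0).
  by rewrite (cocycle_supp0 kD xu0) !subr0.
exists (fun r t u => f r t u - f 0 1 u0); last by move=> r hr; rewrite fr ?subrr.
split=> [r t u w hr ht Hu Hw|r t u hr ht Hu]; first by rewrite (f1 _ _ u w) // addrAC.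
have [e e0 he] := f2 _ _ _ hr ht Hu; exists e => // r' t' *.
by rewrite he.
Qed.

(** The potential at v is the value transported from x0, normalized there by 0 at [u0], along the
    path of v back to time 0. The square over an edge compares the potentials of its two ends. *)
Lemma contractible_cocycle_trivial : exists a : vertex K -> A,
  forall v w, simplex [fset v; w]%fset -> k v w = a w - a v.
Proof.
have [x0 [h [h0 h1 sh]]] := contractionP cK.
have [_ _ [_ [u0 x0u]]] := bary_supp x0.
have i1 : 0 <= (1 : R) <= 1 by rewrite lexx ler01.
have i0 : 0 <= (0 : R) <= 1 by rewrite lexx ler01.
pose H v w (vw : simplex [fset v; w]%fset) r t := h (seg vw (clip01 r)) t.
pose good v w (vw : simplex [fset v; w]%fset) f :=
  trivialization k (H v w vw) 0 1 0 1 f /\ forall r, 0 <= r <= 1 -> f r 1 u0 = 0.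
have ex v w (vw : simplex [fset v; w]%fset) : exists f, good v w vw f.
  have [|//|f tf f1] := @normalized_trivialization (H v w vw) x0 u0 _ _ (sh v w vw).
    by move=> r; exact: h1.
  by exists f; split.
have seg_supp v w (vw : simplex [fset v; w]%fset) (r : R) : 0 <= r <= 1 ->
    (r < 1 -> 0 < H v w vw r 0 v) /\ (0 < r -> 0 < H v w vw r 0 w).
  move=> hr; have /andP[r0 r1] := hr; rewrite /H h0 /= /seg_coord clipE //.
  rewrite !eqxx !mulr1n.
  by split=> r'; case: eqP => _; rewrite ?mulr1n ?mulr0n; lra.
(* Normalized trivializations over two squares agree on a path common to both: their difference is
   constant along it and vanishes at t = 1. *)
have uniq v w (vw : simplex [fset v; w]%fset) f v' w' (vw' : simplex [fset v'; w']%fset) f' r r' u :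
    good v w vw f -> good v' w' vw' f' -> 0 <= r <= 1 -> 0 <= r' <= 1 ->
    seg vw (clip01 r) = seg vw' (clip01 r') -> 0 < H v w vw r 0 u -> f r 0 u = f' r' 0 u.
  move=> [tf f1] [tf' f1'] hr hr' E Hu.
  pose H0 (x t : R) := h (seg vw (clip01 r)) t.
  have sH0 : star_continuous H0 0 0 0 1.
    move=> x t y hx ht Hy; have [e e0 he] := sh v w vw r t y hr ht Hy.
    by exists e => // x' t' *; apply: he => //; rewrite subrr normr0.
  have t0 : trivialization k H0 0 0 0 1 (fun _ t => f r t).
    have [g1 g2] := tf; split=> [x t y z hx|x t y hx ht Hy]; first exact: g1.
    have [e e0 he] := g2 _ _ _ hr ht Hy; exists e => // x' t' *.
    by apply: he => //; rewrite subrr normr0.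
  have t0' : trivialization k H0 0 0 0 1 (fun _ t => f' r' t).
    have [g1 g2] := tf'; rewrite /H0 E; split=> [x t y z hx|x t y hx ht Hy]; first exact: g1.
    have [e e0 he] := g2 _ _ _ hr' ht Hy; exists e => // x' t' *.
    by apply: he => //; rewrite subrr normr0.
  have Hu1 : 0 < H0 0 1 u0 by rewrite /H0 h1.
  have := trivialization_diff sH0 t0 t0' (erefl 0) i0 i1 Hu Hu1.
  by rewrite f1 // f1' // subrr => /eqP; rewrite subr_eq0 => /eqP.
pose F v := sval (cid (ex v v (vertex_edge v))).
have FP v : good v v (vertex_edge v) (F v) by exact: (svalP (cid (ex v v (vertex_edge v)))).
exists (fun v => F v 0 0 v) => v w vw.
have [f gf] := ex v w vw; have [[f1 f2] _] := gf.
have hv := (seg_supp v w vw 0 i0).1 ltr01.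
have hw := (seg_supp v w vw 1 i1).2 ltr01.
rewrite -(uniq _ _ _ _ _ _ _ _ _ _ _ gf (FP v) i0 i0 (seg_left vw) hv).
rewrite -(uniq _ _ _ _ _ _ _ _ _ _ _ gf (FP w) i1 i0 (seg_right vw) hw).
(* An interior point of the edge: v carries the first half, w the second, and at m both lie in the
   support, so that the jump [k v w] is seen there. *)
pose m : R := 1 / 2; have m0 : 0 < m by rewrite /m; lra.
have m1 : m < 1 by rewrite /m; lra.
have hm : 0 <= m <= 1 by rewrite !ltW.
have const a b u : 0 <= a -> a <= b -> b <= 1 ->
    (forall r, a <= r <= b -> 0 < H v w vw r 0 u) -> f a 0 u = f b 0 u.
  move=> a0 ab b1 Hu; pose P x y := f x 0 u = f y 0 u.
  apply: (@cousin R P a b) => // [r /andP[ar rb]|x y z _ _ _ _]; last by rewrite /P => -> ->.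
  have [||e e0 he] := f2 r 0 u _ i0; [by apply/andP; split; lra|by apply: Hu; rewrite ar|].
  have near (y : R) : a <= y -> y <= b -> r - e < y -> y < r + e -> f y 0 u = f r 0 u.
    move=> ay yb y1 y2; apply: he => //; try by apply/andP; split; lra.
    - by rewrite ltr_norml; apply/andP; split; lra.
    - by rewrite subrr normr0.
    - by apply: Hu; rewrite ay.
  by exists e => // y z *; rewrite /P (near y) ?(near z) //; lra.
rewrite (const 0 m v) //; first last.
- move=> r /andP[r0 rm]; apply: (seg_supp v w vw r _).1; last lra.
  by apply/andP; split; lra.
- exact: ltW.
- exact: ltW.
rewrite -(const m 1 w) //; first last.
- move=> r /andP[r0 rm]; apply: (seg_supp v w vw r _).2; last lra.
  by apply/andP; split; lra.
- exact: ltW.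
- exact: ltW.
rewrite (f1 m 0 v w) //.
- by rewrite addrC addKr.
- exact: (seg_supp v w vw m hm).1.
- exact: (seg_supp v w vw m hm).2.
Qed.

End LowDegreeAcyclicity.

(** * The functor P(A) *)

Section PALift.
Variables (R : realType) (G : groupType) (P : mgba R G) (A : finZmodType).

Lemma tensorUI (X Y : P) (a : A) :
  tensor X a = tensor (X `&` Y)%O a + tensor (X `\` Y)%O a.
Proof.
have tX0 (Z : P) : tensor Z 0 = 0 :> PA_sort P A.
  have := tensorD Z Z (0 : A) 0; rewrite !diffxx !tensor_bot meetxx !add0r.
  by move/eqP; rewrite -subr_eq0 addrK => /eqP.
have := tensorD X (X `&` Y)%O a 0.
rewrite !tX0 !addr0 => ->.
rewrite addrC; congr (_ + tensor _ a); first by rewrite meetA meetxx.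
by rewrite diffxI diffxx join0x.
Qed.

Lemma tensorDr (X : P) (a b : A) : tensor X (a + b) = tensor X a + tensor X b.
Proof. by rewrite tensorD !diffxx !tensor_bot meetxx !add0r. Qed.

Lemma tensor0r (X : P) : tensor X 0 = 0 :> PA_sort P A.
Proof. by have := tensorDr X 0 0; rewrite addr0 -[LHS]addr0 => /addrI/esym. Qed.

Lemma tensorNr (X : P) (a : A) : tensor X (- a) = - tensor X a.
Proof. by apply/eqP; rewrite -addr_eq0 -tensorDr addNr tensor0r. Qed.

Lemma tensorBr (X : P) (a b : A) : tensor X (a - b) = tensor X a - tensor X b.
Proof. by rewrite tensorDr tensorNr. Qed.

Lemma PA_ind (Q : PA_sort P A -> Prop) :
  Q 0 -> (forall x y, Q x -> Q y -> Q (x - y)) ->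
  (forall X a, Q (tensor X a)) -> forall x, Q x.
Proof.
move=> Q0 QB Qt x; have [y ->] := PA_surj x.
elim/free_PA_ind: y => [|y z Qy Qz|X a]; last exact: Qt.
  by have -> : PA_proj 0 = 0 :> PA_sort P A by rewrite -(subrr 0) PA_projB subrr.
by rewrite PA_projB; exact: QB.
Qed.

Section Lift.
Variables (V : zmodType) (t : P -> A -> V).
Hypothesis tD : forall X Y a b, t X a + t Y b =
  t (X `\` Y)%O a + t (Y `\` X)%O b + t (X `&` Y)%O (a + b).

Definition PA_free_lift : free_PA P A -> V :=
  fglift (fun p : P * A => t p.1 p.2 : zmodule V).

Lemma PA_free_liftB : {morph PA_free_lift : x y / x - y}.
Proof.
move=> x y.
have := @lift_is_additive int (P * A)%type (zmodule V) (fun p : P * A => t p.1 p.2 : zmodule V) x y.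
exact.
Qed.

Lemma PA_free_lift_gen X a : PA_free_lift (PA_gen X a) = t X a.
Proof. by rewrite /PA_free_lift liftU scale1r. Qed.

Lemma PA_free_lift_span x : x \in span_pred (@PA_rel R G P A) -> PA_free_lift x = 0.
Proof.
have l0 : PA_free_lift 0 = 0 by rewrite -(subrr 0) PA_free_liftB subrr.
have lD : {morph PA_free_lift : y z / y + z}.
  by move=> y z; rewrite -[z in LHS]opprK PA_free_liftB -[- z]add0r PA_free_liftB l0 add0r opprK.
move=> /asboolP/(_ [set y | PA_free_lift y = 0]); apply.
  by split=> //= y z /= y0 z0; rewrite PA_free_liftB y0 z0 subrr.
move=> _ [X [Y [a [b ->]]]] /=.
by rewrite PA_free_liftB !lD !PA_free_lift_gen tD subrr.
Qed.

Definition PA_lift (x : PA_sort P A) : V :=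
  PA_free_lift (repr (x : Quotient.quot (span_pred (@PA_rel R G P A)))).

Lemma PA_lift_proj x : PA_lift (PA_proj x) = PA_free_lift x.
Proof.
apply/eqP; rewrite -subr_eq0 -PA_free_liftB; apply/eqP/PA_free_lift_span.
by apply/PA_proj_eq; rewrite /PA_proj reprK.
Qed.

Lemma PA_liftB : {morph PA_lift : x y / x - y}.
Proof.
move=> x y; have [x' ->] := PA_surj x; have [y' ->] := PA_surj y.
by rewrite -PA_projB !PA_lift_proj PA_free_liftB.
Qed.

Lemma PA_lift_tensor X a : PA_lift (tensor X a) = t X a.
Proof. by rewrite /tensor PA_lift_proj PA_free_lift_gen. Qed.

End Lift.

Lemma PA_hom_eq (V : zmodType) (f g : PA_sort P A -> V) :
  {morph f : x y / x - y} -> {morph g : x y / x - y} ->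
  (forall X a, f (tensor X a) = g (tensor X a)) -> f =1 g.
Proof.
move=> fB gB fg x; elim/PA_ind: x => [|x y ex ey|//].
  by rewrite -(subrr 0) fB gB !subrr.
by rewrite fB gB ex ey.
Qed.

End PALift.

Section MorphB.
Variables (U V : zmodType) (f : U -> V).
Hypothesis fB : {morph f : x y / x - y}.

Lemma morphB0 : f 0 = 0.
Proof. by rewrite -(subrr 0) fB subrr. Qed.

Lemma morphBN x : f (- x) = - f x.
Proof. by rewrite -[- x]add0r fB morphB0 add0r. Qed.

Lemma morphBD x y : f (x + y) = f x + f y.
Proof. by rewrite -[y in LHS]opprK fB morphBN opprK. Qed.

Lemma morphB_sum I (r : seq I) (Q : pred I) (F : I -> U) :
  f (\sum_(i <- r | Q i) F i) = \sum_(i <- r | Q i) f (F i).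
Proof. by apply: (big_morph f morphBD morphB0). Qed.

Lemma morphBMsign x (n : nat) : f (x *~ (-1) ^+ n) = f x *~ (-1) ^+ n.
Proof.
by rewrite -signr_odd; case: (odd n); rewrite ?expr1 ?expr0 ?mulrN1z ?mulr1z ?morphBN.
Qed.

End MorphB.

Section PAMap.
Variables (R : realType) (G : groupType) (A : finZmodType).

Section Map.
Variables (P Q : mgba R G) (f : P -> Q).
Hypothesis fh : bool_hom f.

Lemma bool_homD X Y : f (X `\` Y)%O = (f X `\` f Y)%O.
Proof. by rewrite !diffE (bool_homI fh) (bool_homC fh). Qed.

Definition PA_map : PA P A -> PA Q A := PA_lift (fun X a => tensor (f X) a).

Lemma PA_map_tensor X a : PA_map (tensor X a) = tensor (f X) a.
Proof.
apply: PA_lift_tensor => X' Y' a' b'.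
by rewrite tensorD !bool_homD (bool_homI fh).
Qed.

Lemma PA_mapB : {morph PA_map : x y / x - y}.
Proof.
apply: PA_liftB => X' Y' a' b'.
by rewrite tensorD !bool_homD (bool_homI fh).
Qed.

Lemma PA_map_act (fE : forall g X, f (mact g X) = mact g (f X)) g x :
  PA_map (gm_act g x) = gm_act g (PA_map x).
Proof.
move: x; apply: PA_hom_eq => [x y|x y|X a] /=.
- by rewrite PA_actB PA_mapB.
- by rewrite PA_mapB PA_actB.
- by rewrite PA_act_tensor !PA_map_tensor PA_act_tensor fE.
Qed.

Lemma PA_map_theta a : PA_map (theta P A a) = theta Q A a.
Proof. by rewrite /= PA_map_tensor (bool_hom1 fh). Qed.

End Map.

End PAMap.

Section Characters.
Variables (R : realType) (G : groupType) (P : mgba R G) (A : finZmodType).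

Definition is_char (chi : P -> bool) : Prop :=
  (forall X Y, chi (X `&` Y)%O = chi X && chi Y) /\
  (forall X, chi (~` X)%O = ~~ chi X).

(** A character [chi] is a point of the Stone space of P, and P(A) consists of the locally constant
    A-valued functions on that space; this is evaluation at the point. *)
Definition PA_ev (chi : P -> bool) : PA P A -> A :=
  PA_lift (fun X a => a *+ chi X).

Variable (chi : P -> bool).
Hypothesis chiP : is_char chi.

Fact PA_ev_subproof X Y (a b : A) : a *+ chi X + b *+ chi Y =
  a *+ chi (X `\` Y)%O + b *+ chi (Y `\` X)%O + (a + b) *+ chi (X `&` Y)%O.
Proof.
have [cI cC] := chiP; rewrite !diffE !cI !cC.
by case: (chi X); case: (chi Y); rewrite /= ?mulr0n ?mulr1n ?addr0 ?add0r.
Qed.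

Lemma PA_evB : {morph PA_ev chi : x y / x - y}.
Proof. exact: PA_liftB PA_ev_subproof. Qed.

Lemma PA_ev_tensor X a : PA_ev chi (tensor X a) = a *+ chi X.
Proof. by rewrite /PA_ev (PA_lift_tensor PA_ev_subproof). Qed.

Lemma char_top : chi \top%O.
Proof.
have [cI cC] := chiP; have := cI \top%O (~` \top)%O.
rewrite cC compl1 meetx0 andbN => c0.
by rewrite -compl0 cC c0.
Qed.

End Characters.

Section NullKernel.
Variables (R : realType) (G : groupType) (P : mgba R G) (A : finZmodType).

Definition sep_proj (X : P) : Defs.separated P := \pi_(sep_type P) X.

Lemma sep_proj_hom : bool_hom sep_proj.
Proof.
split=> [X Y|X Y|X||] //; first exact/esym/pi_sepI.
  exact/esym/pi_sepU.
exact/esym/pi_sepC.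
Qed.

Lemma sep_proj_act g X : sep_proj (mact g X) = mact g (sep_proj X).
Proof. exact/esym/pi_act. Qed.

Lemma sep_proj_surj Y : exists X, sep_proj X = Y.
Proof. by exists (repr (Y : sep_type P)); rewrite /sep_proj reprK. Qed.

Definition null_tensor : set (PA P A) :=
  [set y | exists X a, mu X = 0 /\ y = tensor X a].

Let V : zmodType := Quotient.quot (span_pred null_tensor).
Let q (x : PA P A) : V := \pi_(Quotient.quot (span_pred null_tensor)) x.

Let qB : {morph q : x y / x - y}.
Proof. by move=> x y; rewrite /q raddfB. Qed.

Let q_eq x y : q x = q y <-> x - y \in span_pred null_tensor.
Proof. by rewrite Quotient.idealrBE; split=> /eqP. Qed.

Let null0 X a : mu X = 0 -> q (tensor X a) = 0.
Proof.
move=> X0; rewrite -(morphB0 qB); apply/q_eq; rewrite subr0.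
by apply/asboolP => T _; apply; exists X, a.
Qed.

Let q_null X Y a : sep_proj X = sep_proj Y -> q (tensor X a) = q (tensor Y a).
Proof.
move=> /sep_eqP[XY YX]; rewrite (tensorUI X Y) (tensorUI Y X) !(morphBD qB).
by rewrite !(null0 _ (X := (_ `\` _)%O)) // meetC.
Qed.

(** Modulo the tensors of null sets, [tensor X a] depends only on the class of X. The universal
    property then gives a map back from the separated side, so whatever dies there is already a sum
    of null tensors. *)
Lemma sep_kernel (y : PA P A) : PA_map sep_proj y = 0 ->
  exists2 s : seq (P * A), y = \sum_(p <- s) tensor p.1 p.2 &
    forall p, p \in s -> mu p.1 = 0.
Proof.
pose t (X : Defs.separated P) a : V := q (tensor (repr (X : sep_type P)) a).
have tE X a : t (sep_proj X) a = q (tensor X a).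
  by apply: q_null; rewrite /sep_proj reprK.
have tD (X Y : Defs.separated P) (a b : A) : t X a + t Y b =
    t (X `\` Y)%O a + t (Y `\` X)%O b + t (X `&` Y)%O (a + b).
  have [X' <-] := sep_proj_surj X; have [Y' <-] := sep_proj_surj Y.
  rewrite -!(bool_homD sep_proj_hom) -(bool_homI sep_proj_hom) !tE.
  by rewrite -!(morphBD qB) tensorD.
have lift x : PA_lift t (PA_map sep_proj x) = q x.
  move: x; apply: PA_hom_eq => [x z|//|X a].
    by rewrite (PA_mapB sep_proj_hom) (PA_liftB tD).
  by rewrite (PA_map_tensor sep_proj_hom) (PA_lift_tensor tD).
move=> y0; have : q y = q 0 by rewrite -lift y0 (morphB0 (PA_liftB tD)) (morphB0 qB).
move/q_eq; rewrite subr0 => /asboolP/(_ [set y | exists2 s : seq (P * A),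
  y = \sum_(p <- s) tensor p.1 p.2 & forall p, p \in s -> mu p.1 = 0]); apply.
  split=> [|x z [s -> s0] [s' -> s'0]]; first by exists [::]; rewrite ?big_nil.
  exists (s ++ [seq (p.1, - p.2) | p <- s']).
    rewrite big_cat big_map /= -sumrN; congr (_ + _).
    by apply: eq_bigr => p _; rewrite tensorNr.
  by move=> p; rewrite mem_cat => /orP[/s0//|/mapP[p' /s'0 ? ->]].
move=> _ [X [a [X0 ->]]]; exists [:: (X, a)]; rewrite ?big_seq1 //.
by move=> p; rewrite inE => /eqP ->.
Qed.

End NullKernel.

Section TransitivePA.
Variables (R : realType) (G : groupType) (L : finite_index_subgroup G).
Variable A : finZmodType.
Local Notation P := (transitive_mgba R L).

Definition point_char (C : coset_space L) (X : P) : bool := `[< (X : set (coset_space L)) C >].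

Lemma point_charP C : is_char (point_char C).
Proof.
split=> [X Y|X]; first by rewrite /point_char; apply/asboolP/andP => [[? ?]|[/asboolP ? /asboolP ?]]; split=> //; exact/asboolP.
rewrite /point_char -asbool_neg; congr asbool.
Qed.

(** Stated for any additive set function, since it is applied both to tensors and to measures. *)
Lemma level_split (V : zmodType) (F : set (coset_space L) -> V) (I : finType)
    (u : coset_space L -> I) :
  F set0 = 0 -> (forall S T, F S = F (S `&` T) + F (S `\` T)) ->
  forall W, F W = \sum_i F (W `&` [set C | u C = i]).
Proof.
move=> F0 FS W.
have h (s : seq I) : uniq s -> F (W `&` [set C | u C \in s]) =
    \sum_(i <- s) F (W `&` [set C | u C = i]).
  elim: s => [_|i s IH /= /andP[is_ us]].
    by rewrite big_nil -[RHS]F0; congr F; apply/seteqP; split=> // C /= [].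
  rewrite big_cons -IH // (FS _ [set C | u C = i]); congr (F _ + F _).
    apply/seteqP; split=> C /=; first by case=> -[].
    by move=> [WC uC]; rewrite uC inE eqxx.
  apply/seteqP; split=> C /=.
    by move=> [[WC +] uC]; rewrite inE => /orP[/eqP|].
  move=> [WC us_]; rewrite inE us_ orbT; split=> // uC.
  by move: is_; rewrite -uC us_.
rewrite -(h _ (index_enum_uniq I)); congr F; apply/seteqP; split=> C /=.
  by move=> WC; rewrite mem_index_enum.
by case.
Qed.

Definition level (x : PA P A) (a : A) : set (coset_space L) :=
  [set C | PA_ev (point_char C) x = a].

Let tensorS (a : A) (S T : set (coset_space L)) :
  tensor (S : P) a = tensor (S `&` T : P) a + tensor (S `\` T : P) a.
Proof. exact: (@tensorUI R G P A S T a). Qed.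

Lemma level_sum (x : PA P A) : x = \sum_(a : A) tensor (level x a : P) a.
Proof.
elim/PA_ind: x => [|x y ex ey|X b].
- rewrite big1 // => a _; have [->|a0] := eqVneq a 0; first exact: tensor0r.
  rewrite [level _ _](_ : _ = set0) ?tensor_bot //; apply/seteqP; split=> // C /=.
  by rewrite /level /= (morphB0 (PA_evB (point_charP C))) => /esym/eqP; rewrite (negbTE a0).
(* Common refinement of the three partitions: a nonempty piece forces c = a - b, and an empty one
   contributes 0. *)
- pose W a b c : P := (level x a `&` level y b `&` level (x - y) c).
  have sp (e : A) (z : PA P A) (S : set (coset_space L)) :
      tensor (S : P) e = \sum_c tensor (S `&` level z c : P) e.
    apply: (@level_split _ (fun S : set (coset_space L) => tensor (S : P) e) A
      (fun C => PA_ev (point_char C) z)); last exact: tensorS.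
    exact: tensor_bot.
  have hx : x = \sum_a \sum_b \sum_c tensor (W a b c) a.
    rewrite [LHS]ex; apply: eq_bigr => a _; rewrite (sp _ y); apply: eq_bigr => b _.
    exact: sp.
  have hy : y = \sum_a \sum_b \sum_c tensor (W a b c) b.
    rewrite [LHS]ey exchange_big; apply: eq_bigr => b _; rewrite (sp _ x).
    by apply: eq_bigr => a _; rewrite [level y b `&` _]setIC; exact: sp.
  have -> : \sum_c tensor (level (x - y) c : P) c = \sum_a \sum_b \sum_c tensor (W a b c) c.
    transitivity (\sum_c \sum_a \sum_b tensor (W a b c) c).
      apply: eq_bigr => c _; rewrite (sp _ x); apply: eq_bigr => a _; rewrite (sp _ y).
      by apply: eq_bigr => b _; rewrite /W [level (x - y) c `&` _]setIC setIAC.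
    by rewrite exchange_big; apply: eq_bigr => a _; rewrite exchange_big.
  rewrite [in LHS]hx [in LHS]hy -sumrB; apply: eq_bigr => a _; rewrite -sumrB.
  apply: eq_bigr => b _; rewrite -sumrB; apply: eq_bigr => c _; rewrite -tensorBr.
  have [W0|/set0P[C [[xa yb] zc]]] := eqVneq (W a b c : set (coset_space L)) set0.
    by rewrite W0 !tensor_bot.
  by congr tensor; rewrite -zc (PA_evB (point_charP C)) xa yb.
- have lE a : level (tensor X b) a = [set C | b *+ point_char C X = a].
    by apply/seteqP; split=> C; rewrite /level /= (PA_ev_tensor (point_charP C)).
  rewrite (bigD1 b) //= big1 ?addr0 => [|a ab].
    have [->|b0] := eqVneq b 0; first by rewrite !tensor0r.
    congr tensor; rewrite lE; apply/seteqP; split=> C /=; rewrite /point_char.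
      by case: asboolP.
    by case: asboolP => // XC; rewrite mulr0n => /esym/eqP; rewrite (negbTE b0).
  have [->|a0] := eqVneq a 0; first exact: tensor0r.
  rewrite lE [X in tensor X](_ : _ = set0) ?tensor_bot //; apply/seteqP; split=> // C /=.
  case: (point_char C X); rewrite ?mulr1n ?mulr0n => /esym/eqP.
    by rewrite (negbTE ab).
  by rewrite (negbTE a0).
Qed.

(** In every normal form X a is the set where the function x takes the value a, so all normal forms
    give the measure of the support. *)
Lemma mu_PA_transitive (x : PA P A) :
  mu_PA x = coset_mu R [set C | PA_ev (point_char C) x != 0].
Proof.
have norm_value X : PA_normal_form x X -> \sum_(a | a != 0) mu (X a) =
    coset_mu R [set C | PA_ev (point_char C) x != 0].
  move=> [dX xE].
  have evE C : PA_ev (point_char C) x = \sum_(a | a != 0) a *+ point_char C (X a).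
    rewrite [in LHS]xE (morphB_sum (PA_evB (point_charP C))).
    by apply: eq_bigr => a _; rewrite (PA_ev_tensor (point_charP C)).
  have evX C a : a != 0 -> (X a : set (coset_space L)) C -> PA_ev (point_char C) x = a.
    move=> a0 XC; rewrite evE (bigD1 a) //= big1 ?addr0 /point_char ?asboolT //.
    move=> b /andP[b0 ba]; rewrite asboolF // => XbC.
    have XX : (X a `&` X b : set (coset_space L)) C by [].
    by move: XX; rewrite [_ `&` _](dX a b) // eq_sym.
  rewrite (@level_split R (@coset_mu R G L) A (fun C => PA_ev (point_char C) x)).
  - rewrite [RHS](bigD1 0) //= [X in coset_mu _ X + _](_ : _ = set0).
      rewrite (bmu0 (coset_measure R L)) add0r; apply: eq_bigr => a a0.
      congr coset_mu; apply/seteqP; split=> C /=.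
        by move=> XC; rewrite (evX _ a).
      move=> [x0 xa]; move: x0; rewrite evE; apply: contra_neqP => nX.
      have nb b : b != 0 -> ~ (X b : set (coset_space L)) C.
        by move=> b0 XbC; apply: nX; rewrite -xa (evX _ b).
      by rewrite big1 // => b /nb nbC; rewrite /point_char asboolF.
    by apply/seteqP; split=> C //= [/eqP].
  - exact: bmu0 (coset_measure R L).
  - move=> S T; exact: (@mu_split R G P S T).
have nf : PA_normal_form x (level x : A -> P).
  split=> [a b _ _ ab|].
    apply/seteqP; split=> C //= [xa xb]; move: ab; rewrite -xa.
    by move: xb; rewrite /level /= => ->; rewrite eqxx.
  by rewrite [LHS]level_sum (bigD1 0) //= tensor0r add0r.
(* The level sets are a normal form, so the default value 0 of [xget] does not occur. *)
rewrite /mu_PA; case: xgetP => [r _ [X /norm_value <- //]|/(_ (\sum_(a | a != 0) mu (level x a : P)))].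
by case; exists (level x : A -> P).
Qed.

(** The support of a sum lies in the union of the supports. This is what allows presentations with
    overlapping sets elsewhere. *)
Lemma mu_PA_sum_le (s : seq (P * A)) :
  mu_PA (\sum_(p <- s) tensor p.1 p.2 : PA P A) <= \sum_(p <- s) mu p.1.
Proof.
rewrite mu_PA_transitive; elim: s => [|p s IH].
  rewrite !big_nil [X in coset_mu _ X](_ : _ = set0) ?(bmu0 (coset_measure R L)) //.
  by apply/seteqP; split=> C //=; rewrite (morphB0 (PA_evB (point_charP C))) eqxx.
rewrite !big_cons; set y := (\sum_(q <- s) _) in IH *.
apply: le_trans (lerD (lexx _) IH); apply: le_trans (le_muU p.1 ([set C | PA_ev (point_char C) y != 0] : P)).
apply: (@le_mu R G P); apply/subsetPset => C /=.
rewrite (morphBD (PA_evB (point_charP C))) (PA_ev_tensor (point_charP C)) /point_char.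
by case: asboolP => pC; [left|rewrite mulr0n add0r; right].
Qed.

Lemma mu_PA_transitive_ge0 (x : PA P A) : 0 <= mu_PA x.
Proof. by rewrite mu_PA_transitive; exact: bmu_ge0 (coset_measure R L) _. Qed.

End TransitivePA.

(** * Simplicial cochains of EG *)

Section SimplicialTools.
Variables (R : realType) (G : groupType) (E : finite_model R G).

Lemma os_eq n (v w : osimplex E n) : (forall i, v i = w i) -> v = w.
Proof.
case: v w => [v iv sv] [w iw sw] /= /ffunP vw; subst w.
by rewrite (Prop_irrelevance iv iw) (Prop_irrelevance sv sw).
Qed.

Lemma os_act1 n (v : osimplex E n) : os_act 1%g v = v.
Proof. by apply: os_eq => i; rewrite /= ffunE (EG_action E).1. Qed.

Lemma os_actM n g h (v : osimplex E n) : os_act (g * h)%g v = os_act g (os_act h v).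
Proof. by apply: os_eq => i; rewrite /= !ffunE (EG_action E).2. Qed.

Lemma os_perm1 n (v : osimplex E n) : os_perm 1%g v = v.
Proof. by apply: os_eq => i; rewrite /= ffunE perm1. Qed.

Lemma os_permM n s t (v : osimplex E n) : os_perm (s * t)%g v = os_perm s (os_perm t v).
Proof. by apply: os_eq => i; rewrite /= !ffunE permM. Qed.

Lemma os_act_perm n g s (v : osimplex E n) : os_act g (os_perm s v) = os_perm s (os_act g v).
Proof. by apply: os_eq => i; rewrite /= !ffunE. Qed.

Lemma os_act_face n g (i : 'I_n.+2) (v : osimplex E n.+1) :
  os_face i (os_act g v) = os_act g (os_face i v).
Proof. by apply: os_eq => j; rewrite /= !ffunE. Qed.

Lemma mem_vertices n (v : osimplex E n) i : v i \in vertices v.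
Proof. by rewrite in_imfset. Qed.

Lemma vertices_act n g (v : osimplex E n) :
  vertices (os_act g v) = [fset EG_act g x | x in vertices v]%fset.
Proof.
apply/fsetP => x; apply/imfsetP/imfsetP => /=.
  by move=> [i _ ->]; exists (v i); rewrite ?ffunE ?mem_vertices.
by move=> [_ /imfsetP[i _ ->] ->]; exists i; rewrite ?ffunE.
Qed.

Lemma vertices_perm n s (v : osimplex E n) : vertices (os_perm s v) = vertices v.
Proof.
apply/fsetP => x; apply/imfsetP/imfsetP => /= -[i _ ->].
  by exists (s i); rewrite ?ffunE.
by exists ((s^-1)%g i); rewrite ?ffunE ?permKV.
Qed.

Lemma BG_pi n (v w : osimplex E n) :
  (exists g, vertices w = [fset EG_act g x | x in vertices v]%fset) <->
  \pi_(BG E n) v = \pi_(BG E n) w.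
Proof.
split=> [h|/eqmodP/asboolP //].
by apply/eqmodP/asboolP.
Qed.

Lemma pi_act n g (v : osimplex E n) : \pi_(BG E n) (os_act g v) = \pi_(BG E n) v.
Proof. by apply/esym/BG_pi; exists g; rewrite vertices_act. Qed.

Lemma pi_perm n s (v : osimplex E n) : \pi_(BG E n) (os_perm s v) = \pi_(BG E n) v.
Proof.
by apply/esym/BG_pi; exists 1%g; rewrite vertices_perm -vertices_act os_act1.
Qed.

Lemma finite_BG n : finite_set [set: BG E n].
Proof.
pose f (x : BG E n) : set {fset vertex E} :=
  [set [fset EG_act g v | v in vertices (repr x)]%fset | g in [set: G]].
apply: (@sub_finite_set _ _ (f @^-1` [set [set [fset EG_act g v | v in s]%fset | g in [set: G]] | s in @simplex E])).
  by move=> x _; exists (vertices (repr x)) => //; exact: os_simplex.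
apply: finite_preimage (EG_cofinite E) => x y _ _ fxy.
rewrite -[x]reprK -[y]reprK; apply/BG_pi.
have : f y (vertices (repr y)) by exists 1%g => //; rewrite -vertices_act os_act1.
by rewrite -fxy => -[g _ e]; exists g.
Qed.

Lemma os_rep n (v : osimplex E n) :
  exists gs : G * 'S_n.+1, v = os_act gs.1 (os_perm gs.2 (repr (\pi_(BG E n) v))).
Proof.
set r := repr _; have /BG_pi[g e] : \pi_(BG E n) r = \pi_(BG E n) v by rewrite reprK.
have ex i : exists j, v i = EG_act g (r j).
  have := mem_vertices v i; rewrite e => /imfsetP[_ /imfsetP[j _ ->] ->].
  by exists j.
pose t i := sval (cid (ex i)).
have tE i : v i = EG_act g (r (t i)) := svalP (cid (ex i)).
have ti : injective t by move=> i j ij; apply: (@os_inj _ _ _ _ v); rewrite !tE ij.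
by exists (g, perm ti); apply: os_eq => i; rewrite /= !ffunE permE -tE.
Qed.

(** Freeness concerns simplices as sets of vertices, so it identifies the group elements whatever
    the permutations are; injectivity of the vertex map then identifies the permutations. *)
Lemma os_rep_unique n (r : osimplex E n) g h s t :
  os_act g (os_perm s r) = os_act h (os_perm t r) -> g = h /\ s = t.
Proof.
move=> e; have {}e : os_act (h^-1 * g)%g (os_perm s r) = os_perm t r.
  by rewrite os_actM e -os_actM mulVg os_act1.
have /(congr1 (fun x => h * x)%g) : (h^-1 * g = 1)%g.
  apply: (@EG_free _ _ E _ (vertices r) (os_simplex r)).
  by rewrite -[LHS]/[fset _ | x in _]%fset -(vertices_perm s r) -vertices_act e !vertices_perm.
rewrite mulVKg mulg1 => gh; split=> //; move: e; rewrite gh mulVg os_act1 => e.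
apply/permP => i; apply: (@os_inj _ _ _ _ r).
by have := congr1 (fun v : osimplex E n => v i) e; rewrite /= !ffunE.
Qed.

(** Ordered simplices are freely permuted by G times the symmetric group, so values on
    representatives can be prescribed at will. Orientations, lifts and approximations of cochains
    are all obtained in this way. *)
Lemma cochain_extend (M : gmodule G) n (c0 : osimplex E n -> M) :
  exists2 c : simp_ambient E M n, @simp_cochain _ _ E M n c &
    forall x : BG E n, c (repr x) = c0 (repr x).
Proof.
pose d v := sval (cid (@os_rep n v)).
have dE v : v = os_act (d v).1 (os_perm (d v).2 (repr (\pi_(BG E n) v))) :=
  svalP (cid (os_rep v)).
have dU v g s : v = os_act g (os_perm s (repr (\pi_(BG E n) v))) -> d v = (g, s).
  move=> e; have [<- <-] := os_rep_unique (etrans (esym (dE v)) e).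
  by case: (d v).
exists (fun v => gm_act (d v).1 (c0 (repr (\pi_(BG E n) v))) *~ (-1) ^+ (d v).2).
  split=> [g v|s v].
    rewrite (dU (os_act g v) (g * (d v).1)%g (d v).2) /=; last first.
      by rewrite pi_act os_actM -dE.
    by rewrite pi_act (gm_action M).2 (morphBMsign (gm_actB g)).
  rewrite (dU (os_perm s v) (d v).1 (s * (d v).2)%g) /=; last first.
    by rewrite pi_perm os_permM os_act_perm -dE.
  by rewrite pi_perm odd_permM signr_addb mulrC mulrzA.
move=> x; rewrite (dU (repr x) 1%g 1%g) /=; last by rewrite reprK os_perm1 os_act1.
by rewrite odd_perm1 expr0 mulr1z (gm_action M).1 reprK.
Qed.

Lemma alternating_tperm (M : zmodType) n (c : osimplex E n -> M) :
  (forall x y v, x != y -> c (os_perm (tperm x y) v) = - c v) ->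
  forall (s : 'S_n.+1) v, c (os_perm s v) = c v *~ (-1) ^+ s.
Proof.
move=> ct s; have [ts -> dts] := prod_tpermP s; elim: ts dts => [_|[x y] ts IH /= /andP[xy dts]] v.
  by rewrite big_nil os_perm1 odd_perm1 mulr1z.
rewrite big_cons os_permM ct // IH // odd_mul_tperm xy /= -mulrNz.
by case: (odd_perm _); rewrite /= ?expr0 ?expr1 ?opprK.
Qed.

(** Choose a vertex in each orbit; by freeness on vertices, v is the translate of the chosen one by
    a unique element, which is phi v. *)
Lemma vertex_equivariant : exists phi : vertex E -> G,
  forall g v, phi (EG_act g v) = (g * phi v)%g.
Proof.
have [a1 aM] := EG_action E; have [v0 _] := vertex_exists (EG_contractible E).
pose O v : set (vertex E) := [set EG_act g v | g in [set: G]].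
have OE g v : O (EG_act g v) = O v.
  apply/seteqP; split=> _ [h _ <-]; first by exists (h * g)%g; rewrite ?aM.
  by exists (h * g^-1)%g => //; rewrite -aM mulgVK.
pose r v := xget v0 (O v).
have ex v : exists g, v = EG_act g (r v).
  have [g _ e] : O v (r v) by apply: (@xgetPex _ v0 (O v)); exists v; exists 1%g.
  by exists g^-1%g; rewrite -e -aM mulVg a1.
pose p v := sval (cid (ex v)).
have pE v : v = EG_act (p v) (r v) := svalP (cid (ex v)).
exists p => g v.
have : EG_act (p (EG_act g v)) (r v) = EG_act (g * p v)%g (r v).
  by rewrite aM -(pE v) [RHS]pE /r OE.
move/(congr1 (EG_act (g * p v)^-1%g)); rewrite -!aM mulVg a1 => e.
have := @EG_free _ _ E ((g * p v)^-1 * p (EG_act g v))%g _ (simplex_vertex (r v)).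
rewrite -[X in _ -> X]/(_ = _) => /(_ _)/(congr1 (fun x => g * p v * x)%g).
rewrite mulVKg mulg1; apply; apply/fsetP => x; rewrite inE.
by apply/imfsetP/eqP => /= [[y]|->]; [rewrite inE => /eqP -> ->|exists (r v); rewrite ?inE].
Qed.

(* d is the junk value on pairs that are not edges, including v = w. *)
Definition edge_fun (T : Type) (c : osimplex E 1 -> T) (d : T) (v w : vertex E) : T :=
  match pselect (exists e : osimplex E 1, e ord0 = v /\ e ord_max = w) with
  | left h => c (sval (cid h))
  | right _ => d
  end.

Lemma edge_funE T (c : osimplex E 1 -> T) d (e : osimplex E 1) :
  edge_fun c d (e ord0) (e ord_max) = c e.
Proof.
rewrite /edge_fun; case: pselect => [h|[]]; last by exists e.
case: (cid h) => f /= [f0 f1]; congr c; apply: os_eq => i.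
by case: (unliftP ord0 i) => [j ->|->] //; rewrite (ord1 j) (_ : fintype.lift _ _ = ord_max) //; exact: val_inj.
Qed.

Lemma edge_fun0 T (c : osimplex E 1 -> T) d v : edge_fun c d v v = d.
Proof.
rewrite /edge_fun; case: pselect => // -[e [e0 e1]].
by have /os_inj : e ord0 = e ord_max by rewrite e0.
Qed.

Lemma edge_exists (v w : vertex E) : v != w -> simplex [fset v; w]%fset ->
  exists e : osimplex E 1, e ord0 = v /\ e ord_max = w.
Proof.
move=> vw Kvw; pose f : {ffun 'I_2 -> vertex E} := [ffun i => if i == ord0 then v else w].
have fi : injective f.
  move=> i j; rewrite !ffunE; case: (unliftP ord0 i) => [i' ->|->];
    case: (unliftP ord0 j) => [j' ->|->] //=; rewrite ?(ord1 i') ?(ord1 j') // => /eqP.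
    by rewrite eq_sym (negbTE vw).
  by rewrite (negbTE vw).
have fs : @simplex E [fset f i | i in 'I_2]%fset.
  congr (@simplex E _): Kvw; apply/fsetP => x; rewrite !inE; apply/orP/imfsetP => /=.
    by move=> [] /eqP ->; [exists ord0|exists ord_max]; rewrite ?ffunE.
  by move=> [i _ ->]; rewrite ffunE; case: ifP; [left|right].
by exists (OSimplex fi fs); rewrite /= !ffunE.
Qed.

Definition edge_swap (e : osimplex E 1) : osimplex E 1 := os_perm (tperm ord0 ord_max) e.

Lemma edge_swapE e : edge_swap e ord0 = e ord_max /\ edge_swap e ord_max = e ord0.
Proof. by rewrite /= !ffunE tpermL tpermR. Qed.

Lemma triangle_exists (u v w : vertex E) s : u != v -> v != w -> u != w ->
  simplex s -> u \in s -> v \in s -> w \in s ->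
  exists t : osimplex E 2, [/\ t (inord 0) = u, t (inord 1) = v & t (inord 2) = w].
Proof.
move=> uv vw uw Ks us vs ws.
pose f : {ffun 'I_3 -> vertex E} := [ffun i => nth u [:: u; v; w] (i : 'I_3)].
have fi : injective f.
  move=> i j; rewrite !ffunE => /eqP.
  by rewrite nth_uniq ?ltn_ord //= ?inE ?negb_or ?uv ?uw ?vw // => /eqP/val_inj.
have fs : @simplex E [fset f i | i in 'I_3]%fset.
  apply: simplex_sub Ks _ _; last by apply/fset0Pn; exists (f ord0); rewrite in_imfset.
  apply/fsubsetP => x /imfsetP[i _ ->]; rewrite ffunE.
  by case: i => [[|[|[|]]]].
by exists (OSimplex fi fs); rewrite /= !ffunE !inordK.
Qed.

(** The three transpositions are obtained from a rotation and one swap. The hypotheses are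
    restricted to triples in a common simplex because the cochains in question satisfy them only
    there. *)
Lemma triangle_alternating (M : zmodType) (c : vertex E -> vertex E -> vertex E -> M) :
  (forall S u v w, @simplex E S -> u \in S -> v \in S -> w \in S -> c v w u = c u v w) ->
  (forall S u v w, @simplex E S -> u \in S -> v \in S -> w \in S -> c v u w = - c u v w) ->
  forall (s : 'S_3) (t : osimplex E 2),
    c (os_perm s t (inord 0)) (os_perm s t (inord 1)) (os_perm s t (inord 2)) =
    c (t (inord 0)) (t (inord 1)) (t (inord 2)) *~ (-1) ^+ s.
Proof.
move=> crot cswap s t0.
apply: (alternating_tperm (c := fun t : osimplex E 2 =>
  c (t (inord 0)) (t (inord 1)) (t (inord 2)))) => x y t xy.
have KS := os_simplex t; have mv i := mem_vertices t i.
have rt i j k : c (t j) (t k) (t i) = c (t i) (t j) (t k) by exact: crot KS _ _ _.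
have sw i j k : c (t j) (t i) (t k) = - c (t i) (t j) (t k) by exact: cswap KS _ _ _.
rewrite /= !ffunE.
wlog lt_xy : x y xy / (x < y)%N.
  move=> h; case: (ltngtP x y) => [|yx|/val_inj e]; first exact: h.
    by rewrite tpermC; apply: h => //; rewrite eq_sym.
  by rewrite e eqxx in xy.
have v0 : (inord 0 : 'I_3) = 0%N :> nat by rewrite inordK.
have v1 : (inord 1 : 'I_3) = 1%N :> nat by rewrite inordK.
have v2 : (inord 2 : 'I_3) = 2%N :> nat by rewrite inordK.
have n01 : (inord 0 : 'I_3) != inord 1 by apply/eqP => /(congr1 (@nat_of_ord 3)); rewrite v0 v1.
have n02 : (inord 0 : 'I_3) != inord 2 by apply/eqP => /(congr1 (@nat_of_ord 3)); rewrite v0 v2.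
have n12 : (inord 1 : 'I_3) != inord 2 by apply/eqP => /(congr1 (@nat_of_ord 3)); rewrite v1 v2.
have [[-> ->]|[-> ->]|[-> ->]] : [\/ x = inord 0 /\ y = inord 1, x = inord 0 /\ y = inord 2 |
    x = inord 1 /\ y = inord 2].
  case: x y lt_xy {xy} => [[|[|[|x]]] hx] [[|[|[|y]]] hy] //= _;
    [constructor 1|constructor 2|constructor 3]; split; apply: val_inj; rewrite /= ?v0 ?v1 ?v2 //.
- rewrite tpermL tpermR tpermD //; exact: sw.
- rewrite tpermL tpermR tpermD; [|by []|by rewrite eq_sym].
  by rewrite -rt sw rt.
- rewrite tpermL tpermR tpermD; [|by rewrite eq_sym|by rewrite eq_sym].
  by rewrite -rt -rt sw rt.
Qed.

End SimplicialTools.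

(** * The simplicial class of a central extension *)

Section CentralExtension.
Variables (G Gt : groupType) (A : zmodType) (iota : A -> Gt) (pr : Gt -> G).
Hypothesis hext : central_extension iota pr.

Lemma iota0 : iota 0 = 1%g.
Proof.
have := ext_iotaD hext 0 0; rewrite addr0 => /(congr1 (fun x => (iota 0)^-1 * x)%g).
by rewrite mulKg mulVg => ->.
Qed.

Lemma iotaN a : iota (- a) = (iota a)^-1%g.
Proof.
have := ext_iotaD hext a (- a); rewrite subrr iota0.
by move=> /(congr1 (fun x => (iota a)^-1 * x)%g); rewrite mulKg mulg1 => ->.
Qed.

Lemma pr1 : pr 1%g = 1%g.
Proof. by apply/(ext_exact hext); exists 0; rewrite iota0. Qed.

Lemma prV x : pr x^-1%g = (pr x)^-1%g.
Proof.
have := ext_prM hext x x^-1%g; rewrite mulgV pr1.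
by move=> /(congr1 (fun y => (pr x)^-1 * y)%g); rewrite mulKg mulg1 => ->.
Qed.

Lemma pr_iota a : pr (iota a) = 1%g.
Proof. by apply/(ext_exact hext); exists a. Qed.

Lemma pr_eq x y : pr x = pr y -> exists a, x = (iota a * y)%g.
Proof.
move=> e; have /(ext_exact hext)[a ea] : pr (x * y^-1)%g = 1%g.
  by rewrite (ext_prM hext) prV e mulgV.
by exists a; rewrite -ea mulgVK.
Qed.

Lemma iota_conj a x : (x * iota a * x^-1)%g = iota a.
Proof. by rewrite -(ext_central hext) mulgK. Qed.

End CentralExtension.

(** * Residual finiteness of extensions that split over a finite index subgroup *)

Section SplitResiduallyFinite.
Variables (G Gt : groupType) (A : finZmodType) (iota : A -> Gt) (pr : Gt -> G).
Hypothesis hext : central_extension iota pr.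

Lemma is_subgroup_preim (L : set G) : is_subgroup L -> is_subgroup (pr @^-1` L).
Proof.
move=> [L1 LM LV]; split=> [|g h|g] /=; rewrite ?(pr1 hext) //.
  by rewrite (ext_prM hext); exact: LM.
by rewrite (prV hext); exact: LV.
Qed.

Lemma finite_index_preim (L : finite_index_subgroup G) :
  exists M : finite_index_subgroup Gt, (M : set Gt) = pr @^-1` L.
Proof.
have h : finite_set (lcosets (pr @^-1` L)).
  apply: (@sub_finite_set _ _ ((fun C => pr @^-1` C) @` lcosets L)).
    move=> _ [g _ <-]; exists (lcoset (pr g) L); first by exists (pr g).
    apply/seteqP; split=> x /=.
      by move=> [h Lh e]; exists (g^-1 * x)%g; rewrite /= ?mulVKg // (ext_prM hext) (prV hext) -e mulKg.
    by move=> [h Lh <-]; exists (pr h); rewrite ?(ext_prM hext).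
  exact: finite_image (fis_finite L).
by exists (FiniteIndexSubgroup (is_subgroup_preim (fis_subgroup L)) h).
Qed.

Lemma split_residually_finite (L : finite_index_subgroup G) (sigma : G -> Gt) :
  (forall g h, (L : set G) g -> (L : set G) h -> sigma (g * h)%g = (sigma g * sigma h)%g) ->
  (forall g, (L : set G) g -> pr (sigma g) = g) ->
  residually_finite G -> residually_finite Gt.
Proof.
move=> sM sK rfG x x1.
have [L1 LM LV] := fis_subgroup L.
have [prx|/rfG[M Mx]] := pselect (pr x = 1%g); last first.
  by have [N NE] := finite_index_preim M; exists N; rewrite NE.
have [a ea] := (ext_exact hext x).1 prx.
have s1 : sigma 1%g = 1%g.
  have := sM _ _ L1 L1; rewrite mulg1 => /(congr1 (fun y => (sigma 1%g)^-1 * y)%g).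
  by rewrite mulVg mulKg => <-.
pose S : set Gt := sigma @` L.
have Ssub : is_subgroup S.
  split; first by exists 1%g.
    by move=> _ _ [g Lg <-] [h Lh <-]; exists (g * h)%g; [exact: LM|exact: sM].
  move=> _ [g Lg <-]; exists g^-1%g; first exact: LV.
  have := sM _ _ Lg (LV _ Lg); rewrite mulgV s1.
  by move=> /(congr1 (fun y => (sigma g)^-1 * y)%g); rewrite mulg1 mulKg => <-.
have Sfin : finite_set (lcosets S).
  pose r (C : set G) : G := xget 1%g C.
  have exs g := ext_pr_surj hext g.
  pose t g := sval (cid (exs g)); have tK g : pr (t g) = g := svalP (cid (exs g)).
  (* A coset y S is determined by the coset of pr y modulo L and by the element of A that separates
     a suitable member of y S from the fixed lift [t (r C)]. *)
  apply: (@sub_finite_set _ _ ((fun Ca : set G * A => lcoset (t (r Ca.1) * iota Ca.2)%g S) @`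
      (lcosets L `*` [set: A]))); last first.
    by apply: finite_image; apply: finite_setX (fis_finite L) _; exact: finite_finset.
  move=> _ [y _ <-]; pose C := lcoset (pr y) L.
  have [h Lh hr] : C (r C).
    by apply: (@xgetPex _ 1%g C); exists (pr y); exists 1%g; rewrite ?mulg1.
  have /(pr_eq hext)[b eb] : pr (y * sigma h)%g = pr (t (r C)).
    by rewrite (ext_prM hext) sK // tK hr.
  exists (C, b); first by split=> //; exists (pr y).
  have -> : (t (r C) * iota b)%g = (y * sigma h)%g.
    by rewrite eb (ext_central hext).
  apply/seteqP; split=> _ [_ [g Lg <-] <-].
    by exists (sigma (h * g)%g); [exists (h * g)%g => //; exact: LM|rewrite sM ?mulgA].
  exists (sigma (h^-1 * g)%g); first by exists (h^-1 * g)%g => //; apply: LM => //; exact: LV.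
  by rewrite -mulgA -sM ?mulVKg //; apply: LM => //; exact: LV.
exists (FiniteIndexSubgroup Ssub Sfin) => -[g Lg sx]; apply: x1.
by rewrite -sx -(sK _ Lg) sx prx s1.
Qed.

End SplitResiduallyFinite.

Section SimplicialClass.
Variables (R : realType) (G Gt : groupType) (E : finite_model R G) (A : finZmodType).
Variables (iota : A -> Gt) (pr : Gt -> G).
Hypothesis hext : central_extension iota pr.
Variables (s : G -> Gt) (phi : vertex E -> G).
Hypothesis prs : forall g, pr (s g) = g.
Hypothesis phiE : forall g v, phi (EG_act g v) = (g * phi v)%g.
Implicit Types (u v w : vertex E).

(** An equivariant alternating integral 1-cochain with value 1 on representatives. No edge is
    inverted by G, since the action is free on simplices as sets. *)
Lemma orientation : exists o : vertex E -> vertex E -> int,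
  [/\ forall v w, v != w -> simplex [fset v; w]%fset -> o v w = 1 \/ o v w = -1,
      forall v w, v != w -> simplex [fset v; w]%fset -> o w v = - o v w &
      forall g v w, v != w -> simplex [fset v; w]%fset ->
        o (EG_act g v) (EG_act g w) = o v w].
Proof.
have [c [cg cs] c1] := @cochain_extend R G E (trivial_gmodule G int) 1 (fun _ => 1).
exists (edge_fun c 0); split=> [v w vw|v w vw|g v w vw] /(edge_exists vw)[e [<- <-]].
- rewrite edge_funE; have [[g t] ->] := os_rep e.
  rewrite cg cs c1 /=; case: (odd_perm t); [right|left] => //.
- have [s0 s1] := edge_swapE e; have := edge_funE c 0 (edge_swap e).
  by rewrite s0 s1 edge_funE cs odd_tperm /= expr1 mulrN1z.
- have := edge_funE c 0 (os_act g e); rewrite /= !ffunE => ->.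
  by rewrite edge_funE; exact: cg.
Qed.

Variable o : vertex E -> vertex E -> int.
Hypothesis o1 : forall v w, v != w -> simplex [fset v; w]%fset -> o v w = 1 \/ o v w = -1.
Hypothesis oN : forall v w, v != w -> simplex [fset v; w]%fset -> o w v = - o v w.
Hypothesis oE : forall g v w, v != w -> simplex [fset v; w]%fset ->
  o (EG_act g v) (EG_act g w) = o v w.

(* Lifts to Gt of the elements of G along the edges of EG, chosen
   antisymmetrically; this makes [tri_class] an alternating cochain. *)
Definition edge_lift v w : Gt :=
  if v == w then 1%g else
  if o v w == 1 then s ((phi v)^-1 * phi w)%g else (s ((phi w)^-1 * phi v))^-1%g.

Lemma edge_lift_id v : edge_lift v v = 1%g.
Proof. by rewrite /edge_lift eqxx. Qed.

Lemma edge_liftV v w : simplex [fset v; w]%fset -> edge_lift w v = (edge_lift v w)^-1%g.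
Proof.
rewrite /edge_lift eq_sym; case: eqVneq => [_ _|vw Kvw]; first by rewrite invg1.
rewrite (oN vw Kvw); case: (o1 vw Kvw) => -> /=; first by [].
by rewrite invgK.
Qed.

Lemma edge_lift_act g v w : simplex [fset v; w]%fset ->
  edge_lift (EG_act g v) (EG_act g w) = edge_lift v w.
Proof.
move=> Kvw; rewrite /edge_lift (inj_eq (@EG_act_inj _ _ E g)).
case: eqVneq => // vw; rewrite oE // !phiE.
by rewrite !invgM !mulgA !mulgVK.
Qed.

Lemma pr_edge_lift v w : pr (edge_lift v w) = ((phi v)^-1 * phi w)%g.
Proof.
rewrite /edge_lift; case: eqVneq => [->|_]; first by rewrite (pr1 hext) mulVg.
by case: ifP => _; rewrite ?(prV hext) prs // invgM invgK.
Qed.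

(** The product is the holonomy of the lifts around the triangle; its image in G telescopes to 1, so
    it lies in A. *)
Lemma tri_class_ex u v w :
  exists a, iota a = (edge_lift u v * edge_lift v w * edge_lift w u)%g.
Proof.
have [|a ->] := (ext_exact hext (edge_lift u v * edge_lift v w * edge_lift w u)%g).1.
  by rewrite !(ext_prM hext) !pr_edge_lift !mulgA !mulgK mulVg.
by exists a.
Qed.

Definition tri_class u v w : A := sval (cid (tri_class_ex u v w)).

Lemma tri_classE u v w :
  iota (tri_class u v w) = (edge_lift u v * edge_lift v w * edge_lift w u)%g.
Proof. exact: svalP (cid (tri_class_ex u v w)). Qed.

Lemma edge_sub S v w : @simplex E S -> v \in S -> w \in S -> @simplex E [fset v; w]%fset.
Proof.
move=> KS vS wS; apply: simplex_sub KS _ _.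
  by apply/fsubsetP => u; rewrite !inE => /orP[] /eqP ->.
by apply/fset0Pn; exists v; rewrite !inE eqxx.
Qed.

Lemma tri_class_act g u v w S : @simplex E S -> u \in S -> v \in S -> w \in S ->
  tri_class (EG_act g u) (EG_act g v) (EG_act g w) = tri_class u v w.
Proof.
move=> KS uS vS wS; apply: (ext_iota_inj hext); rewrite !tri_classE.
by rewrite !edge_lift_act //; apply: edge_sub KS _ _.
Qed.

(** A change of base point conjugates the holonomy, which is central. *)
Lemma tri_class_rot u v w : tri_class v w u = tri_class u v w.
Proof.
apply: (ext_iota_inj hext); rewrite -(iota_conj hext _ (edge_lift u v)) !tri_classE.
by rewrite !mulgA mulgK.
Qed.

(** Reversing the loop inverts the holonomy, because the lifts are antisymmetric. *)
Lemma tri_class_swap u v w S : @simplex E S -> u \in S -> v \in S -> w \in S ->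
  tri_class v u w = - tri_class u v w.
Proof.
move=> KS uS vS wS; apply: (ext_iota_inj hext).
rewrite (iotaN hext) -[in RHS]tri_class_rot !tri_classE !invgM.
by rewrite -!edge_liftV ?mulgA //; apply: edge_sub KS _ _.
Qed.

Lemma tri_class_lift u v w S : @simplex E S -> u \in S -> v \in S -> w \in S ->
  (edge_lift u v * edge_lift v w = iota (tri_class u v w) * edge_lift u w)%g.
Proof.
by move=> KS uS vS wS; rewrite tri_classE (edge_liftV (edge_sub KS uS wS)) mulgVK.
Qed.

(** The cocycle identity is associativity of the product of the three lifts along t, u, v, w. *)
Lemma tri_class_cocycle t u v w S : @simplex E S -> t \in S -> u \in S -> v \in S ->
  w \in S -> tri_class u v w + tri_class t u w = tri_class t u v + tri_class t v w.
Proof.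
move=> KS tS uS vS wS; apply: (ext_iota_inj hext); rewrite !(ext_iotaD hext).
apply: (@mulIg _ (edge_lift t w)); rewrite -!mulgA.
rewrite -!(tri_class_lift KS) // [in LHS]mulgA (ext_central hext _ (edge_lift t u)) -mulgA.
by rewrite -(tri_class_lift KS uS) // !mulgA (tri_class_lift KS tS).
Qed.

Definition tri_cochain : simp_ambient E (trivial_gmodule G A) 2 :=
  fun t => tri_class (t (inord 0)) (t (inord 1)) (t (inord 2)).

Lemma tri_cochainP : @simp_cochain _ _ E (trivial_gmodule G A) 2 tri_cochain.
Proof.
have KS (t : osimplex E 2) := os_simplex t.
have mv (t : osimplex E 2) i := mem_vertices t i.
split=> [g t|]; first by rewrite /tri_cochain /= !ffunE (tri_class_act _ (KS t)).
apply: (triangle_alternating (c := tri_class)) => S u v w KS' uS vS wS.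
  exact: tri_class_rot.
exact: (tri_class_swap KS').
Qed.

End SimplicialClass.

Section Codifferential.
Variables (R : realType) (G : groupType) (E : finite_model R G) (M : gmodule G).

Lemma os_faceE n (i : 'I_n.+2) (t : osimplex E n.+1) (j : 'I_n.+1) :
  os_face i t j = t (inord (bump i j)).
Proof.
rewrite /= ffunE; congr (os_val t _); apply: val_inj.
rewrite /= inordK //; have := ltn_ord j; rewrite /bump; case: (leqP i j) => _; rewrite ?add1n ?add0n => jn //.
exact: leqW.
Qed.

Lemma codiff_edges (b : vertex E -> vertex E -> M) (t : osimplex E 2) :
  simp_codiff (fun e : osimplex E 1 => b (e ord0) (e ord_max)) t =
  b (t (inord 1)) (t (inord 2)) - b (t (inord 0)) (t (inord 2))
  + b (t (inord 0)) (t (inord 1)).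
Proof.
rewrite /simp_codiff !big_ord_recl big_ord0 addr0 !os_faceE /= /bump /=.
by rewrite !expr0 !expr1 ?expr2 /= !mulr1z mulrN1z addrA.
Qed.

Lemma codiff_triangles (c : vertex E -> vertex E -> vertex E -> M) (t : osimplex E 3) :
  simp_codiff (fun e : osimplex E 2 => c (e (inord 0)) (e (inord 1)) (e (inord 2))) t =
  c (t (inord 1)) (t (inord 2)) (t (inord 3)) - c (t (inord 0)) (t (inord 2)) (t (inord 3))
  + c (t (inord 0)) (t (inord 1)) (t (inord 3)) - c (t (inord 0)) (t (inord 1)) (t (inord 2)).
Proof.
rewrite /simp_codiff !big_ord_recl big_ord0 addr0 !os_faceE /= !inordK // /bump /=.
rewrite !expr0 !exprS !expr0 /= ?mulr1 ?mulr1z !mulrN1z.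
by rewrite !addrA.
Qed.

Lemma codiff_cochain n (b : simp_ambient E M n) : @simp_cochain _ _ E M n b ->
  forall g v, simp_codiff b (os_act g v) = gm_act g (simp_codiff b v).
Proof.
move=> [bg _] g v; rewrite /simp_codiff (morphB_sum (gm_actB g)).
by apply: eq_bigr => i _; rewrite os_act_face bg (morphBMsign (gm_actB g)).
Qed.

End Codifferential.

Section SimplicialClassComparison.
Variables (R : realType) (G Gt : groupType) (E : finite_model R G) (A : finZmodType).
Variables (iota : A -> Gt) (pr : Gt -> G).
Hypothesis hext : central_extension iota pr.
Variables (s : G -> Gt) (phi : vertex E -> G) (o : vertex E -> vertex E -> int).
Hypothesis prs : forall g, pr (s g) = g.
Hypothesis phiE : forall g v, phi (EG_act g v) = (g * phi v)%g.
Hypothesis o1 : forall v w, v != w -> simplex [fset v; w]%fset -> o v w = 1 \/ o v w = -1.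
Hypothesis oN : forall v w, v != w -> simplex [fset v; w]%fset -> o w v = - o v w.
Hypothesis oE : forall g v w, v != w -> simplex [fset v; w]%fset ->
  o (EG_act g v) (EG_act g w) = o v w.
Implicit Types (u v w : vertex E).

Local Notation edge_lift := (edge_lift s phi o).
Local Notation tri := (tri_class hext phi prs o).

Lemma tri_cochain_cocycle : simp_codiff (tri_cochain hext phi prs o) = 0.
Proof.
apply/funext => t.
rewrite [LHS](@codiff_triangles R G E (trivial_gmodule G A) tri t) /=.
have KS := os_simplex t; have m i := mem_vertices t i.
have := tri_class_cocycle hext phi prs o1 oN KS (m (inord 0)) (m (inord 1)) (m (inord 2)) (m (inord 3)).
move=> e; apply/eqP; rewrite subr_eq0 addrAC e addrK; exact: eqxx.
Qed.

Lemma tri_id u v w S : @simplex E S -> u \in S -> v \in S -> w \in S ->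
  [/\ tri u u w = 0, tri u v v = 0 & tri u v u = 0].
Proof.
move=> KS uS vS wS; split; apply: (ext_iota_inj hext); rewrite tri_classE (iota0 hext).
- by rewrite edge_lift_id mul1g (edge_liftV s phi o1 oN (edge_sub KS uS wS)) mulgV.
- by rewrite edge_lift_id mulg1 (edge_liftV s phi o1 oN (edge_sub KS uS vS)) mulgV.
- by rewrite edge_lift_id mulg1 (edge_liftV s phi o1 oN (edge_sub KS uS vS)) mulgV.
Qed.

Section BarToSimplicial.
Variable z : bar_ambient (trivial_gmodule G A) 2.
Hypothesis zC : bar_cochain z.
Local Notation z3 x y w := (z [ffun i => tnth [tuple x; y; w] i]).
Hypothesis zs : forall g h, (s g * s h)%g = (iota (z3 1 g (g * h)) * s (g * h))%g.
Variables (M : gmodule G) (th : A -> M).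
Hypothesis thB : {morph th : a b / a - b}.
Hypothesis thE : forall g a, gm_act g (th a) = th a.
Variable B : bar_ambient M 1.
Hypothesis BC : bar_cochain B.
Hypothesis zB : forall v : {ffun 'I_3 -> G}, th (z v) = bar_codiff B v.

Let corr_ex v w : exists a, edge_lift v w = (iota a * s ((phi v)^-1 * phi w))%g.
Proof. by apply: (pr_eq hext); rewrite (pr_edge_lift hext phi prs) prs. Qed.

Let corr v w : A := sval (cid (corr_ex v w)).

Let corrE v w : edge_lift v w = (iota (corr v w) * s ((phi v)^-1 * phi w))%g.
Proof. exact: svalP (cid (corr_ex v w)). Qed.

Let z3_act g (x y w : G) : z3 (g * x)%g (g * y)%g (g * w)%g = z3 x y w.
Proof.
rewrite -[RHS](zC g); congr z; apply/ffunP => i; rewrite !ffunE.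
by case: i => [[|[|[|]]]].
Qed.

Let B2 (x y : G) : M := B [ffun i => tnth [tuple x; y] i].

Let B2_act g (x y : G) : B2 (g * x)%g (g * y)%g = gm_act g (B2 x y).
Proof.
rewrite -BC; congr B; apply/ffunP => i; rewrite !ffunE.
by case: i => [[|[|]]].
Qed.

Let z3B (x y w : G) : th (z3 x y w) = B2 y w - B2 x w + B2 x y.
Proof.
rewrite zB /bar_codiff !big_ord_recl big_ord0 addr0 /= /bump /=.
rewrite !expr0 !expr1 ?expr2 /= !mulr1z mulrN1z addrA.
congr (B _ - B _ + B _); apply/ffunP => i; rewrite !ffunE.
- by case: i => [[|[|]]].
- by case: i => [[|[|]]].
- by case: i => [[|[|]]].
Qed.

Let tri_corr u v w S : @simplex E S -> u \in S -> v \in S -> w \in S ->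
  tri u v w = z3 (phi u) (phi v) (phi w) + corr u v + corr v w - corr u w.
Proof.
move=> KS uS vS wS; have := tri_class_lift hext phi prs o1 oN KS uS vS wS.
rewrite !corrE !mulgA -(mulgA (iota _)) -(ext_central hext) -!mulgA zs -!mulgA mulVKg.
rewrite -(z3_act (phi u) 1%g) mulg1 !mulVKg !mulgA -!(ext_iotaD hext).
move=> /mulIg/(ext_iota_inj hext) e; apply/eqP; rewrite -subr_eq opprK -e.
by rewrite [X in X == _](AC (2*1) (3*2*1)).
Qed.

(** The bar cocycle pulled back along phi differs from the class of the triangles by the coboundary
    of [corr], the discrepancy between the two lifts of an edge. The primitive is the pullback of B
    corrected by th(corr). *)
Lemma bar_to_simplicial : exists2 b : simp_ambient E M 1, @simp_cochain _ _ E M 1 b &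
  forall t, th (tri_cochain hext phi prs o t) = simp_codiff b t.
Proof.
pose bb v w : M := B2 (phi v) (phi w) + th (corr v w).
have bbD u v w S : @simplex E S -> u \in S -> v \in S -> w \in S ->
    th (tri u v w) = bb v w - bb u w + bb u v.
  move=> KS uS vS wS; rewrite (tri_corr KS) // thB !(morphBD thB) z3B /bb !opprD.
  by rewrite [RHS](AC (2*2*2) (1*3*5*6*2*4)).
(* Neither B nor [corr] is assumed alternating. Their sum is, because [tri] vanishes on degenerate
   triples and [bbD] holds for these as well. *)
have bb0 v : bb v v = 0.
  have KS := simplex_vertex v; have vv : v \in [fset v]%fset by rewrite inE.
  have := bbD v v v _ KS vv vv vv; have [-> _ _] := tri_id KS vv vv vv.
  by rewrite (morphB0 thB) subrr add0r.
have bbN v w : @simplex E [fset v; w]%fset -> bb w v = - bb v w.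
  move=> KS; have vS : v \in [fset v; w]%fset by rewrite !inE eqxx.
  have wS : w \in [fset v; w]%fset by rewrite !inE eqxx orbT.
  have := bbD v w v _ KS vS wS vS; have [_ _ ->] := tri_id KS vS wS vS.
  by rewrite (morphB0 thB) bb0 subr0 => /esym/eqP; rewrite addr_eq0 => /eqP.
have bb_act g v w : @simplex E [fset v; w]%fset ->
    bb (EG_act g v) (EG_act g w) = gm_act g (bb v w).
  move=> KS; rewrite /bb (morphBD (gm_actB g)) !phiE B2_act thE; congr (_ + th _).
  apply: (ext_iota_inj hext); apply: (@mulIg _ (s ((phi v)^-1 * phi w)%g)).
  rewrite -corrE -(edge_lift_act s phiE oE g KS) corrE !phiE.
  by rewrite invgM !mulgA mulgVK.
have edgeK (e : osimplex E 1) : @simplex E [fset e ord0; e ord_max]%fset.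
  exact: edge_sub (os_simplex e) (mem_vertices e _) (mem_vertices e _).
exists (fun e : osimplex E 1 => bb (e ord0) (e ord_max)).
  split=> [g e|]; first by rewrite /= !ffunE bb_act.
  apply: alternating_tperm => x y e xy; rewrite /= !ffunE -bbN //.
  have [[-> ->]|[-> ->]] : (x = ord0 /\ y = ord_max) \/ (x = ord_max /\ y = ord0).
    case: x y xy => [[|[|x]] hx] [[|[|y]] hy] //= _; [left|right]; split; exact: val_inj.
    by rewrite tpermL tpermR.
  by rewrite tpermL tpermR.
move=> t; rewrite (codiff_edges bb t); apply: (bbD _ _ _ _ (os_simplex t)); exact: mem_vertices.
Qed.

End BarToSimplicial.

Section SplittingCochain.
Variables (L : set G) (b : osimplex E 1 -> A).
Hypothesis bL : forall g e, L g -> b (os_act g e) = b e.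
Hypothesis bN : forall e, b (edge_swap e) = - b e.
Hypothesis bE : forall t, tri_cochain hext phi prs o t =
  simp_codiff (b : simp_ambient E (trivial_gmodule G A) 1) t.

Let bb := edge_fun b 0.

Let bbN v w : @simplex E [fset v; w]%fset -> bb w v = - bb v w.
Proof.
have [->|vw] := eqVneq v w; first by rewrite /bb edge_fun0 oppr0.
move=> /(edge_exists vw)[e [<- <-]]; rewrite /bb.
by have [s0 s1] := edge_swapE e; have := edge_funE b 0 (edge_swap e); rewrite s0 s1 edge_funE bN.
Qed.

Let bb_act g v w : L g -> @simplex E [fset v; w]%fset -> bb (EG_act g v) (EG_act g w) = bb v w.
Proof.
have [->|vw] := eqVneq v w; first by rewrite /bb !edge_fun0.
move=> Lg /(edge_exists vw)[e [<- <-]]; rewrite /bb.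
by have := edge_funE b 0 (os_act g e); rewrite /= !ffunE edge_funE bL.
Qed.

Let tri_bb u v w S : @simplex E S -> u \in S -> v \in S -> w \in S ->
  tri u v w = bb v w - bb u w + bb u v.
Proof.
move=> KS uS vS wS; have [t1 t2 t3] := tri_id KS uS vS wS.
have [<-|uv] := eqVneq u v.
  by rewrite t1 /bb edge_fun0 addr0 subrr.
have [<-|vw] := eqVneq v w; first by rewrite t2 /bb edge_fun0 sub0r addNr.
have [<-|uw] := eqVneq u w.
  by rewrite t3 (bbN (edge_sub KS uS vS)) /bb edge_fun0 subr0 addNr.
have [t [<- <- <-]] := triangle_exists uv vw uw KS uS vS wS.
have := bE t; rewrite /tri_cochain => ->.
transitivity (simp_codiff ((fun e => bb (e ord0) (e ord_max)) :
  simp_ambient E (trivial_gmodule G A) 1) t).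
  apply: (congr1 (fun f : simp_ambient E (trivial_gmodule G A) 1 => simp_codiff f t)).
  by apply/funext => e; rewrite /bb edge_funE.
exact: (@codiff_edges R G E (trivial_gmodule G A) bb t).
Qed.

Lemma splitting_cochain : exists sigma : G -> Gt,
  (forall g h, L g -> L h -> L (g * h)%g -> sigma (g * h)%g = (sigma g * sigma h)%g) /\
  (forall g, L g -> pr (sigma g) = g).
Proof.
(* Dividing the lifts by iota b removes the holonomy, since the coboundary of b is the class of the
   triangle. *)
have [el elD] : exists el, forall v w, el v w = (iota (- bb v w) * edge_lift v w)%g.
  by exists (fun v w => iota (- bb v w) * edge_lift v w)%g.
have el_flat u v w S : @simplex E S -> u \in S -> v \in S -> w \in S ->
    (el u v * el v w = el u w)%g.
  move=> KS uS vS wS; rewrite !elD !mulgA -[X in (X * _)%g]mulgA -(ext_central hext).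
  rewrite mulgA -mulgA (tri_class_lift hext phi prs o1 oN KS uS vS wS) (tri_bb KS) //.
  rewrite mulgA -!(ext_iotaD hext); congr (iota _ * _)%g.
  by rewrite [LHS](AC (2*3) ((2*3)*(1*5)*4)) /= !addNr !add0r.
(* Over the vertex v the lift s(phi v) is a reference point in the fibre of Gt; measured against
   these, the flat system becomes a cocycle with values in A. *)
have ex v w : exists a, iota a = (s (phi v) * el v w * (s (phi w))^-1)%g.
  have [|a ->] := (ext_exact hext (s (phi v) * el v w * (s (phi w))^-1)%g).1; last by exists a.
  rewrite elD !(ext_prM hext) (pr_iota hext) mul1g (pr_edge_lift hext phi prs) (prV hext) !prs.
  by rewrite mulVKg mulgV.
pose k v w := sval (cid (ex v w)).
have kE v w : iota (k v w) = (s (phi v) * el v w * (s (phi w))^-1)%g := svalP (cid (ex v w)).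
have kD S : @simplex E S -> forall u v w, u \in S -> v \in S -> w \in S -> k u v + k v w = k u w.
  move=> KS u v w uS vS wS; apply: (ext_iota_inj hext); rewrite (ext_iotaD hext) !kE.
  by rewrite !mulgA mulgVK -(mulgA (s _)) (el_flat _ _ _ S).
have [a aE] := contractible_cocycle_trivial (EG_contractible E) kD.
have [psi psiD] : exists psi, forall v, psi v = (iota (a v) * s (phi v))%g.
  by exists (fun v => iota (a v) * s (phi v))%g.
have elE v w : @simplex E [fset v; w]%fset -> el v w = ((psi v)^-1 * psi w)%g.
  move=> /aE e; have := kE v w; rewrite e => kE'.
  rewrite !psiD invgM -(iotaN hext) !mulgA -(mulgA _ _ (iota (a w))) -(ext_iotaD hext).
  by rewrite [- a v + _]addrC kE' !mulgA mulVg mul1g mulgVK.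
have el_act g v w : L g -> @simplex E [fset v; w]%fset ->
    el (EG_act g v) (EG_act g w) = el v w.
  by move=> Lg KS; rewrite !elD bb_act // (edge_lift_act s phiE oE).
have [v0 _] := vertex_exists (EG_contractible E).
(* For g in L, both psi and its translate by g trivialize the invariant system [el], so they differ
   by a constant left factor; this factor is sigma g. *)
have const g : L g -> forall v w, (psi (EG_act g v) * (psi v)^-1 = psi (EG_act g w) * (psi w)^-1)%g.
  move=> Lg; apply: (contractible_connected (EG_contractible E)) => v w KS.
  have KS' : @simplex E [fset EG_act g v; EG_act g w]%fset.
    have := EG_simplicial g KS; congr (@simplex E _); apply/fsetP => x; rewrite !inE.
    apply/imfsetP/orP => /= [[y]|[/eqP->|/eqP->]].
    - by rewrite !inE => /orP[] /eqP -> ->; [left|right].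
    - by exists v; rewrite ?inE ?eqxx.
    - by exists w; rewrite ?inE ?eqxx ?orbT.
  have := el_act g v w Lg KS; rewrite !elE // => e.
  by rewrite -[psi (EG_act g w)](mulVKg (psi (EG_act g v))) e !mulgA mulgK.
exists (fun g => psi (EG_act g v0) * (psi v0)^-1)%g; split=> [g h Lg Lh Lgh|g Lg].
  by rewrite (const g Lg v0 (EG_act h v0)) mulgA mulgVK -(EG_action E).2.
by rewrite (ext_prM hext) (prV hext) !psiD !(ext_prM hext) !(pr_iota hext) !mul1g !prs phiE mulgK.
Qed.

End SplittingCochain.

End SimplicialClassComparison.

Section CochainSquare.
Variables (R : realType) (G : groupType) (E : finite_model R G) (M : gmodule G).
Variable b : simp_ambient E M 1.
Hypothesis bC : @simp_cochain _ _ E M 1 b.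

Let bb : vertex E -> vertex E -> M := edge_fun b 0.

Let bE : b = (fun e : osimplex E 1 => bb (e ord0) (e ord_max)).
Proof. by apply/funext => e; rewrite /bb edge_funE. Qed.

Let bbN S v w : @simplex E S -> v \in S -> w \in S -> bb w v = - bb v w.
Proof.
move=> KS vS wS; have [->|vw] := eqVneq v w; first by rewrite /bb edge_fun0 oppr0.
have [e [<- <-]] := edge_exists vw (edge_sub KS vS wS); rewrite /bb.
have [s0 s1] := edge_swapE e; have := edge_funE b 0 (edge_swap e).
by rewrite s0 s1 edge_funE bC.2 odd_tperm /= expr1 mulrN1z.
Qed.

Let dd u v w := bb v w - bb u w + bb u v.

Let dbE : simp_codiff b =
  (fun e : osimplex E 2 => dd (e (inord 0)) (e (inord 1)) (e (inord 2))).
Proof.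
by apply/funext => t; rewrite [in LHS]bE; exact: (codiff_edges bb t).
Qed.

Lemma simp_codiff_codiff : simp_codiff (simp_codiff b) = 0.
Proof.
apply/funext => t; rewrite dbE [LHS](codiff_triangles dd t) /dd.
move: (bb _ _) (bb _ _) (bb _ _) (bb _ _) (bb _ _) (bb _ _) => p q r x y z.
rewrite !opprD !opprK [LHS](AC (3*3*3*3) ((1*4)*(7*2)*(3*10)*(5*8)*(6*11)*(9*12))) /=.
by rewrite !addrN !addNr !addr0.
Qed.

Lemma simp_codiffC : @simp_cochain _ _ E M 2 (simp_codiff b).
Proof.
split; first exact: codiff_cochain.
rewrite dbE => s t; apply: (triangle_alternating (c := dd)) => S u v w KS uS vS wS.
  rewrite /dd (bbN KS uS wS) (bbN KS uS vS) opprK.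
  by rewrite [RHS](AC (2*1) (2*3*1)).
rewrite /dd (bbN KS uS vS) !opprD opprK.
by rewrite [bb u w - _]addrC.
Qed.

End CochainSquare.

Section LowerBound.
Variables (R : realType) (A : finZmodType) (G : groupType).
Variables (E : finite_model R G) (nu : forall n : nat, BG E n -> R).
Hypothesis hnu : faithful_probability nu.
Hypothesis hcos : cosystolic_inequality nu A 2 (@finite_transitive_mgba R G).

(** From here on the extension is seen only through c: the third clause turns vanishing over P into
    a primitive of theta c, and the fourth forbids primitives over G/L. *)
Lemma central_simplicial_cocycle (Gt : groupType) (iota : A -> Gt) (pr : Gt -> G)
    (alpha : group_cohomology (trivial_gmodule G A) 2) :
  central_extension iota pr -> classifies iota pr alpha ->
  exists c : simp_ambient E (trivial_gmodule G A) 2,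
  [/\ @simp_cochain _ _ E (trivial_gmodule G A) 2 c, simp_codiff c = 0,
    forall P : mgba R G, cohom_map (theta P A) alpha = 0 ->
      exists2 b : simp_ambient E (PA P A) 1, @simp_cochain _ _ E (PA P A) 1 b &
        forall t, theta P A (c t) = simp_codiff b t &
    residually_finite G -> ~ residually_finite Gt ->
      forall (L : finite_index_subgroup G)
      (b : simp_ambient E (PA (transitive_mgba R L) A) 1),
      @simp_cochain _ _ E (PA (transitive_mgba R L) A) 1 b ->
      ~ (forall t, theta (transitive_mgba R L) A (c t) = simp_codiff b t)].
Proof.
move=> hext [s [z [zalpha prs sz]]].
have [phi phiE] := vertex_equivariant E; have [d [d1 dN dE]] := orientation E.
exists (tri_cochain hext phi prs d); split.
- exact: tri_cochainP.
- exact: tri_cochain_cocycle.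
- move=> P /eqP; rewrite -zalpha cohom_mapE => /eqP e.
  have /asboolP[B BC zB] : bar_map (theta P A) z \in @coboundary_pred (bar_complex (PA P A)) 2.
    by rewrite -[X in X \in _]subr0 Quotient.idealrBE; apply/eqP; rewrite [LHS]e -[LHS](raddf0 (\pi_(Quotient.quot (@coboundary_pred (bar_complex (PA P A)) 2)))).
  have /asboolP[zC _] := cocycleP z.
  apply: (@bar_to_simplicial _ _ _ _ _ _ _ hext s phi d prs phiE d1 dN dE
    (cocycle_val z) zC sz (PA P A) (theta P A) (ghB (theta P A)) _ B BC).
    by move=> g a; rewrite -gh_equivariant.
  by move=> v; have := congr1 (fun f => f v) zB.
- move=> rG nrGt L b [bg bs] bE; apply: nrGt.
  (* L fixes the base coset, so the values of b evaluated there are invariant under L. *)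
  pose C0 : coset_space L := exist (fun D => D \in lcosets L) (lcoset 1%g L)
    (mem_set (imageP (fun g => lcoset g L) (I : [set: G] 1%g))).
  have evB := PA_evB (A := A) (point_charP R C0).
  have [|||sigma [sM sK]] := @splitting_cochain _ _ _ _ _ _ _ hext s phi d prs phiE d1 dN dE
    (L : set G) (fun e => PA_ev (point_char (R := R) C0) (b e)).
  - move=> g e Lg; rewrite bg.
    move: (b e); apply: PA_hom_eq => [x y|x y|X a]; first by rewrite gm_actB evB.
      by rewrite evB.
    rewrite [gm_act g _]PA_act_tensor !(PA_ev_tensor (point_charP R C0)); congr (_ *+ _).
    rewrite /point_char; congr asbool.
    rewrite -[mact g X]/(coset_act g X) /coset_act /=; congr (X _); apply: val_inj => /=.
    rewrite lcoset1; have [L1 LM LV] := fis_subgroup L; apply/seteqP; split=> x.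
      by move=> [h Lh <-]; apply: LM => //; exact: LV.
    by move=> Lx; exists (g * x)%g; rewrite ?mulKg //; exact: LM.
  - by move=> e; rewrite bs odd_tperm /= expr1 mulrN1z (morphBN evB).
  - move=> t; rewrite [RHS](_ : _ = PA_ev (point_char C0) (simp_codiff b t)).
      rewrite -bE /= (PA_ev_tensor (point_charP R C0)) (char_top (point_charP R C0)) //.
    rewrite /simp_codiff (morphB_sum evB); apply: eq_bigr => i _.
    by rewrite (morphBMsign evB).
  - apply: (split_residually_finite hext _ sK rG) => g h Lg Lh; apply: sM => //.
    exact: subgM (fis_subgroup L) _ _ Lg Lh.
Qed.

End LowerBound.

(** * Lower bounds over finite actions *)

Section FiniteAlgebra.
Variables (R : realType) (G : groupType) (Q : mgba R G).
Hypothesis finQ : finite_set [set: Q].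

Definition is_atom (p : Q) : Prop :=
  p != \bot%O /\ forall X : Q, (X <= p)%O -> X = \bot%O \/ X = p.

Let F := fset_set [set: Q].
Let inF X : X \in F.
Proof. by rewrite in_fset_set ?inE. Qed.

Lemma atom_meet p X : is_atom p -> ~~ (p <= X)%O -> (p `&` X = \bot)%O.
Proof.
move=> [p0 pA] pX; have [//|pXp] := pA (p `&` X)%O (leIl _ _).
by move: pX; rewrite leEmeet pXp eqxx.
Qed.

Lemma atom_char p : is_atom p -> is_char (fun X : Q => (p <= X)%O).
Proof.
move=> pA; split=> X; first by move=> Y; rewrite lexI.
rewrite -disj_leC; have [pX|npX] := boolP (p <= X)%O.
  by rewrite (meet_idPl pX); apply/negbTE; case: pA.
by rewrite (atom_meet pA npX) eqxx.
Qed.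

Lemma mu_sum_atoms X : mu X = \sum_(p <- F | `[< is_atom p >] && (p <= X)%O) mu p.
Proof.
have [n] := ubnP (count (fun Y => (Y <= X)%O) F); elim: n X => // n IH X.
rewrite ltnS => cX; have [->|X0] := eqVneq X \bot%O.
  rewrite (bmu0 (mu_measure Q)) big1 // => p /andP[/asboolP[p0 _]].
  by rewrite lex0 (negbTE p0).
have lt_count Y : (Y < X)%O -> (count (fun Z => (Z <= Y)%O) F < n)%N.
  move=> YX; apply: leq_trans cX.
  rewrite -!size_filter; have u : uniq (enum_fset F) := fset_uniq F.
  apply: (@uniq_leq_size _ (X :: [seq Z <- F | (Z <= Y)%O])).
    by rewrite /= filter_uniq // andbT mem_filter (lt_geF YX).
  move=> Z; rewrite inE mem_filter => /orP[/eqP ->|/andP[ZY ZF]].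
    by rewrite mem_filter lexx inF.
  by rewrite mem_filter ZF (le_trans ZY (ltW YX)).
have [Xa|nXa] := pselect (is_atom X).
  rewrite big_mkcond (bigD1_seq X) ?fset_uniq ?inF //= lexx asboolT //=.
  rewrite big1 ?addr0 // => p pnX; case: ifP => // /andP[/asboolP[p0 _] pX].
  have [pb|pXe] := Xa.2 p pX; first by rewrite pb eqxx in p0.
  by rewrite pXe eqxx in pnX.
have [Y YX [Y0 YneX]] : exists2 Y, (Y <= X)%O & Y != \bot%O /\ Y != X.
  apply: contrapT => nY; apply: nXa; split=> // Y YX.
  have [->|Y0] := eqVneq Y \bot%O; first by left.
  have [->|YneX] := eqVneq Y X; first by right.
  by case: nY; exists Y.
have YltX : (Y < X)%O by rewrite lt_neqAle YneX.
have DltX : (X `\` Y < X)%O.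
  rewrite lt_neqAle leBx andbT; apply: contra Y0 => /eqP e.
  by have := diffKI X Y; rewrite e (meet_idPl YX) => ->.
rewrite (mu_split X Y) meetC (meet_idPl YX) (IH Y (lt_count _ YltX)) (IH _ (lt_count _ DltX)).
rewrite [RHS](bigID (fun p => (p <= Y)%O)) /=; congr (_ + _); apply: eq_bigl => p.
  rewrite -andbA; congr (_ && _); case: (boolP (p <= Y)%O) => [pY|]; rewrite ?andbF //.
  by rewrite (le_trans pY YX).
rewrite -andbA; case: (asboolP (is_atom p)) => //= pA.
by rewrite diffE lexI -disj_leC; congr (_ && _); rewrite disj_leC (atom_char pA).2.
Qed.

(** The kernel of the action instead of the stabilizer of one atom, so that a single G/L serves all
    atoms. *)
Definition act_kernel : set G := [set g | forall X : Q, mact g X = X].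

Lemma act_kernel_subgroup : is_subgroup act_kernel.
Proof.
have [a1 aM] := mact_action Q; split=> [X|g h kg kh X|g kg X] //.
  by rewrite aM kh kg.
by rewrite -{1}(kg X) -aM mulVg a1.
Qed.

Lemma act_kernel_finite : finite_set (lcosets act_kernel).
Proof.
have [a1 aM] := mact_action Q.
pose k (g : G) : {ffun F -> F} := [ffun X : F => [` inF (mact g (val X))]%fset].
have kE g h : k g = k h -> forall X : Q, mact g X = mact h X.
  by move=> /ffunP e X; have := e [` inF X]%fset; rewrite !ffunE => /(congr1 val).
apply: (@sub_finite_set _ _ ((fun f => [set g | k g = f]) @` [set: {ffun F -> F}])).
  move=> _ [g _ <-]; exists (k g) => //; apply/seteqP; split=> x /=.
    move=> /kE e; exists (g^-1 * x)%g; rewrite ?mulVKg // => X.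
    by rewrite aM e -aM mulVg a1.
  move=> [h kh <-]; apply/ffunP => X; rewrite !ffunE; apply: val_inj => /=.
  by rewrite aM kh.
by apply: finite_image; exact: finite_finset.
Qed.

Definition act_kernel_fis : finite_index_subgroup G :=
  FiniteIndexSubgroup act_kernel_subgroup act_kernel_finite.

Local Notation L := act_kernel_fis.

Definition coset_rep (C : coset_space L) : G := xget 1%g (val C).

Lemma coset_rep_in (C : coset_space L) : val C (coset_rep C).
Proof.
have := valP C; rewrite inE => -[h _ hC].
apply: (@xgetPex _ 1%g (val C)); exists h; rewrite -hC.
by exists 1%g; [exact (subg1 act_kernel_subgroup)|rewrite mulg1].
Qed.

Lemma coset_repE (C : coset_space L) g (X : Q) : val C g ->
  mact g^-1%g X = mact (coset_rep C)^-1%g X.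
Proof.
have [a1 aM] := mact_action Q; have := valP C; rewrite inE => -[h _ hC].
have key r : val C r -> val C g -> mact g^-1%g X = mact r^-1%g X.
  rewrite -hC => -[x kx <-] [y ky <-].
  have kV z : act_kernel z -> forall Y : Q, mact z^-1%g Y = Y.
    by move=> kz; exact (subgV act_kernel_subgroup kz).
  by rewrite !invgM !aM (kV _ kx) (kV _ ky).
apply: key; exact: coset_rep_in.
Qed.

Section AtomMap.
Variable p : Q.
Hypothesis pA : is_atom p.

(* X goes to the set of cosets g act_kernel with g p <= X. *)
Definition atom_map (X : Q) : transitive_mgba R L :=
  [set C : coset_space L | (p <= mact (coset_rep C)^-1%g X)%O].

Lemma atom_map_hom : bool_hom atom_map.
Proof.
have [cI cC] := atom_char pA.
have mh g := mact_hom Q g.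
split=> [X Y|X Y|X||]; apply/seteqP; split=> C; rewrite /atom_map /=.
- by rewrite (bool_homI (mh _)) lexI => /andP[].
- by move=> [? ?]; rewrite (bool_homI (mh _)) lexI; apply/andP.
- rewrite -{1}(complK X) -{1}(complK Y) -complI !(bool_homC (mh _)) cC (bool_homI (mh _)) cI negb_and.
  by rewrite -!cC -!(bool_homC (mh _)) !complK => /orP.
- move=> h; rewrite -(complK X) -(complK Y) -complI !(bool_homC (mh _)) cC (bool_homI (mh _)) cI negb_and.
  by rewrite -!cC -!(bool_homC (mh _)) !complK; apply/orP.
- by rewrite (bool_homC (mh _)) cC => /negP.
- by move=> /negP; rewrite (bool_homC (mh _)) cC.
- by rewrite (bool_hom0 (mh _)) lex0 => /eqP p0; case: pA; rewrite p0 eqxx.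
- by [].
- by [].
- by move=> _; rewrite (bool_hom1 (mh _)) lex1.
Qed.

Lemma atom_map_act g X : atom_map (mact g X) = mact g (atom_map X).
Proof.
have [a1 aM] := mact_action Q.
have e C : mact (coset_rep C)^-1%g (mact g X) = mact (coset_rep (translate g^-1%g C))^-1%g X.
  rewrite -(@coset_repE (translate g^-1%g C) (g^-1 * coset_rep C)%g X).
    by rewrite invgM invgK aM.
  by exists (coset_rep C) => //; exact: coset_rep_in.
by apply/seteqP; split=> C; rewrite /atom_map /= e.
Qed.

End AtomMap.

(** A single [atom_map p] need not preserve the measure, but the average does: for each coset gL the
    atoms below g^-1 X have total mass mu (g^-1 X) = mu X. *)
Lemma atom_average X :
  \sum_(p <- F | `[< is_atom p >]) mu p * coset_mu R (atom_map p X) = mu X.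
Proof.
have fin := @finite_coset_space G L.
pose T := fset_set [set: coset_space L].
have cardE S : coset_card R S = \sum_(C <- T) (`[< S C >])%:R.
  have <- : (count (fun C => `[< S C >]) T)%:R = \sum_(C <- T) (`[< S C >])%:R :> R.
    by rewrite -sum1_count natr_sum big_mkcond; apply: eq_bigr => C _; case: asbool.
  rewrite /coset_card -size_filter; congr _%:R.
  apply: perm_size; apply: uniq_perm; rewrite ?fset_uniq ?filter_uniq ?fset_uniq //.
  move=> C; rewrite mem_filter !in_fset_set // in_setT andbT.
  by apply/idP/asboolP => [|SC]; rewrite inE.
under eq_bigr do rewrite /coset_mu mulrA.
rewrite -mulr_suml.
have -> : \sum_(p <- F | `[< is_atom p >]) mu p * coset_card R (atom_map p X) =
    coset_card R [set: coset_space L] * mu X.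
  under eq_bigr do rewrite cardE mulr_sumr.
  rewrite exchange_big cardE mulr_suml /=; apply: eq_bigr => C _.
  rewrite asboolT // mul1r -(mu_act (coset_rep C)^-1%g X) mu_sum_atoms [RHS]big_mkcondr /=.
  apply: eq_bigr => p _; rewrite /atom_map /=; case: asboolP => [->|/negP/negbTE ->].
    by rewrite mulr1.
  by rewrite mulr0.
by rewrite mulrAC mulfV ?mul1r // gt_eqF // coset_card_gt0.
Qed.

End FiniteAlgebra.

Section Defect.
Variables (R : realType) (A : finZmodType) (G : groupType) (E : finite_model R G).

Definition BG_enum n := fset_set [set: BG E n].

(** It measures how far b is from being a primitive of theta c, and it is natural under Boolean
    homomorphisms, measure preserving or not. *)
Definition defect (c : simp_ambient E (trivial_gmodule G A) 2) (P : mgba R G)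
    (b : simp_ambient E (PA P A) 1) (t : osimplex E 2) : PA P A :=
  theta P A (c t) - simp_codiff b t.

Variables (P Q : mgba R G) (f : P -> Q).
Hypothesis fh : bool_hom f.

Lemma simp_cochain_map n (b : simp_ambient E (PA P A) n) :
  (forall g X, f (mact g X) = mact g (f X)) ->
  @simp_cochain _ _ E (PA P A) n b ->
  @simp_cochain _ _ E (PA Q A) n (fun t => PA_map f (b t)).
Proof.
move=> fE [bg bs]; split=> [g t|s t]; last by rewrite bs (morphBMsign (PA_mapB fh)).
by rewrite bg; exact: (PA_map_act fh).
Qed.

Lemma defect_map c (b : simp_ambient E (PA P A) 1) t :
  PA_map f (defect c b t) = defect c (fun t => PA_map f (b t) : PA Q A) t.
Proof.
rewrite /defect (PA_mapB fh); congr (_ - _); first exact: (PA_map_theta fh).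
rewrite /simp_codiff (morphB_sum (PA_mapB fh)); apply: eq_bigr => i _.
by rewrite (morphBMsign (PA_mapB fh)).
Qed.

End Defect.

Section LowerBounds.
Variables (R : realType) (A : finZmodType) (G : groupType).
Variables (E : finite_model R G) (nu : forall n : nat, BG E n -> R).
Hypothesis hnu : faithful_probability nu.
Hypothesis hcos : cosystolic_inequality nu A 2 (@finite_transitive_mgba R G).
Variable c : simp_ambient E (trivial_gmodule G A) 2.
Hypothesis cC : @simp_cochain _ _ E (trivial_gmodule G A) 2 c.
Hypothesis dc : simp_codiff c = 0.
Hypothesis c_nontrivial : forall (L : finite_index_subgroup G)
  (b : simp_ambient E (PA (transitive_mgba R L) A) 1),
  @simp_cochain _ _ E (PA (transitive_mgba R L) A) 1 b ->
  ~ (forall t, theta (transitive_mgba R L) A (c t) = simp_codiff b t).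

Let thC (P : mgba R G) : @simp_cochain _ _ E (PA P A) 2 (fun t => theta P A (c t)).
Proof.
split=> [g t|s t]; first by rewrite cC.1; exact: (gh_equivariant (theta P A)).
by rewrite cC.2 (morphBMsign (ghB (theta P A))).
Qed.

Let dth (P : mgba R G) : simp_codiff ((fun t => theta P A (c t)) : simp_ambient E (PA P A) 2) = 0.
Proof.
apply/funext => t; transitivity (theta P A (simp_codiff c t)).
  rewrite /simp_codiff (morphB_sum (ghB (theta P A))); apply: eq_bigr => i _.
  by rewrite (morphBMsign (ghB (theta P A))).
by rewrite dc (morphB0 (ghB (theta P A))).
Qed.

(** theta c and its defect represent the same class, nonzero by [c_nontrivial], so the cosystolic
    constant bounds the norm of the defect. *)
Lemma transitive_lower_bound : exists2 e : R, 0 < e &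
  forall (L : finite_index_subgroup G)
  (b : simp_ambient E (PA (transitive_mgba R L) A) 1),
  @simp_cochain _ _ E (PA (transitive_mgba R L) A) 1 b ->
  e <= \sum_(x <- BG_enum E 2) mu_PA (defect c b (repr x)) * nu x.
Proof.
have [e e0 he] := hcos; exists e => // L b bC.
set P := transitive_mgba R L in b bC *; pose K := simp_complex E (PA P A).
have zP : ((fun t => theta P A (c t)) : ambient K 2) \in @cocycle_pred K 2.
  by apply/asboolP; split; [exact (thC P)|exact (dth P)].
have zbP : (defect c b : ambient K 2) \in @cocycle_pred K 2.
  apply/asboolP; split.
    exact: (@simp_cochainB _ _ E (PA P A) 2 _ _ (thC P) (simp_codiffC bC)).
  transitivity (simp_codiff ((fun t => theta P A (c t)) : simp_ambient E (PA P A) 2)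
    - simp_codiff (simp_codiff b)); first exact: simp_codiffB.
  by rewrite dth simp_codiff_codiff // subrr.
have beta0 : cohom_class (Cocycle zP) != 0.
  apply/eqP => beta0; have : Cocycle zP \in @coboundary_pred K 2.
    rewrite -[Cocycle zP]subr0 Quotient.idealrBE; apply/eqP; rewrite [LHS]beta0.
    by rewrite -[LHS](raddf0 (\pi_(Quotient.quot (@coboundary_pred K 2)))).
  move=> /asboolP[b' b'C b'E]; apply: (c_nontrivial b'C) => t.
  exact: (congr1 (fun f => f t) b'E).
apply: le_trans (he P _ _ beta0) _; first by exists L.
have nn (z : simp_ambient E (PA P A) 2) (x : BG E 2) : 0 <= mu_PA (z (repr x)) * nu x.
  by rewrite mulr_ge0 ?mu_PA_transitive_ge0 // ltW // (hnu 2).1.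
have -> : \sum_(x <- BG_enum E 2) mu_PA (defect c b (repr x)) * nu x =
    cochain_norm nu (defect c b : simp_ambient E (PA P A) 2).
  by rewrite /cochain_norm fsbig_finite //; exact: finite_BG.
apply: ge_inf.
  exists 0 => _ [z _ <-]; rewrite /cochain_norm fsbig_finite; last exact: finite_BG.
  by apply: sumr_ge0 => x _; exact: nn.
exists (Cocycle zbP) => //=.
apply/eqP; rewrite -Quotient.idealrBE; apply/asboolP.
exists (- b); first by rewrite -[- b]sub0r; apply: simp_cochainB => //; exact: simp_cochain0.
have dN : simp_codiff (- b) = - simp_codiff b :> simp_ambient E (PA P A) 2.
  exact: (morphBN (@simp_codiffB _ _ E (PA P A) 1)).
rewrite [RHS]dN; apply/funext => t.
by rewrite -[LHS]/(theta P A (c t) - simp_codiff b t - theta P A (c t)) addrAC subrr sub0r.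
Qed.

(** Each atom sends b to the transitive action, where the image of the presentation has size at
    least e. Averaging with the masses of the atoms, which sum to 1, returns the original masses by
    [atom_average]. *)
Lemma finite_lower_bound : exists2 e : R, 0 < e &
  forall (Q : mgba R G), finite_mgba Q ->
  forall (b : simp_ambient E (PA Q A) 1), @simp_cochain _ _ E (PA Q A) 1 b ->
  forall s : BG E 2 -> seq (Q * A),
  (forall x, defect c b (repr x) = \sum_(p <- s x) tensor p.1 p.2) ->
  e <= \sum_(x <- BG_enum E 2) (\sum_(p <- s x) mu p.1) * nu x.
Proof.
have [e e0 he] := transitive_lower_bound; exists e => // Q finQ b bC s sE.
pose F := fset_set [set: Q].
have hp (p : Q) : is_atom p -> e <= \sum_(x <- BG_enum E 2)
    (\sum_(q <- s x) coset_mu R (atom_map (finQ := finQ) p q.1)) * nu x.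
  move=> pA; pose f := PA_map (A := A) (atom_map (finQ := finQ) p).
  have fB : {morph f : x y / x - y} := PA_mapB (atom_map_hom finQ pA).
  have fbC : @simp_cochain _ _ E (PA (transitive_mgba R (act_kernel_fis finQ)) A) 1 (fun t => f (b t)).
    by apply: (simp_cochain_map (atom_map_hom finQ pA)) => //; exact: atom_map_act.
  apply: le_trans (he _ _ fbC) _; apply: ler_sum => x _.
  rewrite ler_wpM2r //; first by rewrite ltW // (hnu 2).1.
  rewrite -(defect_map (atom_map_hom finQ pA)) sE (morphB_sum (PA_mapB (atom_map_hom finQ pA))).
  rewrite -(big_map (fun q => (atom_map (finQ := finQ) p q.1, q.2)) xpredT (fun q => mu q.1)).
  apply: le_trans (mu_PA_sum_le _); rewrite big_map le_eqVlt; apply/orP; left; apply/eqP.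
  congr mu_PA; apply: eq_bigr => q _; exact: (PA_map_tensor (atom_map_hom finQ pA)).
have mu1 : \sum_(p <- F | `[< is_atom p >]) mu p = 1.
  rewrite -(bmu1 (mu_measure Q)) (mu_sum_atoms finQ).
  by apply: eq_bigl => p; rewrite lex1 andbT.
have -> : e = \sum_(p <- F | `[< is_atom p >]) mu p * e by rewrite -mulr_suml mu1 mul1r.
apply: (@le_trans _ _ (\sum_(p <- F | `[< is_atom p >]) mu p * \sum_(x <- BG_enum E 2)
    (\sum_(q <- s x) coset_mu R (atom_map (finQ := finQ) p q.1)) * nu x)).
  apply: ler_sum => p /asboolP pA; rewrite ler_wpM2l ?hp //.
  exact: bmu_ge0 (mu_measure Q) _.
under eq_bigr do rewrite mulr_sumr.
rewrite exchange_big le_eqVlt; apply/orP; left; apply/eqP; apply: eq_bigr => x _.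
under eq_bigr do rewrite mulrA mulr_sumr.
rewrite -mulr_suml exchange_big; congr (_ * _); apply: eq_bigr => q _.
exact: atom_average.
Qed.

End LowerBounds.

(** * Ultraproducts *)

Section SeparatedLift.
Variables (R : realType) (A : finZmodType) (G : groupType) (E : finite_model R G).
Variable P : mgba R G.

Lemma PA_sep_surj (y : PA (Defs.separated P) A) : exists x, PA_map (sep_proj (P := P)) x = y.
Proof.
have mB := PA_mapB (A := A) (sep_proj_hom P).
elim/PA_ind: y => [|_ _ [x <-] [y <-]|Y a]; first by exists 0; exact: (morphB0 mB).
  by exists (x - y).
have [X <-] := sep_proj_surj Y; exists (tensor X a).
exact: (PA_map_tensor (sep_proj_hom P)).
Qed.

Lemma cochain_eq (M : gmodule G) n (b b' : simp_ambient E M n) :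
  @simp_cochain _ _ E M n b -> @simp_cochain _ _ E M n b' ->
  (forall x : BG E n, b (repr x) = b' (repr x)) -> b = b'.
Proof.
move=> [bg bs] [bg' bs'] e; apply/funext => v; have [[g s] ->] := os_rep v.
by rewrite bg bg' bs bs' e.
Qed.

(** Ultraproducts and measure algebras are both quotients by null sets, and approximation takes
    place before the quotient. Lifting values on representatives only keeps the lift a cochain; its
    defect dies in the quotient, so [sep_kernel] applies. *)
Lemma separated_lift c (b : simp_ambient E (PA (Defs.separated P) A) 1) :
  @simp_cochain _ _ E (PA (Defs.separated P) A) 1 b ->
  (forall t, defect c b t = 0) ->
  exists2 b' : simp_ambient E (PA P A) 1, @simp_cochain _ _ E (PA P A) 1 b' &
    forall t, exists2 s : seq (P * A), defect c b' t = \sum_(p <- s) tensor p.1 p.2 &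
      forall p, p \in s -> mu p.1 = 0.
Proof.
move=> bC b0; pose c0 e := sval (cid (PA_sep_surj (b e))).
have c0E e : PA_map (sep_proj (P := P)) (c0 e) = b e := svalP (cid (PA_sep_surj (b e))).
have [b' b'C b'E] := cochain_extend (M := PA P A) c0; exists b' => // t.
apply: sep_kernel; rewrite (defect_map (sep_proj_hom P)).
rewrite [X in defect _ X](_ : _ = b) //; apply: cochain_eq => // [|x].
  by apply: (simp_cochain_map (sep_proj_hom P)) => //; exact: sep_proj_act.
by rewrite b'E c0E.
Qed.

End SeparatedLift.

Section Ultraproduct.
Variables (R : realType) (A : finZmodType) (G : groupType) (E : finite_model R G).
Variables (I : Type) (U : set_system I) (UU : UltraFilter U) (Q : I -> mgba R G).

Lemma filter_sum_small (K : eqType) (r : seq K) (F : K -> I -> R) :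
  (forall k, k \in r -> forall e : R, 0 < e -> U [set j | F k j < e]) ->
  forall e : R, 0 < e -> U [set j | \sum_(k <- r) F k j < e].
Proof.
have FU : ProperFilter U := @ultra_proper _ _ UU.
elim: r => [_|k r IH Fr] e e0.
  by apply: filterE => j; rewrite /= big_nil.
have e2 : 0 < e / 2 by lra.
have Fk := Fr k (mem_head _ _) _ e2.
have Fr' : U [set j | \sum_(k <- r) F k j < e / 2].
  by apply: IH => // k' k'r; apply: Fr; rewrite inE k'r orbT.
apply: filterS (filterI Fk Fr').
by move=> j /= [h1 h2]; rewrite big_cons; lra.
Qed.

(** The null sets in the defect of the lift form finitely many finite lists, fixed before any
    coordinate is chosen; their masses at j tend to 0 along U, so one j makes the weighted sum
    small. *)
Lemma ultraproduct_defect_small (nu : forall n : nat, BG E n -> R) c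
    (b : simp_ambient E (PA (ultraproduct UU Q) A) 1) (e : R) :
  (forall x, 0 < @nu 2 x) -> 0 < e ->
  @simp_cochain _ _ E (PA (ultraproduct UU Q) A) 1 b ->
  (forall t, defect c b t = 0) ->
  exists j (b' : simp_ambient E (PA (Q j) A) 1) (s : BG E 2 -> seq (Q j * A)),
  [/\ @simp_cochain _ _ E (PA (Q j) A) 1 b',
    forall x, defect c b' (repr x) = \sum_(p <- s x) tensor p.1 p.2 &
    \sum_(x <- BG_enum E 2) (\sum_(p <- s x) mu p.1) * nu 2 x < e].
Proof.
move=> nu0 e0 bC b0; have [b' b'C sE] := separated_lift bC b0.
pose s (x : BG E 2) := sval (cid2 (sE (repr x))).
have s1 x : defect c b' (repr x) = \sum_(p <- s x) tensor p.1 p.2.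
  by rewrite /s; case: cid2.
have s2 x p : p \in s x -> mu p.1 = 0 by rewrite /s; case: cid2 => /= ? _; apply.
pose pj j (X : prod_mgba UU Q) : Q j := X j.
have pjh j : bool_hom (pj j) by split.
have FU : ProperFilter U := @ultra_proper _ _ UU.
have small x (d : R) : 0 < d -> U [set j | (\sum_(p <- s x) mu (pj j p.1)) * nu 2 x < d].
  move=> d0; have dn : 0 < d / nu 2 x by rewrite divr_gt0.
  have h p : p \in s x -> forall e : R, 0 < e -> U [set j | mu (pj j p.1) < e].
    move=> ps e' e'0; have := prod_mu_cvg UU (P := Q) (X := p.1).
    have -> : prod_mu U p.1 = 0 by exact: (s2 x).
    by move/(cvgr_lt _) => /(_ _ e'0).
  apply: filterS (filter_sum_small h dn) => j /=; rewrite ltr_pdivlMr //.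
have [j hj] : exists j, \sum_(x <- BG_enum E 2) (\sum_(p <- s x) mu (pj j p.1)) * nu 2 x < e.
  have := @filter_sum_small _ (BG_enum E 2)
    (fun x j => (\sum_(p <- s x) mu (pj j p.1)) * nu 2 x) (fun x _ => @small x) e e0.
  by move=> /filter_ex[j hj]; exists j.
exists j, (fun t => PA_map (pj j) (b' t)), (fun x => [seq (pj j p.1, p.2) | p <- s x]); split.
- exact: simp_cochain_map.
- move=> x; rewrite -(defect_map (pjh j)) s1 (morphB_sum (PA_mapB (pjh j))) big_map.
  by apply: eq_bigr => p _; exact: (PA_map_tensor (pjh j)).
- by under eq_bigr do rewrite big_map.
Qed.

End Ultraproduct.

(** * Borel sets of the profinite completion *)

Section FinitelyGenerated.
Variables (R : realType) (G : groupType) (E : finite_model R G).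

(** If S contains the differences of phi along representative edges, the coset (phi v) S is the same
    at both ends of every edge, hence constant on the connected complex. As phi is equivariant, S is
    all of G. *)
Lemma finite_model_fg : exists T : seq G, forall S : set G, is_subgroup S ->
  (forall t, t \in T -> S t) -> S = setT.
Proof.
have [phi phiE] := vertex_equivariant E.
exists [seq (phi (repr x ord0))^-1 * phi (repr x ord_max) | x : BG E 1 <- BG_enum E 1]%g.
move=> S Ssub ST; have [S1 SM SV] := Ssub.
have edge (e : osimplex E 1) : S ((phi (e ord0))^-1 * phi (e ord_max))%g.
  have [[g s] ->] := os_rep e; set x := \pi_(BG E 1) e.
  have Sx : S ((phi (repr x ord0))^-1 * phi (repr x ord_max))%g.
    by apply: ST; apply: map_f; rewrite in_fset_set ?inE //; exact: finite_BG.
  rewrite /= !ffunE !phiE invgM -mulgA mulKg.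
  have : s ord0 != s ord_max by rewrite (inj_eq perm_inj).
  have o2 (i : 'I_2) : i = ord0 \/ i = ord_max.
    by case: i => [[|[|i]] hi] //; [left|right]; exact: val_inj.
  have [->|->] := o2 (s ord0); have [->|->] := o2 (s ord_max); rewrite ?eqxx // => _.
  by have := SV _ Sx; rewrite invgM invgK.
have const := @contractible_connected R E (EG_contractible E) (set G) (fun v => lcoset (phi v) S).
have {}const v w : lcoset (phi v) S = lcoset (phi w) S.
  apply: const => {v w} v w; have [->//|vw /(edge_exists vw)[e [<- <-]]] := eqVneq v w.
  apply/seteqP; split=> _ [h Sh <-].
    exists ((phi (e ord_max))^-1 * phi (e ord0) * h)%g; last by rewrite -mulgA mulVKg.
    by apply: SM => //; have := SV _ (edge e); rewrite invgM invgK.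
  exists ((phi (e ord0))^-1 * phi (e ord_max) * h)%g; last by rewrite -mulgA mulVKg.
  exact: SM.
have [v0 _] := vertex_exists (EG_contractible E).
apply/seteqP; split=> // g _.
have : lcoset (phi v0) S (phi v0 * g)%g.
  rewrite (const v0 (EG_act (phi v0 * g * (phi v0)^-1)%g v0)) phiE mulgVK.
  by exists 1%g; rewrite ?mulg1.
by move=> [h Sh /mulgI <-].
Qed.

End FinitelyGenerated.

(** * Countability of the finite index normal subgroups *)

Section CountablyManySubgroups.
Variables (G : groupType) (T : seq G).
Hypothesis T_gen : forall S : set G, is_subgroup S -> (forall t, t \in T -> S t) -> S = setT.

Let T2 := T ++ [seq t^-1%g | t <- T].

Section Code.
Variable L : finite_index_subgroup G.

Definition coset_index (C : coset_space L) : nat :=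
  index C (enum_fset (fset_set [set: coset_space L])).

Lemma coset_index_inj : injective coset_index.
Proof.
move=> C D e; have inT (C' : coset_space L) : C' \in enum_fset (fset_set [set: coset_space L]).
  by rewrite in_fset_set ?inE //; exact: finite_coset_space.
by rewrite -(nth_index C (inT C)) -(nth_index C (inT D)) -/(coset_index C) e.
Qed.

Definition base_coset : coset_space L :=
  exist (fun D => D \in lcosets L) (lcoset 1%g L)
    (mem_set (imageP (fun g => lcoset g L) (I : [set: G] 1%g))).

Lemma translate_base g : (L : set G) g <-> translate g base_coset = base_coset.
Proof.
have [L1 LM LV] := fis_subgroup L.
split=> [Lg|/(congr1 val) /= e].
  apply: val_inj; rewrite /= !lcoset1; apply/seteqP; split=> x; first by move=> [h Lh <-]; exact: LM.
  by move=> Lx; exists (g^-1 * x)%g; rewrite ?mulVKg //; apply: LM => //; exact: LV.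
have : lcoset g (lcoset 1 L) (g * 1)%g by exists 1%g => //; rewrite lcoset1.
by rewrite e lcoset1 mulg1.
Qed.

Definition transition : set (nat * nat * nat) :=
  [set q | exists k C, (k < size T2)%N /\
     q = (k, coset_index C, coset_index (translate (nth 1%g T2 k) C))].

Lemma finite_transition : finite_set transition.
Proof.
apply: (@sub_finite_set _ _ ((fun p : nat * coset_space L =>
    (p.1, coset_index p.2, coset_index (translate (nth 1%g T2 p.1) p.2))) @`
    (`I_(size T2) `*` [set: coset_space L]))).
  by move=> _ [k [C [kT ->]]]; exists (k, C).
apply: finite_image; apply: finite_setX; first exact: finite_II.
exact: finite_coset_space.
Qed.

(* The action of the generators on G/L determines L, the stabilizer of the
   base coset. *)
Definition subgroup_code : nat * {fset nat * nat * nat} :=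
  (coset_index base_coset, fset_set transition).

End Code.

Lemma subgroup_code_inj (L M : finite_index_subgroup G) :
  subgroup_code L = subgroup_code M -> (L : set G) = M.
Proof.
move=> [e0 /(fset_set_inj (finite_transition L) (finite_transition M)) eT].
(* The elements that act alike on the numbers of the cosets of L and of M. The clause for g^-1 makes
   S a subgroup, and [T2] contains the inverses of the generators to match it. *)
pose S : set G := [set g | forall (C : coset_space L) (D : coset_space M), coset_index C = coset_index D ->
  coset_index (translate g C) = coset_index (translate g D) /\
  coset_index (translate g^-1%g C) = coset_index (translate g^-1%g D)].
have step t C D : t \in T2 -> coset_index C = coset_index D ->
    coset_index (translate (L := L) t C) = coset_index (translate (L := M) t D).
  move=> tT CD; have : transition L (index t T2, coset_index C, coset_index (translate t C)).
    by exists (index t T2), C; rewrite index_mem tT nth_index.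
  rewrite eT => -[k [D' [_ [<- e2 ->]]]]; rewrite nth_index //.
  by have -> : D' = D by apply: coset_index_inj; rewrite -e2 CD.
have ST : S = setT.
  apply: T_gen => [|t tT C D CD]; last first.
    by split; apply: step => //; rewrite mem_cat ?tT // map_f ?orbT.
  split=> [C D CD|g h Sg Sh C D CD|g Sg C D CD].
  - by rewrite invg1 !translate1.
  - have [h1 h2] := Sh _ _ CD; have [g1 g2] := Sg _ _ CD.
    rewrite invgM !translateM; split; first by have [] := Sg _ _ h1.
    by have [] := Sh _ _ g2.
  - by rewrite invgK; have [] := Sg _ _ CD.
apply/seteqP; split=> g /translate_base.
  move=> gC; apply/translate_base/coset_index_inj; rewrite -e0 -gC.
  have : S g by rewrite ST.
  by move=> /(_ _ _ e0)[<-].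
move=> gC; apply/translate_base/coset_index_inj; rewrite e0 -gC.
have : S g by rewrite ST.
by move=> /(_ _ _ e0)[->].
Qed.

Lemma fin_normal_eq (N M : finite_index_normal G) : (N : set G) = M -> N = M.
Proof.
case: N M => [[N sN fN] nN] [[M sM fM] nM] /= e; subst M.
rewrite (Prop_irrelevance sN sM) (Prop_irrelevance fN fM) in nN nM *.
by rewrite (Prop_irrelevance nN nM).
Qed.

Lemma countable_finite_index_normal : countable [set: finite_index_normal G].
Proof.
apply/countable_injP; exists (fun N => choice.pickle (subgroup_code N)) => N M _ _.
by move=> /(pcan_inj choice.pickleK)/subgroup_code_inj/fin_normal_eq.
Qed.

End CountablyManySubgroups.

HB.instance Definition _ (G : groupType) := gen_eqMixin (finite_index_normal G).
HB.instance Definition _ (G : groupType) := gen_choiceMixin (finite_index_normal G).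

Section Cylinders.
Variable G : groupType.
Implicit Types (N M K : finite_index_normal G) (x : profinite G).

Definition component N x : coset_space N :=
  exist (fun D => D \in lcosets N) (x N) (mem_set (prof_coset x N)).

Definition cylinder N (S : set (coset_space N)) : set (profinite G) :=
  component N @^-1` S.

Lemma cylinder_open N S : open (@cylinder N S).
Proof.
suff : prof_open (@cylinder N S) by [].
move=> x Sx; exists [set N] => // y yx.
rewrite /cylinder /=; have -> // : component N y = component N x.
by apply: val_inj => /=; exact: yx.
Qed.

Lemma lcoset_self (L : set G) g : is_subgroup L -> lcoset g L g.
Proof. by move=> sL; exists 1%g; [exact: subg1|rewrite mulg1]. Qed.

Lemma lcoset_eq (L : set G) g h : is_subgroup L -> lcoset g L h -> lcoset h L = lcoset g L.
Proof.
move=> sL [k Lk <-]; apply/seteqP; split=> _ [l Ll <-].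
  by exists (k * l)%g; [exact: subgM|rewrite mulgA].
exists (k^-1 * l)%g; first by apply: subgM => //; exact: subgV.
by rewrite -mulgA mulVKg.
Qed.

Lemma component_refine K N : (K : set G) `<=` N ->
  exists h : coset_space K -> coset_space N, forall x, component N x = h (component K x).
Proof.
move=> KN; have sN := fis_subgroup N; have sK := fis_subgroup K.
have hP (C : coset_space K) : exists D : coset_space N, val C `<=` val D.
  have := valP C; rewrite inE => -[g _ gC].
  have gN : lcoset g N \in lcosets N by rewrite inE; exists g.
  exists (exist (fun D => D \in lcosets N) _ gN) => /=.
  by rewrite -gC => _ [k Kk <-]; exists k => //; exact: KN.
exists (fun C => sval (cid (hP C))) => x; case: cid => D /= CD; apply: val_inj => /=.
have := valP D; rewrite inE => -[d _ dD]; have [n _ nx] := prof_coset x N.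
have [k _ kx] := prof_coset x K.
have xk : x K k by rewrite -kx; exact: lcoset_self.
have := CD _ xk; rewrite -dD => /(lcoset_eq sN) <-.
have := prof_compat KN xk; rewrite -nx => /(lcoset_eq sN) <- //.
Qed.

Lemma fin_normal_meet N M : exists K, (K : set G) `<=` N /\ (K : set G) `<=` M.
Proof.
have sN := fis_subgroup N; have sM := fis_subgroup M.
pose S : set G := (N : set G) `&` M.
have sS : is_subgroup S.
  split; first by split; exact: subg1.
    by move=> g h [? ?] [? ?]; split; exact: subgM.
  by move=> g [? ?]; split; exact: subgV.
have fS : finite_set (lcosets S).
  apply: (@sub_finite_set _ _ ((fun p => p.1 `&` p.2) @` (lcosets N `*` lcosets M))).
    move=> _ [g _ <-]; exists (lcoset g N, lcoset g M); first by split; exists g.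
    apply/seteqP; split=> x /=.
      by move=> [[n Nn nx] [k Mk kx]]; exists n => //; split=> //; move: kx; rewrite -nx => /mulgI <-.
    by move=> [k [Nk Mk] <-]; split; exists k.
  by apply: finite_image; apply: finite_setX; exact: fis_finite.
have nS g h : S h -> S (g^-1 * h * g)%g by move=> [? ?]; split; exact: fin_normal.
by exists (@FiniteIndexNormal G (FiniteIndexSubgroup sS fS) nS); split=> x [].
Qed.

Lemma fin_normal_exists : exists N : finite_index_normal G, True.
Proof.
have sS : is_subgroup [set: G] by [].
have fS : finite_set (lcosets [set: G]).
  apply: (@sub_finite_set _ _ [set [set: G]]); last exact: finite_set1.
  move=> _ [g _ <-] /=; apply/seteqP; split=> // x _.
  by exists (g^-1 * x)%g; rewrite ?mulVKg.
by exists (@FiniteIndexNormal G (FiniteIndexSubgroup sS fS) (fun _ _ _ => I)).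
Qed.

Lemma fin_normal_meets (s : seq (finite_index_normal G)) :
  exists K, forall N, N \in s -> (K : set G) `<=` N.
Proof.
elim: s => [|N s [K KP]]; first by have [N _] := fin_normal_exists; exists N.
have [K' [K'N K'K]] := fin_normal_meet N K; exists K' => M.
rewrite inE => /orP[/eqP -> //|/KP KM].
exact: subset_trans KM.
Qed.

(** A basic neighbourhood constrains finitely many components, all determined by the component at
    the intersection of the subgroups. For each N the largest cylinder inside V is taken, so the
    union runs over subgroups alone. *)
Lemma open_bigcup_cylinder (V : set (profinite G)) : open V ->
  V = \bigcup_(N in [set: finite_index_normal G]) @cylinder N [set C | @cylinder N [set C] `<=` V].
Proof.
move=> oV; have {}oV : prof_open V by [].
apply/seteqP; split=> [x Vx|x [N _]]; last by rewrite /cylinder /=; apply.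
have [D /finite_seqP[s sD] DV] := oV _ Vx; have [K KP] := fin_normal_meets s.
exists K => // y /= /(congr1 val) /= yx; apply: DV => N; rewrite sD /= => /KP KN.
have [h hE] := component_refine KN.
have : component N y = component N x by rewrite !hE; congr h; apply: val_inj.
by move/(congr1 val).
Qed.

End Cylinders.

(** * Approximation of Borel sets by cylinders *)

Section CylinderApproximation.
Variables (R : realType) (G : groupType) (m : probability (borel_profinite G) R).
Hypothesis Gcount : countable [set: finite_index_normal G].

Lemma cylinder_measurable (N : finite_index_normal G) (S : set (coset_space N)) :
  measurable (cylinder S : set (borel_profinite G)).
Proof. by apply: sub_sigma_algebra; exact: cylinder_open. Qed.

Definition approximable (E : set (borel_profinite G)) : Prop :=
  measurable E /\ forall e : R, 0 < e -> exists (N : finite_index_normal G) (S : set (coset_space N)),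
    (m ((E `\` cylinder S) `|` (cylinder S `\` E)) < e%:E)%E.

Let sd_measurable (E F : set (borel_profinite G)) : measurable E -> measurable F ->
  measurable ((E `\` F) `|` (F `\` E)).
Proof. by move=> mE mF; apply: measurableU; exact: measurableD. Qed.

Let measure_cover (E F H : set (borel_profinite G)) (e e' : R) :
  measurable E -> measurable F -> measurable H -> H `<=` E `|` F ->
  (m E < e%:E)%E -> (m F < e'%:E)%E -> (m H < (e + e')%:E)%E.
Proof.
move=> mE mF mH HEF Ee Fe; rewrite EFinD.
apply: (@le_lt_trans _ _ (m E + m F)%E); last exact: lteD.
apply: (@le_trans _ _ (m (E `|` F))); last exact: measureU2; apply: le_measure => //; rewrite ?inE //.
exact: measurableU.
Qed.

Lemma approximable_cylinder (N : finite_index_normal G) (S : set (coset_space N)) :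
  approximable (cylinder S).
Proof.
split=> [|e e0]; first exact: cylinder_measurable.
by exists N, S; rewrite setDv setU0 measure0 lte_fin.
Qed.

Lemma approximableC E : approximable E -> approximable (~` E).
Proof.
move=> [mE aE]; split=> [|e e0]; first exact: measurableC.
have [N [S SE]] := aE e e0; exists N, (~` S).
have -> : cylinder (~` S) = ~` (cylinder S : set (borel_profinite G)) by [].
suff -> : (~` E `\` cylinder (~` S)) `|` (cylinder (~` S) `\` ~` E) =
    (E `\` cylinder S) `|` (cylinder S `\` E) by [].
apply/seteqP; split=> x /=.
  by move=> [[nE /contrapT Sx]|[nS /contrapT Ex]]; [right|left].
by move=> [[Ex nS]|[Sx nE]]; [right; split=> // nE; exact: nE|left; split=> // nS; exact: nS].
Qed.

Lemma approximableU E F : approximable E -> approximable F -> approximable (E `|` F).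
Proof.
move=> [mE aE] [mF aF]; split=> [|e e0]; first exact: measurableU.
have e2 : 0 < e / 2 by lra.
have [N [S SE]] := aE _ e2; have [M [T TF]] := aF _ e2.
have [K [KN KM]] := fin_normal_meet N M.
have [h hE] := component_refine KN; have [k kE] := component_refine KM.
have SK : cylinder S = cylinder (h @^-1` S) by apply/funext => x; rewrite /cylinder /= hE.
have TK : cylinder T = cylinder (k @^-1` T) by apply/funext => x; rewrite /cylinder /= kE.
exists K, (h @^-1` S `|` k @^-1` T).
have -> : cylinder (h @^-1` S `|` k @^-1` T) = cylinder S `|` cylinder T by rewrite SK TK.
have mS := cylinder_measurable S; have mT := cylinder_measurable T.
have -> : e = e / 2 + e / 2 by lra.
apply: (measure_cover _ _ _ _ SE TF); try exact: sd_measurable.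
  by apply: sd_measurable => //; exact: measurableU.
move=> x /= [[[Ex|Fx] nST]|[[Sx|Tx] nEF]].
- by left; left; split=> // Sx; apply: nST; left.
- by right; left; split=> // Tx; apply: nST; right.
- by left; right; split=> // Ex; apply: nEF; left.
- by right; right; split=> // Fx; apply: nEF; right.
Qed.

Lemma approximable0 : approximable set0.
Proof.
have [N _] := fin_normal_exists G.
have -> : set0 = cylinder (set0 : set (coset_space N)) by [].
exact: approximable_cylinder.
Qed.

(** By continuity from above, the union exceeds some finite partial union [H n] by less than e / 2,
    and [H n] is itself approximated up to e / 2. *)
Lemma approximable_bigcup (F : nat -> set (borel_profinite G)) :
  (forall n, approximable (F n)) -> approximable (\bigcup_n F n).
Proof.
move=> aF; have mF n : measurable (F n) by have [] := aF n.
have mU : measurable (\bigcup_n F n) by exact: bigcup_measurable.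
split=> // e e0; have e2 : 0 < e / 2 by lra.
pose H n := \bigcup_(i < n) F i.
have aH n : approximable (H n).
  rewrite /H bigcup_mkord; elim/big_ind: _ => [|A B|i _] //.
  - exact: approximable0.
  - exact: approximableU.
have mH n : measurable (H n) by have [] := aH n.
pose D n := (\bigcup_n F n) `\` H n.
have mD n : measurable (D n) by exact: measurableD.
have D0 : \bigcap_n D n = set0.
  apply/seteqP; split=> // x Dx; have [[n _ Fx] _] := Dx 0%N I.
  by have [_] := Dx n.+1 I; apply; exists n => //=.
have Dlty : (m (D 0%N) < +oo)%E.
  by rewrite ltey_eq fin_num_measure.
have mD0 : measurable (\bigcap_n D n) by rewrite D0.
have homoD : {homo D : n k / (n <= k)%N >-> (k <= n)%O}.
  move=> n k nk; apply/subsetPset => x [Ux nH]; split=> // -[i /= lt_in Fi].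
  by apply: nH; exists i => //=; exact: leq_trans nk.
have lt_open : open [set y : \bar R | (y < (e / 2)%:E)%E] by exact: open_ereal_lt_ereal.
have nb : nbhs (m (\bigcap_n D n)) [set y : \bar R | (y < (e / 2)%:E)%E].
  by apply: open_nbhs_nbhs; split=> //=; rewrite D0 measure0 lte_fin.
have [n _ Dn] := nonincreasing_cvg_mu Dlty mD mD0 homoD nb.
have {}Dn : (m (D n) < (e / 2)%:E)%E by apply: Dn => /=.
have [_ /(_ _ e2)[N [S HS]]] := aH n; exists N, S.
have mS := cylinder_measurable S.
have -> : e = e / 2 + e / 2 by lra.
apply: (measure_cover (mD n) _ _ _ Dn HS); try exact: sd_measurable.
move=> x /= [[Ux nS]|[Sx nU]].
  by have [Hx|nHx] := pselect (H n x); [right; left|left; split].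
by right; right; split=> // -[i _ Fi]; apply: nU; exists i.
Qed.

Lemma approximable_open (V : set (profinite G)) : open V -> approximable V.
Proof.
move=> /open_bigcup_cylinder ->; have [N0 _] := fin_normal_exists G.
have /countable_injP[f fi] := Gcount.
(* A number that codes no subgroup gives the default [N0], which only repeats a term of the
   union. *)
pose g n : finite_index_normal G := xget N0 [set N | f N = n].
rewrite (_ : \bigcup_(N in _) _ = \bigcup_n (@cylinder _ (g n) [set C | @cylinder _ (g n) [set C] `<=` V])).
  by apply: approximable_bigcup => n; exact: approximable_cylinder.
apply/seteqP; split=> [x [N _ Nx]|x [n _ nx]]; last by exists (g n).
exists (f N) => //; have -> // : g (f N) = N.
by apply: fi; rewrite ?inE //; apply: (@xgetPex _ N0 [set M | f M = f N]); exists N.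
Qed.

Lemma approximable_measurable E : measurable E -> approximable E.
Proof.
have sa : sigma_algebra setT approximable.
  split; first exact: approximable0.
    by move=> A aA; rewrite setTD; exact: approximableC.
  exact: approximable_bigcup.
move=> mE; apply: mE; split=> // V oV; exact: approximable_open.
Qed.

End CylinderApproximation.

(** * Uniqueness of the invariant measure on G/L *)

Section UniformMeasure.
Variables (R : realType) (G : groupType) (L : finite_index_subgroup G).

Let T := fset_set [set: coset_space L].
Let inT C : C \in T.
Proof. by rewrite in_fset_set ?inE //; exact: finite_coset_space. Qed.

Lemma invariant_measure_uniform (F : set (coset_space L) -> R) :
  F set0 = 0 -> (forall S W, F S = F (S `&` W) + F (S `\` W)) -> F setT = 1 ->
  (forall g S, F (coset_act g S) = F S) ->
  forall S, F S = (\sum_(i : T) `[< S (val i) >]%:R) / (\sum_(i : T) 1).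
Proof.
move=> F0 FS FT Fact; pose a := F [set base_coset L].
have Fa D : F [set D] = a.
  have [g _ gD] : lcosets L (val D) by have := valP D; rewrite inE.
  rewrite /a -(Fact g [set base_coset L]); congr F; apply/seteqP; split=> C; rewrite /coset_act /=.
    move=> ->; apply: val_inj; rewrite /= -gD -lcosetM mulVg.
    by rewrite !lcoset1.
  move=> /(congr1 (translate g)); rewrite -translateM mulgV translate1 => ->.
  by apply: val_inj; rewrite /= lcoset1.
have FE S : F S = (\sum_(i : T) `[< S (val i) >]%:R) * a.
  rewrite (level_split (fun C : coset_space L => [` inT C]%fset) F0 FS) mulr_suml.
  apply: eq_bigr => i _; case: asboolP => Si.
    rewrite mul1r -(Fa (val i)); congr F; apply/seteqP; split=> C /=; first by move=> [_ <-].
    by move=> ->; split=> //; exact: val_inj.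
  rewrite mul0r -F0; congr F; apply/seteqP; split=> // C /= [SC Ci].
  by apply: Si; rewrite -Ci.
have := FE setT; under eq_bigr do rewrite asboolT //.
rewrite FT => e S; rewrite FE; congr (_ * _).
have n0 : \sum_(i : T) 1 != 0 :> R.
  by apply: contra_eq_neq e => ->; rewrite mul0r oner_neq0.
by apply: (mulfI n0); rewrite -e mulfV.
Qed.

End UniformMeasure.

Section Haar.
Variables (R : realType) (G : groupType) (m : probability (borel_profinite G) R).
Variable hm : is_haar m.
Local Notation B := (borel_mgba hm).

Definition cylinder_map (N : finite_index_normal G) (S : transitive_mgba R N) : B :=
  BorelSet (@cylinder_measurable G N S).

Lemma cylinder_map_hom N : bool_hom (@cylinder_map N).
Proof. by split=> *; exact: borel_eq. Qed.

Lemma component_translate (N : finite_index_normal G) g x :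
  component N (prof_mul (prof_of g) x) = translate g (component N x).
Proof.
apply: val_inj => /=; have [k _ <-] := prof_coset x N.
by rewrite lcoset_mul lcosetM.
Qed.

Lemma cylinder_map_act (N : finite_index_normal G) g (S : transitive_mgba R N) :
  cylinder_map (mact g S) = mact g (cylinder_map S).
Proof.
apply: borel_eq; apply/seteqP; split=> x; rewrite /= /cylinder /= /coset_act /=;
  by rewrite component_translate.
Qed.

(** The Haar measure of cylinders and the normalized counting measure are both invariant
    probabilities on G/N, so both have the value given by [invariant_measure_uniform]. *)
Lemma cylinder_map_mu (N : finite_index_normal G) (S : transitive_mgba R N) : mu (cylinder_map S) = mu S.
Proof.
rewrite [RHS](invariant_measure_uniform (F := @coset_mu R G N)); first last.
- exact: coset_mu_act.
- exact: bmu1 (coset_measure R N).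
- by move=> X Y; exact: (@mu_split R G (transitive_mgba R N)).
- exact: bmu0 (coset_measure R N).
apply: (invariant_measure_uniform (F := fun S : transitive_mgba R N => mu (cylinder_map S))).
- by rewrite (bool_hom0 (cylinder_map_hom N)); exact: bmu0 (mu_measure B).
- by move=> X Y; rewrite (mu_split _ (cylinder_map Y)); congr (mu _ + mu _); exact: borel_eq.
- by rewrite (bool_hom1 (cylinder_map_hom N)); exact: bmu1 (mu_measure B).
- by move=> g X; rewrite (cylinder_map_act g) mu_act.
Qed.

Variable A : finZmodType.

(** A replacement for a bound on [mu_PA] over Borel sets: it is subadditive by concatenation of
    presentations, and [small_mu_PA] turns it back into a bound over G/N. *)
Definition small (y : PA B A) (r : R) : Prop :=
  exists2 s : seq (B * A), y = \sum_(p <- s) tensor p.1 p.2 & \sum_(p <- s) mu p.1 <= r.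

Lemma smallB x y r r' : small x r -> small y r' -> small (x - y) (r + r').
Proof.
move=> [s -> sr] [t -> tr]; exists (s ++ [seq (p.1, - p.2) | p <- t]); last first.
  by rewrite big_cat big_map lerD.
rewrite big_cat big_map -sumrN; congr (_ + _).
by apply: eq_bigr => p _; rewrite tensorNr.
Qed.

Lemma small0 : small 0 0.
Proof. by exists [::]; rewrite big_nil. Qed.

Lemma smallN x r : small x r -> small (- x) r.
Proof. by move=> sx; have := smallB small0 sx; rewrite !add0r. Qed.

Lemma smallD x y r r' : small x r -> small y r' -> small (x + y) (r + r').
Proof. by move=> sx /smallN sy; rewrite -[y]opprK; exact: smallB. Qed.

Lemma small_sign x r (n : nat) : small x r -> small (x *~ (-1) ^+ n) r.
Proof.
rewrite -signr_odd; case: (odd n); rewrite ?expr0 ?expr1 ?mulr1z ?mulrN1z //.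
exact: smallN.
Qed.

Lemma small_act g x r : small x r -> small (gm_act g x) r.
Proof.
move=> [s -> sr]; exists [seq (mact g p.1, p.2) | p <- s].
  rewrite (morphB_sum (gm_actB g)) big_map; apply: eq_bigr => p _.
  exact: PA_act_tensor.
by rewrite big_map; under eq_bigr do rewrite mu_act.
Qed.

Lemma small_tensor X Y a : small (tensor X a - tensor Y a) (mu (X `\` Y)%O + mu (Y `\` X)%O).
Proof.
exists [:: ((X `\` Y)%O, a); ((Y `\` X)%O, - a)]; last by rewrite !big_cons big_nil addr0.
rewrite !big_cons big_nil addr0 /= tensorNr (tensorUI X Y) [tensor Y a](tensorUI Y X).
by rewrite [(Y `&` X)%O]meetC opprD addrACA subrr add0r.
Qed.

Lemma small_le x r r' : r <= r' -> small x r -> small x r'.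
Proof. by move=> rr [s sx sr]; exists s => //; exact: le_trans rr. Qed.

(** Evaluation at a point x of the profinite completion shows that the cylinder over the support of
    y is covered by the sets of the presentation; cylinders keep their measure. *)
Lemma small_mu_PA (N : finite_index_normal G) (y : PA (transitive_mgba R N) A) r :
  small (PA_map (@cylinder_map N) y) r -> mu_PA y <= r.
Proof.
move=> [s ys sr]; rewrite mu_PA_transitive -[X in X <= _]/(mu (_ : transitive_mgba R N)).
apply: le_trans sr; rewrite -cylinder_map_mu.
pose chi x (X : B) := `[< (X : set (borel_profinite G)) x >].
have chiP x : is_char (chi x).
  split=> [X Y|X]; first by rewrite /chi; apply/asboolP/andP => [[? ?]|[/asboolP ? /asboolP ?]]; split=> //; exact/asboolP.
  by rewrite /chi -asbool_neg; congr asbool.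
have evE x : PA_ev (chi x) (PA_map (@cylinder_map N) y) = PA_ev (point_char (component N x)) y.
  move: y {ys}; apply: PA_hom_eq => [u v|u v|X a].
  - by rewrite (PA_mapB (cylinder_map_hom N) u v) (PA_evB (chiP x)).
  - by rewrite (PA_evB (point_charP R (component N x))).
  - rewrite (PA_map_tensor (cylinder_map_hom N)) (PA_ev_tensor (chiP x)).
    by rewrite (PA_ev_tensor (point_charP R (component N x))).
have sub : (cylinder_map [set C | PA_ev (point_char C) y != 0] : set (borel_profinite G)) `<=`
    [set x | exists2 p, p \in s & (p.1 : set (borel_profinite G)) x].
  move=> x; rewrite /= /cylinder /= -evE ys (morphB_sum (PA_evB (chiP x))) => ev0.
  apply: contrapT => nx; move/eqP: ev0; apply; rewrite big_seq big1 // => p ps.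
  rewrite (PA_ev_tensor (chiP x)) /chi asboolF // => px.
  by apply: nx; exists p.
elim: s (cylinder_map _) sub {ys} => [|p s IH] X sub.
  rewrite big_nil [X](_ : _ = \bot%O) ?(bmu0 (mu_measure B)) //; apply: borel_eq.
  by apply/seteqP; split=> // x /sub[].
rewrite big_cons (mu_split X p.1) lerD //; first exact/le_mu/leIr.
apply: IH => x [Xx npx]; have [q] := sub x Xx; rewrite inE => /orP[/eqP ->|qs qx] //.
by exists q.
Qed.

Hypothesis Gcount : countable [set: finite_index_normal G].

Lemma cylinder_map_refine (K N : finite_index_normal G) (y : PA (transitive_mgba R N) A) :
  (K : set G) `<=` N -> exists y' : PA (transitive_mgba R K) A,
  PA_map (@cylinder_map K) y' = PA_map (@cylinder_map N) y.
Proof.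
move=> /component_refine[h hE].
pose f (X : transitive_mgba R N) : transitive_mgba R K := h @^-1` (X : set (coset_space N)).
have fh : bool_hom f by split.
exists (PA_map f y); move: y; apply: PA_hom_eq => [x y|x y|X a].
- by rewrite (PA_mapB fh x y) (PA_mapB (cylinder_map_hom K) (PA_map f x) (PA_map f y)).
- exact: (PA_mapB (cylinder_map_hom N) x y).
- rewrite (PA_map_tensor fh) (PA_map_tensor (cylinder_map_hom K)) (PA_map_tensor (cylinder_map_hom N)).
  by congr tensor; apply: borel_eq; apply/seteqP; split=> x; rewrite /= /cylinder /= hE.
Qed.

Lemma cylinder_dense (y : PA B A) (e : R) : 0 < e ->
  exists (N : finite_index_normal G) (y' : PA (transitive_mgba R N) A),
    small (y - PA_map (@cylinder_map N) y') e.
Proof.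
elim/PA_ind: y e => [|x y IHx IHy|X a] e e0.
- have [N _] := fin_normal_exists G; exists N, 0.
  by rewrite (morphB0 (PA_mapB (cylinder_map_hom N))) subr0; exact: small_le (ltW e0) small0.
- have e2 : 0 < e / 2 by lra.
  have [N [x' xx']] := IHx _ e2; have [M [y' yy']] := IHy _ e2.
  have [K [KN KM]] := fin_normal_meet N M.
  have [x2 x2E] := cylinder_map_refine x' KN; have [y2 y2E] := cylinder_map_refine y' KM.
  exists K, (x2 - y2); rewrite (PA_mapB (cylinder_map_hom K) x2 y2) x2E y2E.
  have -> : x - y - (PA_map (@cylinder_map N) x' - PA_map (@cylinder_map M) y') =
      (x - PA_map (@cylinder_map N) x') - (y - PA_map (@cylinder_map M) y').
    by rewrite !opprB [LHS](AC (2*2) ((1*4)*(3*2))).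
  have -> : e = e / 2 + e / 2 by lra.
  exact: smallB.
- have [_ /(_ _ e0)[N [S XS]]] := approximable_measurable m Gcount (borel_measurable X).
  exists N, (tensor (S : transitive_mgba R N) a); rewrite (PA_map_tensor (cylinder_map_hom N)).
  pose Y : B := cylinder_map (S : transitive_mgba R N).
  apply: small_le (small_tensor X Y a).
  rewrite -(bmuUI (mu_measure B)) [X in _ + mu X](_ : _ = \bot%O); last first.
    by apply: borel_eq; apply/seteqP; split=> // x [[? ?] [? ?]].
  rewrite (bmu0 (mu_measure B)) addr0 -lee_fin /= /borel_mu fineK; first exact: ltW XS.
  by apply: fin_num_measure; exact: borel_measurable.
Qed.

Lemma cylinder_dense_seq (K : eqType) (r : seq K) (y : K -> PA B A) (e : R) : 0 < e ->
  exists N : finite_index_normal G, forall k, k \in r ->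
  exists y' : PA (transitive_mgba R N) A, small (y k - PA_map (@cylinder_map N) y') e.
Proof.
move=> e0; elim: r => [|k r [N NP]]; first by have [N _] := fin_normal_exists G; exists N.
have [M [y' yy']] := cylinder_dense (y k) e0.
have [L [LN LM]] := fin_normal_meet N M; exists L => j; rewrite inE => /orP[/eqP ->|/NP[z yz]].
  by have [z zE] := cylinder_map_refine y' LM; exists z; rewrite zE.
by have [z' zE] := cylinder_map_refine z LN; exists z'; rewrite zE.
Qed.

End Haar.

Section HaarDefect.
Variables (R : realType) (A : finZmodType) (G : groupType) (E : finite_model R G).
Variables (m : probability (borel_profinite G) R) (hm : is_haar m).

(** On the finitely many representative edges the values of a Borel lift are replaced by cylinder
    values for one common N; equivariance and invariance of the measure carry the estimate to all
    edges. *)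
Lemma haar_defect_small c (b : simp_ambient E (PA (haar_mgba hm) A) 1) (d : R) : 0 < d ->
  @simp_cochain _ _ E (PA (haar_mgba hm) A) 1 b -> (forall t, defect c b t = 0) ->
  exists (L : finite_index_subgroup G) (b' : simp_ambient E (PA (transitive_mgba R L) A) 1),
    @simp_cochain _ _ E (PA (transitive_mgba R L) A) 1 b' /\
    forall t, mu_PA (defect c b' t) <= d.
Proof.
move=> d0 bC b0; have [b1 b1C b1E] := separated_lift bC b0.
(* One third for each edge of a triangle; the defect of the lift [b1] itself has a presentation of
   size 0. *)
have d3 : 0 < d / 3 by lra.
have [T /countable_finite_index_normal Gcount] := finite_model_fg E.
have [N NP] := @cylinder_dense_seq R G m hm A Gcount _ (BG_enum E 1) (fun x => b1 (repr x)) _ d3.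
have inB (x : BG E 1) : x \in BG_enum E 1 by rewrite in_fset_set ?inE //; exact: finite_BG.
pose c0 e := sval (cid (NP _ (inB (\pi_(BG E 1) e)))).
have c0E (x : BG E 1) : small (b1 (repr x) - PA_map (@cylinder_map _ _ _ hm N) (c0 (repr x))) (d / 3).
  by rewrite /c0; case: cid => z /=; rewrite reprK.
have [b2 b2C b2E] := cochain_extend (M := PA (transitive_mgba R N) A) c0.
exists N, b2; split=> // t; apply: (@small_mu_PA _ _ _ hm).
have kh := cylinder_map_hom hm N.
have near e : small (b1 e - PA_map (@cylinder_map _ _ _ hm N) (b2 e)) (d / 3).
  have b3C := simp_cochain_map kh (@cylinder_map_act _ _ _ hm N) b2C.
  have [[g s] ->] := os_rep e; have [b3g b3s] := b3C; have [b1g b1s] := b1C.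
  rewrite /= in b3g b3s; rewrite b3g b1g b3s b1s -gm_actB -mulrzBl.
  by apply: small_act; apply: small_sign; rewrite b2E.
rewrite (defect_map kh).
have [s sE s0] := b1E t.
have -> : defect c (fun t => PA_map (@cylinder_map _ _ _ hm N) (b2 t) : PA _ A) t =
    defect c b1 t + \sum_(i < 3) (b1 (os_face i t) -
      PA_map (@cylinder_map _ _ _ hm N) (b2 (os_face i t))) *~ (-1) ^+ i.
  rewrite (_ : \sum_(i < 3) _ = simp_codiff b1 t -
    simp_codiff ((fun t => PA_map (@cylinder_map _ _ _ hm N) (b2 t)) : simp_ambient E (PA (borel_mgba hm) A) 1) t).
    by rewrite /defect addrA subrK.
  by rewrite /simp_codiff -sumrB; apply: eq_bigr => i _; exact: mulrzBl.
have -> : d = 0 + (d / 3 + (d / 3 + (d / 3 + 0))) by lra.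
apply: smallD.
  exists s => //; rewrite big_seq big1 //.
rewrite !big_ord_recl big_ord0.
do 3 (apply: smallD; first exact: small_sign).
exact: small0.
Qed.

End HaarDefect.

(** * Non-vanishing of the class *)

Section NonVanishing.
Variables (R : realType) (A : finZmodType) (G : groupType).
Variables (E : finite_model R G) (nu : forall n : nat, BG E n -> R).
Hypothesis hnu : faithful_probability nu.
Hypothesis hcos : cosystolic_inequality nu A 2 (@finite_transitive_mgba R G).
Hypothesis hG : residually_finite G.
Variables (Gt : groupType) (iota : A -> Gt) (pr : Gt -> G).
Hypothesis hext : central_extension iota pr.
Variable alpha : group_cohomology (trivial_gmodule G A) 2.
Hypothesis halpha : classifies iota pr alpha.
Hypothesis hGt : ~ residually_finite Gt.

Lemma theta_neq0_weakly_contained (P : mgba R G) :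
  weakly_contained P (@finite_mgba R G) -> cohom_map (theta P A) alpha != 0.
Proof.
have [c [cC dc ctheta cnt]] := central_simplicial_cocycle E hext halpha.
have [e e0 he] := finite_lower_bound hnu hcos cC dc (cnt hG hGt).
move=> [I [U [UU [Q [_ finQ [f [fh fmu fact]]]]]]]; apply/eqP => /ctheta[b bC bE].
have [||j [b' [s [b'C sE]]]] := @ultraproduct_defect_small R A G E I U UU Q nu c
    (fun t => PA_map f (b t)) e (hnu 2).1 e0.
- exact: simp_cochain_map.
- by move=> t; rewrite -(defect_map fh) /defect bE subrr (morphB0 (PA_mapB fh)).
- by rewrite ltNge; apply/negP/negPn; exact: he b'C s sE.
Qed.

Lemma theta_neq0_haar (m : probability (borel_profinite G) R) (hm : is_haar m) :
  cohom_map (theta (haar_mgba hm) A) alpha != 0.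
Proof.
have [c [cC dc ctheta cnt]] := central_simplicial_cocycle E hext halpha.
have [e e0 he] := transitive_lower_bound hnu hcos cC dc (cnt hG hGt).
apply/eqP => /ctheta[b bC bE].
pose V := \sum_(x <- BG_enum E 2) @nu 2 x.
have V0 : 0 <= V by apply: sumr_ge0 => x _; rewrite ltW // (hnu 2).1.
(* V is the total mass of nu on the 2-simplices, 1 or, if there are none, 0; the denominator V + 1
   covers both cases and makes the final inequality strict. *)
have d0 : 0 < e / (V + 1) by rewrite divr_gt0 //; lra.
have [|L [b' [b'C b'd]]] := haar_defect_small (c := c) d0 bC.
  by move=> t; rewrite /defect bE subrr.
have := he L b' b'C; rewrite leNgt => /negP; apply.
apply: (@le_lt_trans _ _ (e / (V + 1) * V)).
  by rewrite mulr_sumr; apply: ler_sum => x _; rewrite ler_wpM2r ?b'd // ltW // (hnu 2).1.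
by rewrite mulrAC ltr_pdivrMr; [rewrite ltr_pM2l //|]; lra.
Qed.

End NonVanishing.

Theorem theorem2p16 (R : realType) (A : finZmodType) (G : groupType)
    (hG : residually_finite G)
    (E : finite_model R G) (nu : forall n : nat, BG E n -> R)
    (hnu : faithful_probability nu)
    (hcos : cosystolic_inequality nu A 2 (@finite_transitive_mgba R G))
    (Gt : groupType) (iota : A -> Gt) (pr : Gt -> G)
    (hext : central_extension iota pr)
    (alpha : group_cohomology (trivial_gmodule G A) 2)
    (halpha : classifies iota pr alpha)
    (hGt : ~ residually_finite Gt) :
  (forall P : mgba R G, weakly_contained P (@finite_mgba R G) ->
     cohom_map (theta P A) alpha != 0) /\
  (forall (m : probability (borel_profinite G) R) (hm : is_haar m),
     cohom_map (theta (haar_mgba hm) A) alpha != 0).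
Proof.
split=> [P|m hm].
  exact: (theta_neq0_weakly_contained hnu hcos hG hext halpha hGt).
exact: (theta_neq0_haar hnu hcos hG hext halpha hGt).
Qed.
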